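(* Let $I$, $\{\Lambda_k\}_{k\in I}$, $\{V_k\}_{k\in I}$, $\{\Phi_k\}_{k\in I}$, $H_{k+1}$, $G_{k+1}^{(m)}$, $\Psi_k^{(m)}$, $\nu_{k,\ell}$, $d_k$ and $P_k$ be as described in the context; in particular conditions (i), (ii), (iii) given there are assumed. Assume in addition that for every $k\in I$, $$P_k(\gamma)^*P_k(\gamma)=d_k I_{d_k}\quad\text{for a.e. } \gamma\in V_k .$$ Then the generalized shift-invariant system $$\{T_\lambda \mathcal F^{-1}\Phi_{k_0}\}_{\lambda\in\Lambda_{k_0}}\ \bigcup\ \{T_\lambda\mathcal F^{-1}\Psi_k^{(m)}\}_{k\ge k_0,\ \lambda\in\Lambda_k,\ m=1,\dots,\rho_k}$$ forms a tight frame for $L^2(G)$ with frame bound $1$.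
   Context: **Groups.** $G$ is a locally compact abelian (LCA) group, written additively, Hausdorff, metrizable and a countable union of compact sets. $\widehat G$ is its dual group of continuous characters (also written additively), and $(x,\gamma):=\gamma(x)$ for $x\in G$, $\gamma\in\widehat G$. A Haar measure $\mu_G$ on $G$ is fixed and the Haar measure $\mu_{\widehat G}$ on $\widehat G$ is normalized so that the Fourier inversion formula holds; $\mathcal F:L^2(G)\to L^2(\widehat G)$ is the surjective isometry extending $\mathcal Ff(\gamma)=\int_G f(x)(-x,\gamma)\,dx$. For $y\in G$, $T_y:L^2(G)\to L^2(G)$, $T_yf(x)=f(x-y)$. A lattice in an LCA group is a discrete subgroup with compact quotient. The annihilator of a lattice $\Lambda\subset G$ is $\Lambda^\perp=\{\gamma\in\widehat G: (x,\gamma)=1\ \forall x\in\Lambda\}$; it is a lattice in $\widehat G$. A fundamental domain associated with a lattice is a Borel measurable relatively compact set whose translates by the lattice elements are pairwise disjoint and cover the group, both conditions being required only up to sets of measure zero. **Index set.** $I$ is a sequence of consecutive integers with first element $k_0\in\mathbb Z$, either $I=\{k\}_{k=k_0}^\infty$ or $I=\{k\}_{k=k_0}^{k_1}$. Every condition or object involving both indices $k$ and $k+1$ (including $\Psi_k^{(m)}$ and $P_k$) is understood for those $k\in I$ with $k+1\in I$. **Setup.** $\{\Lambda_k\}_{k\in I}$ is a nested sequence of lattices in $G$, $\Lambda_{k_0}\subset\Lambda_{k_0+1}\subset\cdots$. For each $k\in I$, $V_k\subset\widehat G$ is a fundamental domain associated with $\Lambda_k^\perp$. $L^\infty(V_k)$-functions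 called periodic are extended to $\widehat G$ by $\Lambda_k^\perp$-periodicity: $f(\omega+\gamma)=f(\gamma)$, $\omega\in\Lambda_k^\perp$. $\{\Phi_k\}_{k\in I}$ is a sequence in $L^2(\widehat G)$. Assume: (i) for every compact $S\subset\widehat G$ there is $K_1\in I$ with $\mu_{\widehat G}((\omega+S)\cap(\omega'+S))=0$ for all $\omega\ne\omega'$ in $\Lambda_{K_1}^\perp$; (ii) for every compact $S\subset\widehat G$ and every $\epsilon>0$ there is $K_2\in I$ such that for all $k\ge K_2$, $k\in I$: $\big|\mu_{\widehat G}(V_k)|\Phi_k(\gamma)|^2-1\big|\le\epsilon$ for all $\gamma\in S$; (iii) for all $k\in I$ there is a periodic function $H_{k+1}\in L^\infty(V_{k+1})$ with $\Phi_k(\gamma)=H_{k+1}(\gamma)\Phi_{k+1}(\gamma)$ for a.e. $\gamma\in\widehat G$. For each $k\in I$, periodic functions $G_{k+1}^{(m)}\in L^\infty(V_{k+1})$, $m=1,\dots,\rho_k$, are given, and $\Psi_k^{(m)}(\gamma):=G_{k+1}^{(m)}(\gamma)\Phi_{k+1}(\gamma)$, $\gamma\in\widehat G$. **The matrix $P_k$.** $d_k=|\Lambda_k^\perp/\Lambda_{k+1}^\perp|$ (finite), and $\{\nu_{k,\ell}\}_{\ell=1}^{d_k}\subset\Lambda_k^\perp$ is a set of coset representatives of $\Lambda_k^\perp/\Lambda_{k+1}^\perp$ with $\nu_{k,1}=0$. $P_k(\gamma)$ is the $(\rho_k+1)\times d_k$ matrix whose first row is $(H_{k+1}(\gamma+\nu_{k,\ell}))_{\ell=1}^{d_k}$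 and whose $(m+1)$-st row is $(G_{k+1}^{(m)}(\gamma+\nu_{k,\ell}))_{\ell=1}^{d_k}$, $m=1,\dots,\rho_k$. $I_{d}$ denotes the $d\times d$ identity matrix. A tight frame with frame bound $1$ for a Hilbert space $\mathcal H$ is a countable family $\{f_i\}$ with $\sum_i|\langle f,f_i\rangle|^2=\|f\|^2$ for all $f\in\mathcal H$. *)

(* Defs.v *)
From HB Require Import structures.
From mathcomp Require Import all_boot all_order all_algebra.
From mathcomp Require Import all_classical all_reals all_analysis.
From mathcomp.real_closed Require Import complex.
From mathcomp Require Import ring.
Set Implicit Arguments.
Unset Strict Implicit.
Unset Printing Implicit Defensive.
Import Order.TTheory GRing.Theory Num.Theory.
Import numFieldNormedType.Exports.
Local Open Scope classical_set_scope.
Local Open Scope ring_scope.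

(* Continuous characters of G, valued in the unit circle of R[i]; R[i]^o is R[i]
   with its norm topology. *)
Record dual_group (R : realType) (G : topologicalZmodType) := Character {
  character_fun :> G -> R[i];
  character_continuous : continuous (character_fun : G -> R[i]^o);
  character_norm : forall x, `|character_fun x| = 1;
  characterD : forall x y,
    character_fun (x + y) = character_fun x * character_fun y }.

HB.instance Definition _ R G := gen_eqMixin (dual_group R G).
HB.instance Definition _ R G := gen_choiceMixin (dual_group R G).

Section DualGroup.
Context {R : realType} {G : topologicalZmodType}.
Implicit Types chi psi : dual_group R G.

Lemma dualP chi psi : (forall x, chi x = psi x) -> chi = psi.
Proof.
case: chi psi => [f cf nf mf] [g cg ng mg] /= /funext fg.
by subst g; congr Character; exact: Prop_irrelevance.
Qed.

Lemma dual_zero_subproof : [/\ continuous (fun _ : G => 1 : R[i]^o),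
  forall x : G, `|1 : R[i]| = 1 & forall x y : G, (1 : R[i]) = 1 * 1].
Proof.
by split=> [x| _|_ _]; [exact: cvg_cst|rewrite normr1|rewrite mulr1].
Qed.

Definition dual_zero : dual_group R G :=
  Character (let: And3 c _ _ := dual_zero_subproof in c)
    (let: And3 _ n _ := dual_zero_subproof in n)
    (let: And3 _ _ m := dual_zero_subproof in m).

Lemma dual_opp_subproof chi : [/\ continuous (fun x => (chi x)^-1 : R[i]^o),
  forall x, `|(chi x)^-1| = 1
  & forall x y, (chi (x + y))^-1 = (chi x)^-1 * (chi y)^-1].
Proof.
split=> [x|x|x y].
- apply: (@cvgV R[i] G); last exact: character_continuous.
  by rewrite -normr_eq0 character_norm oner_eq0.
- by rewrite normfV character_norm invr1.
- by rewrite characterD invfM.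
Qed.

Definition dual_opp chi : dual_group R G :=
  Character (let: And3 c _ _ := dual_opp_subproof chi in c)
    (let: And3 _ n _ := dual_opp_subproof chi in n)
    (let: And3 _ _ m := dual_opp_subproof chi in m).

Lemma dual_add_subproof chi psi : [/\
  continuous (fun x => chi x * psi x : R[i]^o),
  forall x, `|chi x * psi x| = 1 & forall x y,
    chi (x + y) * psi (x + y) = (chi x * psi x) * (chi y * psi y)].
Proof.
split=> [x|x|x y].
- by apply: (@cvgM R[i] G); exact: character_continuous.
- by rewrite normrM !character_norm mulr1.
- by rewrite !characterD mulrACA.
Qed.

Definition dual_add chi psi : dual_group R G :=
  Character (let: And3 c _ _ := dual_add_subproof chi psi in c)
    (let: And3 _ n _ := dual_add_subproof chi psi in n)
    (let: And3 _ _ m := dual_add_subproof chi psi in m).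

Lemma dual_zeroE x : dual_zero x = 1.
Proof. by []. Qed.

Lemma dual_oppE chi x : dual_opp chi x = (chi x)^-1.
Proof. by []. Qed.

Lemma dual_addE chi psi x : dual_add chi psi x = chi x * psi x.
Proof. by []. Qed.

Lemma dual_addA : associative dual_add.
Proof. by move=> f g h; apply: dualP => x; rewrite !dual_addE mulrA. Qed.

Lemma dual_addC : commutative dual_add.
Proof. by move=> f g; apply: dualP => x; rewrite !dual_addE mulrC. Qed.

Lemma dual_add0 : left_id dual_zero dual_add.
Proof.
by move=> f; apply: dualP => x; rewrite dual_addE dual_zeroE mul1r.
Qed.

Lemma dual_addN : left_inverse dual_zero dual_opp dual_add.
Proof.
move=> f; apply: dualP => x; rewrite dual_addE dual_zeroE dual_oppE mulVf//.
by rewrite -normr_eq0 character_norm oner_eq0.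
Qed.

HB.instance Definition _ := GRing.isZmodule.Build (dual_group R G)
  dual_addA dual_addC dual_add0 dual_addN.

HB.instance Definition _ := Topological.copy (dual_group R G)
  (initial_topology (fun chi : dual_group R G =>
     character_fun chi : {compact-open, G -> R[i]^o})).

Lemma dual_subE chi psi x : (chi - psi) x = chi x / psi x.
Proof. by rewrite dual_addE dual_oppE. Qed.

Lemma dual_nbhs_uniform chi (K : set G) (e : R[i]) : compact K -> 0 < e ->
  nbhs chi [set psi : dual_group R G | forall x, K x -> `|chi x - psi x| < e].
Proof.
pose inc (c : dual_group R G) : {compact-open, G -> R[i]^o} := character_fun c.
move=> cK e0.
have cinc : continuous inc by exact: initial_continuous.
have [+ _] := @compact_open_fam_compactP G R[i]^o (character_fun chi)
  (inc @ chi) (@character_continuous _ _ chi)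
  (fmap_filter inc (nbhs_filter chi)).
move=> /(_ (cinc chi)) cv; exact: (cv _ (@fam_nbhs G R[i]^o _ K _
  (character_fun chi) (entourage_ball R[i]^o (PosNum e0)) cK)).
Qed.

Lemma dual_sub_continuous :
  continuous (fun p : dual_group R G * dual_group R G => p.1 - p.2).
Proof.
pose inc (c : dual_group R G) : {compact-open, G -> R[i]^o} := character_fun c.
apply: (@continuous_comp_initial _ _ _ inc) => -[chi psi].
apply/(@compact_open_fam_compactP G R[i]^o (character_fun (chi - psi))
  (inc \o (fun p => p.1 - p.2) @ (chi, psi))).
  exact: character_continuous.
apply/fam_cvgP => K cK P /uniform_nbhs[E [entE EP]].
move: entE; rewrite -entourage_ballE => -[e /= e0 eE].
have e20 : 0 < e / 2 by rewrite divr_gt0.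
exists ([set c : dual_group R G | forall x, K x -> `|chi x - c x| < e / 2],
        [set c : dual_group R G | forall x, K x -> `|psi x - c x| < e / 2]).
  by split; exact: dual_nbhs_uniform.
move=> -[c d] [/= cc dd]; apply: EP => x Kx; apply: eE => /=.
rewrite /ball /=.
have u (f : dual_group R G) : f x != 0.
  by rewrite -normr_eq0 character_norm oner_eq0.
have -> : chi x / psi x - c x / d x =
    (chi x - c x) / psi x - c x / (d x * psi x) * (psi x - d x).
  by field; rewrite !u.
apply: le_lt_trans (ler_normB _ _) _.
rewrite !normrM !normfV normrM !character_norm !(mulr1, mul1r, invr1).
by rewrite [ltRHS]splitr ltrD ?cc ?dd.
Qed.

HB.instance Definition _ :=
  PreTopologicalNmodule_isTopologicalZmodule.Build (dual_group R G)
    dual_sub_continuous.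

End DualGroup.

(* Carrier of G with its Borel sigma-algebra: g_sigma_algebraType needs a
   pointed type, hence the alias. *)
Definition borel (G : topologicalZmodType) : Type := G.

HB.instance Definition _ (G : topologicalZmodType) :=
  TopologicalZmodule.on (borel G).
HB.instance Definition _ (G : topologicalZmodType) :=
  isPointed.Build (borel G) 0.
HB.instance Definition _ (G : topologicalZmodType) :=
  @isMeasurable.Build (sigma_display (@open (borel G))) (borel G)
    <<s @open (borel G) >> (@sigma_algebra0 _ setT open) (@sigma_algebraC _ open)
    (@sigma_algebra_bigcup _ setT open).

Definition metrizable (R : realType) (T : topologicalType) :=
  exists d : T -> T -> R,
    [/\ forall x y, d x y = 0 <-> x = y,
        forall x y, d x y = d y x,
        forall x y z, d x z <= d x y + d y z
      & forall x (A : set T), nbhs x A <->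
          exists2 e, 0 < e & [set y | d x y < e] `<=` A].

Definition sigma_compact (T : topologicalType) :=
  exists K : nat -> set T,
    (forall n, compact (K n)) /\ \bigcup_n K n = [set: T].

Definition lca_group (R : realType) (G : topologicalZmodType) :=
  [/\ hausdorff_space G, locally_compact [set: G], metrizable R G
    & sigma_compact G].

(* On a sigma-compact metrizable locally compact group, a Borel measure that is
   finite on compact sets is regular, so regularity is not required here. *)
Definition haar_measure (R : realType) (G : topologicalZmodType)
    (mu : {measure set (borel G) -> \bar R}) :=
  [/\ mu setT != 0%E,
      forall K : set (borel G), compact K -> (mu K < +oo)%E
    & forall (x : borel G) (A : set (borel G)), measurable A ->
        mu (+%R x @` A) = mu A].

Section Lattices.
Context {G : topologicalZmodType}.
Implicit Types L : set G.

Definition is_subgroup L := L 0 /\ (forall x y, L x -> L y -> L (x - y)).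

Definition coset_rel L : rel G := fun x y => `[< L (x - y) >].

Lemma coset_equiv_subproof L : is_subgroup L ->
  [/\ reflexive (coset_rel L), symmetric (coset_rel L)
    & transitive (coset_rel L)].
Proof.
move=> [L0 LB]; split.
- by move=> x; apply/asboolP; rewrite subrr.
- by move=> x y; apply/asboolP/asboolP => Lxy; rewrite -opprB -sub0r;
    apply: LB.
- move=> y x z /asboolP Lxy /asboolP Lyz; apply/asboolP.
  have -> : x - z = (x - y) - (0 - (y - z)).
    by rewrite sub0r opprK addrA subrK.
  by apply: (LB) => //; exact: LB.
Qed.

Definition coset_equiv L (LS : is_subgroup L) : equiv_rel G :=
  EquivRel (coset_rel L) (let: And3 r _ _ := coset_equiv_subproof LS in r)
    (let: And3 _ s _ := coset_equiv_subproof LS in s)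
    (let: And3 _ _ t := coset_equiv_subproof LS in t).

Definition quotient_group L (LS : is_subgroup L) : topologicalType :=
  quotient_topology {eq_quot coset_equiv LS}%qT.

Definition lattice L := exists LS : is_subgroup L,
  L `<=` isolated L /\ compact [set: quotient_group LS].

Definition has_index (A B : set G) (d : nat) :=
  ([set +%R a @` B | a in A] #= `I_d)%card.

Definition coset_representatives (A B : set G) (d : nat) (nu : 'I_d -> G) :=
  (forall l, A (nu l)) /\ (forall a, A a -> exists! l, B (a - nu l)).

End Lattices.

Definition fundamental_domain (R : realType) (G : topologicalZmodType)
    (mu : {measure set (borel G) -> \bar R}) (L V : set (borel G)) :=
  [/\ measurable V, precompact V,
      forall x y, L x -> L y -> x <> y ->
        mu ((+%R x @` V) `&` (+%R y @` V)) = 0%E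
    & mu.-negligible (~` \bigcup_(x in L) (+%R x @` V))].

Definition annihilator (R : realType) (G : topologicalZmodType) (L : set G) :
  set (dual_group R G) := [set chi | forall x, L x -> chi x = 1].

Section ComplexFunctions.
Context (R : realType) {d : measure_display} {T : measurableType d}.
Variable mu : {measure set T -> \bar R}.
Implicit Types f g : T -> R[i].

Definition cmeasurable f :=
  measurable_fun setT (fun x => complex.Re (f x)) /\
  measurable_fun setT (fun x => complex.Im (f x)).

Definition cintegrable f :=
  mu.-integrable setT (fun x => (complex.Re (f x))%:E) /\
  mu.-integrable setT (fun x => (complex.Im (f x))%:E).

Definition cintegral f : R[i] := Complex
  (Rintegral mu setT (fun x => complex.Re (f x)))
  (Rintegral mu setT (fun x => complex.Im (f x))).

Definition sqnorm f : \bar R := (\int[mu]_x (Normc.normc (f x) ^+ 2)%:E)%E.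

(* L^2 is handled through representatives, identified almost everywhere. *)
Definition L2 f := cmeasurable f /\ (sqnorm f < +oo)%E.

Definition inner f g : R[i] := cintegral (fun x => f x * (g x)^*).

Definition tight_frame (J : choiceType) (S : set J) (f : J -> T -> R[i])
    (A : R) :=
  [/\ countable S, forall j, S j -> L2 (f j)
    & forall g, L2 g ->
        \esum_(j in S) (Normc.normc (inner g (f j)) ^+ 2)%:E = (A%:E * sqnorm g)%E].

End ComplexFunctions.

Section Fourier.
Context {R : realType} {G : topologicalZmodType}.
Local Notation D := (dual_group R G).
Variables (mu : {measure set (borel G) -> \bar R})
          (nu : {measure set (borel D) -> \bar R}).
Implicit Types (f g : borel G -> R[i]) (phi : borel D -> R[i]).

Definition fourier f : borel D -> R[i] :=
  fun gamma => cintegral mu (fun x : G => f x * (gamma : D) (- x)).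

Definition fourier_inversion := forall f,
  cintegrable mu f -> cintegrable nu (fourier f) ->
  {ae mu, forall x : G,
    f x = cintegral nu (fun gamma => fourier f gamma * (gamma : D) x)}.

(* F : L^2(G) -> L^2(G^) is the surjective linear isometry extending the
   Fourier integral. *)
Definition plancherel_transform (F : (borel G -> R[i]) -> (borel D -> R[i])) :=
  [/\ forall f, L2 mu f -> L2 nu (F f) /\ sqnorm nu (F f) = sqnorm mu f,
      forall (a : R[i]) f g, L2 mu f -> L2 mu g ->
        {ae nu, forall gamma,
          F (fun x => a * f x + g x) gamma = a * F f gamma + F g gamma},
      forall phi, L2 nu phi -> exists2 f, L2 mu f &
        {ae nu, forall gamma, F f gamma = phi gamma}
    & forall f, L2 mu f -> cintegrable mu f ->
        {ae nu, forall gamma, F f gamma = fourier f gamma}].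

(* A representative of F^-1 phi, for phi in L^2(G^); it is unique a.e. *)
Definition plancherel_inv (F : (borel G -> R[i]) -> (borel D -> R[i])) phi :
    borel G -> R[i] :=
  xget (fun=> 0) [set f | L2 mu f /\
    {ae nu, forall gamma, F f gamma = phi gamma}].

(* L^oo(V)-functions extended L-periodically to the whole dual group; as for
   any L^oo-function, periodicity is an a.e. identity. *)
Definition periodic_Linfty (L V : set D) (h : borel D -> R[i]) :=
  [/\ cmeasurable h,
      exists M : R, {ae nu, forall gamma, V gamma -> Normc.normc (h gamma) <= M}
    & forall omega : D, L omega ->
        {ae nu, forall gamma : D, h (omega + gamma) = h gamma}].

Definition translate (y : G) f : borel G -> R[i] := fun x : G => f (x - y).

End Fourier.

Definition consecutive_integers (k0 : int) (I : set int) :=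
  I = [set k | k0 <= k] \/
  exists2 k1, k0 <= k1 & I = [set k | k0 <= k <= k1].

Section FilterBank.
Context {R : realType} {G : topologicalZmodType}.
Local Notation D := (dual_group R G).

(* Gm k m stands for G_(k+1)^(m), and Psi Phi Gm k m for Psi_k^(m). *)
Definition Psi (rho : int -> nat) (Phi : int -> D -> R[i])
    (Gm : forall k, 'I_(rho k) -> D -> R[i]) (k : int) (m : 'I_(rho k)) :
  D -> R[i] := fun gamma => Gm k m gamma * Phi (k + 1) gamma.

(* H stands for H_(k+1), and Gm for the family G_(k+1)^(m). *)
Definition Pmx (r d : nat) (H : D -> R[i]) (Gm : 'I_r -> D -> R[i])
    (nu : 'I_d -> D) (gamma : D) : 'M[R[i]]_(1 + r, d) :=
  col_mx (\row_l H (gamma + nu l)) (\matrix_(m, l) Gm m (gamma + nu l)).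

(* Indices of the generalized shift-invariant system: the left summand is for
   the translates of the generator at level k0, the right one for those of the
   Psi_k^(m). *)
Definition gsi_index (rho : int -> nat) : Type :=
  (G + {k : int & ('I_(rho k) * G)%type})%type.

HB.instance Definition _ rho := gen_eqMixin (gsi_index rho).
HB.instance Definition _ rho := gen_choiceMixin (gsi_index rho).

Definition gsi_support (rho : int -> nat) (I : set int) (k0 : int)
    (Lam : int -> set G) : set (gsi_index rho) :=
  [set j | match j with
           | inl l => Lam k0 l
           | inr (existT k (_, l)) => [/\ I k, I (k + 1) & Lam k l]
           end].

Definition gsi_system (rho : int -> nat) (phi : G -> R[i])
    (psi : forall k, 'I_(rho k) -> G -> R[i]) (j : gsi_index rho) :
  borel G -> R[i] :=
  match j with
  | inl l => translate l phi
  | inr (existT k (m, l)) => translate l (psi k m)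
  end.

End FilterBank.

Arguments Psi {R G rho} Phi Gm k m _.

(* Main.v *)
(* Write phi for the Plancherel transform of f. For a lattice Lam with annihilator A and
   fundamental domain V of A, the functions g |-> g(l), l in Lam, restricted to V are
   orthogonal and complete in L^2(V); unfolding along V then turns
   sum_(l in Lam) |int h(g) g(l)|^2, for h in L^2 with compact support, into the finite sum
   nu(V) * sum_(w in A) int h(g) conj(h(w + g)).
   Applied to h = phi conj(Phi_k) and h = phi conj(Psi_k^(m)), with phi bounded and of compact
   support, the relation P_k^* P_k = d_k, read on cosets, together with
   nu(V_(k+1)) = d_k nu(V_k), shows that the energies of phi at level k (Phi_k and all the
   Psi_k^(m)) add up to the energy of Phi_(k+1) alone. Telescoping leaves the energy at a
   high level K, where by condition (i) only w = 0 contributes, and by condition (ii) the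
   value tends to the squared norm of phi. Such phi are dense. *)
Require Import Defs.
From HB Require Import structures.
From mathcomp Require Import all_boot all_order all_algebra.
From mathcomp Require Import all_classical all_reals all_analysis.
From mathcomp.real_closed Require Import complex.
From mathcomp Require Import measurable_realfun ring lra.
Import Order.TTheory GRing.Theory Num.Theory.
Import numFieldNormedType.Exports.
Import HBNNSimple.
Set Implicit Arguments.
Unset Strict Implicit.
Unset Printing Implicit Defensive.
Local Open Scope classical_set_scope.
Local Open Scope ring_scope.
Local Open Scope sesquilinear_scope.

(** * Complex-valued integrals and square-integrable functions *)

(** The main obstacle is completeness of the lattice characters in L^2(V), where [V] is just a Borel
    set tiling the dual up to null sets. Bounded functions whose restriction to [V] lies in the
    closed span form an algebra stable under bounded limits. Polynomials tending to the absolute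
    value bring in the indicators of half-plane conditions on g(l); since two characters that agree
    on Lam differ by an element of A, countably many such conditions describe every A-periodic open
    set on [V]. Superlevel sets then give the hit counts of open sets, a Dynkin argument those of
    Borel sets, and simple functions the periodization of any square-integrable function supported
    in a compact set. Orthogonality rests on some character being nontrivial at each nonzero lattice
    point, which comes from the Plancherel isometry. Compact supports keep every sum over an
    annihilator finite. Density alone does not carry an infinite sum of squares to the limit:
    Bessel's inequality with constant 1 is extended first, and the defect in it is then controlled
    by the parallelogram law. *)

Local Notation cRe := complex.Re.
Local Notation cIm := complex.Im.
Local Notation sqc z := (Normc.normc z ^+ 2).

Section ComplexNumbers.
Context {R : realType}.
Implicit Types z w : R[i].

Lemma conjcE (a b : R) : (Complex a b)^* = Complex a (- b).
Proof. by []. Qed.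

Lemma sqcE z : sqc z = cRe z ^+ 2 + cIm z ^+ 2.
Proof. by case: z => a b /=; rewrite sqr_sqrtr// addr_ge0// sqr_ge0. Qed.

Lemma normc_ge0 z : 0 <= Normc.normc z.
Proof. by case: z => a b; exact: sqrtr_ge0. Qed.

Lemma normc_le z : Normc.normc z <= `|cRe z| + `|cIm z|.
Proof.
rewrite -(ler_pXn2r (n := 2)) ?nnegrE ?addr_ge0 ?normc_ge0// sqcE.
by rewrite sqrrD !real_normK ?num_real// -addrAC lerDl mulrn_wge0// mulr_ge0.
Qed.

Lemma norm_Re_le z : `|cRe z| <= Normc.normc z.
Proof.
rewrite -(ler_pXn2r (n := 2)) ?nnegrE ?normc_ge0// sqcE real_normK ?num_real//.
by rewrite lerDl sqr_ge0.
Qed.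

Lemma norm_Im_le z : `|cIm z| <= Normc.normc z.
Proof.
rewrite -(ler_pXn2r (n := 2)) ?nnegrE ?normc_ge0// sqcE real_normK ?num_real//.
by rewrite lerDr sqr_ge0.
Qed.

Lemma normcC z : Normc.normc z^* = Normc.normc z.
Proof. by case: z => a b /=; rewrite sqrrN. Qed.

Lemma sqcM z w : sqc (z * w) = sqc z * sqc w.
Proof. by rewrite Normc.normcM exprMn. Qed.

Lemma sqc_ge0 z : 0 <= sqc z.
Proof. exact: sqr_ge0. Qed.

Lemma normE z : `|z| = (Normc.normc z)%:C%C.
Proof. by []. Qed.

Lemma normc1P z : (`|z| = 1) <-> (Normc.normc z = 1).
Proof. by rewrite normE; split=> [[]|->]. Qed.

Lemma mul_conjc z : z * z^* = (sqc z)%:C%C.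
Proof.
case: z => a b; rewrite conjcE sqcE /=; apply/eqP; rewrite eq_complex /=.
by apply/andP; split; apply/eqP; ring.
Qed.

Lemma sqcD z w : sqc (z + w) = sqc z + sqc w + 2 * cRe (z * w^*).
Proof. by case: z w => a b [c e]; rewrite conjcE !sqcE /=; ring. Qed.

Lemma cReM z w : cRe (z * w) = cRe z * cRe w - cIm z * cIm w.
Proof. by case: z w => a b [c e]. Qed.

Lemma cImM z w : cIm (z * w) = cRe z * cIm w + cIm z * cRe w.
Proof. by case: z w => a b [c e]. Qed.

Lemma cReD z w : cRe (z + w) = cRe z + cRe w.
Proof. by case: z w => a b [c e]. Qed.

Lemma cImD z w : cIm (z + w) = cIm z + cIm w.
Proof. by case: z w => a b [c e]. Qed.

Lemma cReC z : cRe z^* = cRe z. Proof. by case: z. Qed.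

Lemma cImC z : cIm z^* = - cIm z. Proof. by case: z. Qed.

Lemma cplxP z w : cRe z = cRe w -> cIm z = cIm w -> z = w.
Proof. by case: z w => a b [c e] /= -> ->. Qed.

End ComplexNumbers.

Section ComplexMeasurability.
Context {R : realType} {d : measure_display} {T : measurableType d}.
Implicit Types f g : T -> R[i].

Lemma cmeasurableD f g : cmeasurable f -> cmeasurable g ->
  cmeasurable (fun x => f x + g x).
Proof.
move=> [rf jf] [rg jg]; split; rewrite /=.
  by under eq_fun do rewrite cReD; exact: measurable_funD.
by under eq_fun do rewrite cImD; exact: measurable_funD.
Qed.

Lemma cmeasurableM f g : cmeasurable f -> cmeasurable g ->
  cmeasurable (fun x => f x * g x).
Proof.
move=> [rf jf] [rg jg]; split; rewrite /=.
  by under eq_fun do rewrite cReM; apply: measurable_funB; exact: measurable_funM.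
by under eq_fun do rewrite cImM; apply: measurable_funD; exact: measurable_funM.
Qed.

Lemma cmeasurable_cst (a : R[i]) : cmeasurable (fun _ : T => a).
Proof. by split; exact: measurable_cst. Qed.

Lemma cmeasurableC f : cmeasurable f -> cmeasurable (fun x => (f x)^*).
Proof.
move=> [rf jf]; split; rewrite /=.
  by under eq_fun do rewrite cReC.
by under eq_fun do rewrite cImC; exact: measurableT_comp.
Qed.

Lemma cmeasurable_real (u : T -> R) : measurable_fun setT u ->
  cmeasurable (fun x => (u x)%:C%C).
Proof. by move=> mu; split => //=; exact: measurable_cst. Qed.

Lemma cmeasurable_sum (J : Type) (s : seq J) (P : pred J) (h : J -> T -> R[i]) :
  (forall j, cmeasurable (h j)) -> cmeasurable (fun x => \sum_(j <- s | P j) h j x).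
Proof.
move=> mh; elim: s => [|j s IH].
  by under eq_fun do rewrite big_nil; exact: cmeasurable_cst.
under eq_fun do rewrite big_cons; case: (P j) => //.
exact: cmeasurableD.
Qed.

Lemma measurable_sqc f : cmeasurable f -> measurable_fun setT (fun x => sqc (f x)).
Proof.
move=> [rf jf]; under eq_fun do rewrite sqcE.
by apply: measurable_funD; exact: measurable_funX.
Qed.

Lemma measurable_normc f : cmeasurable f ->
  measurable_fun setT (fun x => Normc.normc (f x)).
Proof.
move=> mf; have -> : (fun x => Normc.normc (f x)) = Num.sqrt \o (fun x => sqc (f x)).
  by apply/funext => x /=; rewrite sqrtr_sqr ger0_norm// normc_ge0.
apply: measurableT_comp; last exact: measurable_sqc.
exact: (continuous_measurable_fun (@sqrt_continuous R)).
Qed.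

End ComplexMeasurability.

Lemma cmeasurable_comp {R : realType} {d d' : measure_display}
  {T : measurableType d} {T' : measurableType d'} (p : T -> T') (f : T' -> R[i]) :
  measurable_fun setT p -> cmeasurable f -> cmeasurable (fun x => f (p x)).
Proof.
move=> mp [rf jf]; split.
  exact: (measurableT_comp rf mp).
exact: (measurableT_comp jf mp).
Qed.

Section ComplexIntegral.
Context {R : realType} {d : measure_display} {T : measurableType d}.
Variable mu : {measure set T -> \bar R}.
Implicit Types f g : T -> R[i].

Lemma cintegrable_meas f : cintegrable mu f -> cmeasurable f.
Proof. by move=> [/measurable_int/measurable_EFinP ? /measurable_int/measurable_EFinP ?]. Qed.

Lemma cintegrable_le f (u : T -> R) : cmeasurable f ->
  mu.-integrable setT (EFin \o u) -> (forall x, Normc.normc (f x) <= u x) ->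
  cintegrable mu f.
Proof.
move=> [rf jf] iu le; split; apply: (le_integrable _ _ _ iu) => //=;
  do ?exact/measurable_EFinP.
- by move=> x _; rewrite lee_fin (le_trans (norm_Re_le _))// (le_trans (le x))// ler_norm.
- by move=> x _; rewrite lee_fin (le_trans (norm_Im_le _))// (le_trans (le x))// ler_norm.
Qed.

Lemma cintegrable_normc f : cintegrable mu f ->
  mu.-integrable setT (EFin \o (fun x => Normc.normc (f x))).
Proof.
move=> fi; have mf := cintegrable_meas fi; case: fi => rf jf.
have := integrableD measurableT (integrable_norm rf) (integrable_norm jf).
apply: le_integrable => //.
  by apply/measurable_EFinP; exact: measurable_normc.
move=> x _ /=; rewrite lee_fin ger0_norm ?normc_ge0//.
exact: le_trans (normc_le _) (ler_norm _).
Qed.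

Lemma cintegrableD f g : cintegrable mu f -> cintegrable mu g ->
  cintegrable mu (fun x => f x + g x).
Proof.
move=> [rf jf] [rg jg]; split.
  by under eq_fun do rewrite cReD; exact: (integrableD measurableT rf rg).
by under eq_fun do rewrite cImD; exact: (integrableD measurableT jf jg).
Qed.

Lemma cintegralD f g : cintegrable mu f -> cintegrable mu g ->
  cintegral mu (fun x => f x + g x) = cintegral mu f + cintegral mu g.
Proof.
move=> [rf jf] [rg jg]; rewrite /cintegral; apply: cplxP => /=.
  by under eq_Rintegral do rewrite cReD; exact: RintegralD.
by under eq_Rintegral do rewrite cImD; exact: RintegralD.
Qed.

Lemma cintegrableZ (a : R[i]) f : cintegrable mu f ->
  cintegrable mu (fun x => a * f x).
Proof.
move=> fi; apply: (@cintegrable_le _ (fun x => Normc.normc a * Normc.normc (f x))).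
- by apply: cmeasurableM; [exact: cmeasurable_cst|exact: (cintegrable_meas fi)].
- exact: (integrableZl measurableT _ (cintegrable_normc fi)).
- by move=> x; rewrite Normc.normcM.
Qed.

Lemma cintegralZ (a : R[i]) f : cintegrable mu f ->
  cintegral mu (fun x => a * f x) = a * cintegral mu f.
Proof.
move=> [rf jf]; rewrite /cintegral; apply: cplxP => /=; case: a => a b /=.
  under eq_Rintegral do rewrite cReM /=.
  by rewrite RintegralB// ?RintegralZl//;
    [exact: (integrableZl measurableT a rf)|exact: (integrableZl measurableT b jf)].
under eq_Rintegral do rewrite cImM /=.
by rewrite RintegralD// ?RintegralZl//;
  [exact: (integrableZl measurableT a jf)|exact: (integrableZl measurableT b rf)].
Qed.

Lemma cintegralC f : cintegrable mu f ->
  cintegral mu (fun x => (f x)^*) = (cintegral mu f)^*.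
Proof.
move=> [rf jf]; rewrite /cintegral; apply: cplxP => /=.
  by under eq_Rintegral do rewrite cReC.
under eq_Rintegral do rewrite cImC.
rewrite -[RHS]mulN1r -RintegralZl//.
by apply: eq_Rintegral => x _; rewrite mulN1r.
Qed.

Lemma cintegrable0 : cintegrable mu (fun=> 0).
Proof. by split; exact: integrable0. Qed.

Lemma cintegral0 : cintegral mu (fun=> 0) = 0.
Proof. by apply: cplxP => /=; rewrite /Rintegral integral0_eq. Qed.

Lemma cintegrable_sum (J : Type) (s : seq J) (h : J -> T -> R[i]) :
  (forall j, cintegrable mu (h j)) -> cintegrable mu (fun x => \sum_(j <- s) h j x).
Proof.
move=> ih; elim: s => [|j s IH].
  by under eq_fun do rewrite big_nil; exact: cintegrable0.
by under eq_fun do rewrite big_cons; exact: cintegrableD.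
Qed.

Lemma cintegral_sum (J : Type) (s : seq J) (h : J -> T -> R[i]) :
  (forall j, cintegrable mu (h j)) ->
  cintegral mu (fun x => \sum_(j <- s) h j x) = \sum_(j <- s) cintegral mu (h j).
Proof.
move=> ih; elim: s => [|j s IH].
  by under eq_fun do rewrite big_nil; rewrite cintegral0 big_nil.
under eq_fun do rewrite big_cons; rewrite cintegralD// ?IH ?big_cons//.
exact: cintegrable_sum.
Qed.

Lemma ae_eq_Rintegral (u v : T -> R) : measurable_fun setT u ->
  measurable_fun setT v -> {ae mu, forall x, u x = v x} ->
  Rintegral mu setT u = Rintegral mu setT v.
Proof.
move=> hu hv uv; congr fine; apply: ae_eq_integral => //; try exact/measurable_EFinP.
by apply: filterS uv => x uv _ /=; rewrite uv.
Qed.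

Lemma ae_eq_cintegral f g : cmeasurable f -> cmeasurable g ->
  {ae mu, forall x, f x = g x} -> cintegral mu f = cintegral mu g.
Proof.
move=> [rf jf] [rg jg] fg; apply: cplxP; apply: ae_eq_Rintegral => //;
  by apply: filterS fg => x ->.
Qed.

End ComplexIntegral.

Section SquareIntegrable.
Context {R : realType} {d : measure_display} {T : measurableType d}.
Variable mu : {measure set T -> \bar R}.
Implicit Types f g h : T -> R[i].

Lemma L2_integrable f : L2 mu f -> mu.-integrable setT (EFin \o (fun x => sqc (f x))).
Proof.
move=> [mf foo]; apply/integrableP; split.
  by apply/measurable_EFinP; exact: measurable_sqc.
rewrite (eq_integral (fun x => (sqc (f x))%:E))// => x _ /=.
by rewrite ger0_norm// sqc_ge0.
Qed.

Lemma integrable_L2 f : cmeasurable f ->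
  mu.-integrable setT (EFin \o (fun x => sqc (f x))) -> L2 mu f.
Proof. by move=> mf fi; split => //; exact: (integrable_lty measurableT fi). Qed.

(** Real-valued companion of [sqnorm]: the two agree under [L2] ([sqnormE]), while an infinite
    integral is sent to 0 by [fine]. *)
Definition nrm2 f : R := Rintegral mu setT (fun x => sqc (f x)).

Lemma sqnormE f : L2 mu f -> sqnorm mu f = (nrm2 f)%:E.
Proof.
by move=> /L2_integrable fi; rewrite /nrm2 /Rintegral fineK//;
  exact: (integrable_fin_num measurableT fi).
Qed.

Lemma nrm2_ge0 f : 0 <= nrm2 f.
Proof. by apply: Rintegral_ge0 => x _; exact: sqc_ge0. Qed.

Lemma L2_le f (u : T -> R) : cmeasurable f ->
  mu.-integrable setT (EFin \o u) -> (forall x, sqc (f x) <= u x) -> L2 mu f.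
Proof.
move=> mf ui le; apply: integrable_L2 => //; apply: (le_integrable _ _ _ ui) => //.
  by apply/measurable_EFinP; exact: measurable_sqc.
by move=> x _; rewrite lee_fin ger0_norm ?sqc_ge0// (le_trans (le x))// ler_norm.
Qed.

Lemma sqcD_le (z w : R[i]) : sqc (z + w) <= 2 * sqc z + 2 * sqc w.
Proof.
rewrite !sqcE !cReD !cImD.
have := sqr_ge0 (cRe z - cRe w); have := sqr_ge0 (cIm z - cIm w).
by rewrite !expr2; nra.
Qed.

Lemma L2D f g : L2 mu f -> L2 mu g -> L2 mu (fun x => f x + g x).
Proof.
move=> L2f L2g; apply: (@L2_le _ (fun x => 2 * sqc (f x) + 2 * sqc (g x))).
- by apply: cmeasurableD; [case: L2f|case: L2g].
- exact: (integrableD measurableT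
    (integrableZl measurableT 2 (L2_integrable L2f))
    (integrableZl measurableT 2 (L2_integrable L2g))).
- by move=> x; exact: sqcD_le.
Qed.

Lemma L2M (M : R) (u : T -> R[i]) f : cmeasurable u ->
  (forall x, Normc.normc (u x) <= M) -> L2 mu f -> L2 mu (fun x => u x * f x).
Proof.
move=> hu uM L2f; apply: (@L2_le _ (fun x => M ^+ 2 * sqc (f x))).
- by apply: cmeasurableM => //; case: L2f.
- exact: (integrableZl measurableT _ (L2_integrable L2f)).
- move=> x; rewrite sqcM ler_wpM2r ?sqc_ge0// lerXn2r ?nnegrE ?normc_ge0//.
  exact: le_trans (normc_ge0 _) (uM x).
Qed.

Lemma L2Z (a : R[i]) f : L2 mu f -> L2 mu (fun x => a * f x).
Proof. by move=> L2f; apply: (@L2M (Normc.normc a)) => //; exact: cmeasurable_cst. Qed.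

Lemma L2B f g : L2 mu f -> L2 mu g -> L2 mu (fun x => f x - g x).
Proof.
move=> L2f /(L2Z (-1)) L2g; have := L2D L2f L2g.
by under eq_fun do rewrite mulN1r.
Qed.

Lemma L2_0 : L2 mu (fun=> 0).
Proof.
apply: (@L2_le _ (fun=> 0)); first exact: cmeasurable_cst.
  exact: integrable0.
by move=> x; rewrite Normc.normc0 expr0n.
Qed.

Lemma L2_sum (J : Type) (s : seq J) (h : J -> T -> R[i]) :
  (forall j, L2 mu (h j)) -> L2 mu (fun x => \sum_(j <- s) h j x).
Proof.
move=> ih; elim: s => [|j s IH].
  by under eq_fun do rewrite big_nil; exact: L2_0.
by under eq_fun do rewrite big_cons; exact: L2D.
Qed.

Lemma cintegrable_inner f g : L2 mu f -> L2 mu g ->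
  cintegrable mu (fun x => f x * (g x)^*).
Proof.
move=> L2f L2g; apply: (@cintegrable_le _ _ _ _ _ (fun x => sqc (f x) + sqc (g x))).
- by apply: cmeasurableM; [case: L2f|apply: cmeasurableC; case: L2g].
- exact: (integrableD measurableT (L2_integrable L2f) (L2_integrable L2g)).
- move=> x; rewrite Normc.normcM normcC.
  have := sqr_ge0 (Normc.normc (f x) - Normc.normc (g x)).
  by have := normc_ge0 (f x); have := normc_ge0 (g x); nra.
Qed.

Lemma innerDl f g h : L2 mu f -> L2 mu g -> L2 mu h ->
  inner mu (fun x => f x + g x) h = inner mu f h + inner mu g h.
Proof.
move=> L2f L2g L2h; rewrite /inner -cintegralD; try exact: cintegrable_inner.
by congr cintegral; apply/funext => x; rewrite mulrDl.
Qed.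

Lemma innerZl (a : R[i]) f g : L2 mu f -> L2 mu g ->
  inner mu (fun x => a * f x) g = a * inner mu f g.
Proof.
move=> L2f L2g; rewrite /inner -cintegralZ; last exact: cintegrable_inner.
by congr cintegral; apply/funext => x; rewrite mulrA.
Qed.

Lemma innerC f g : L2 mu f -> L2 mu g -> inner mu g f = (inner mu f g)^*.
Proof.
move=> L2f L2g; rewrite /inner -cintegralC; last exact: cintegrable_inner.
by congr cintegral; apply/funext => x; rewrite rmorphM/= conjCK mulrC.
Qed.

Lemma innerDr f g h : L2 mu f -> L2 mu g -> L2 mu h ->
  inner mu h (fun x => f x + g x) = inner mu h f + inner mu h g.
Proof.
by move=> L2f L2g L2h; rewrite innerC ?innerDl ?rmorphD//= -?innerC//; exact: L2D.
Qed.

Lemma innerZr (a : R[i]) f g : L2 mu f -> L2 mu g ->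
  inner mu g (fun x => a * f x) = a^* * inner mu g f.
Proof.
by move=> L2f L2g; rewrite innerC ?innerZl ?rmorphM//= -?innerC//; exact: L2Z.
Qed.

Lemma innerBl f g h : L2 mu f -> L2 mu g -> L2 mu h ->
  inner mu (fun x => f x - g x) h = inner mu f h - inner mu g h.
Proof.
move=> L2f L2g L2h; rewrite -mulN1r -innerZl// -innerDl//; last exact: L2Z.
by congr inner; apply/funext => x; rewrite mulN1r.
Qed.

Lemma inner_suml (J : Type) (s : seq J) (h : J -> T -> R[i]) g :
  (forall j, L2 mu (h j)) -> L2 mu g ->
  inner mu (fun x => \sum_(j <- s) h j x) g = \sum_(j <- s) inner mu (h j) g.
Proof.
move=> L2h L2g; rewrite /inner -cintegral_sum.
  by congr cintegral; apply/funext => x; rewrite mulr_suml.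
by move=> j; exact: cintegrable_inner.
Qed.

Lemma inner_nrm2 f : L2 mu f -> inner mu f f = (nrm2 f)%:C%C.
Proof.
move=> L2f; rewrite /inner; apply: cplxP => /=.
  by apply: eq_Rintegral => x _; rewrite mul_conjc.
under eq_Rintegral do rewrite mul_conjc /=.
by rewrite /Rintegral integral0_eq.
Qed.

Lemma nrm2E f : L2 mu f -> nrm2 f = cRe (inner mu f f).
Proof. by move=> L2f; rewrite inner_nrm2. Qed.

Lemma nrm2D f g : L2 mu f -> L2 mu g ->
  nrm2 (fun x => f x + g x) = nrm2 f + nrm2 g + 2 * cRe (inner mu f g).
Proof.
move=> L2f L2g; rewrite !nrm2E ?innerDl ?innerDr//; try exact: L2D.
by rewrite (innerC L2f L2g) !cReD cReC; ring.
Qed.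

Lemma nrm2Z (a : R[i]) f : L2 mu f -> nrm2 (fun x => a * f x) = sqc a * nrm2 f.
Proof.
move=> L2f; rewrite /nrm2 -RintegralZl//; last exact: L2_integrable.
by apply: eq_Rintegral => x _; rewrite sqcM.
Qed.

Lemma nrm2B f g : L2 mu f -> L2 mu g ->
  nrm2 (fun x => f x - g x) = nrm2 f + nrm2 g - 2 * cRe (inner mu f g).
Proof.
move=> L2f L2g; have := nrm2D L2f (L2Z (-1) L2g).
rewrite innerZr// nrm2Z//.
have -> : (fun x => f x + -1 * g x) = (fun x => f x - g x).
  by apply/funext => x; rewrite mulN1r.
move=> ->; rewrite sqcE /= oppr0 sqrrN expr1n expr0n/= addr0 mul1r.
by rewrite mulN1r; case: (inner mu f g) => a b /=; ring.
Qed.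

Lemma nrm2D_le f g : L2 mu f -> L2 mu g ->
  nrm2 (fun x => f x + g x) <= 2 * nrm2 f + 2 * nrm2 g.
Proof.
move=> L2f L2g; have := nrm2_ge0 (fun x => f x - g x).
by rewrite (nrm2D L2f L2g) (nrm2B L2f L2g); lra.
Qed.

(** With b the inner product, the squared norm of f - t b g is a real quadratic in t even over the
    complex numbers, because the factor b turns the cross term into 2 t |b|^2. Its value at t = 1 /
    [nrm2 g] is the claim. *)
Lemma cauchy_schwarz f g : L2 mu f -> L2 mu g ->
  sqc (inner mu f g) <= nrm2 f * nrm2 g.
Proof.
move=> L2f L2g; set b := inner mu f g.
have key (t : R) : 0 <= nrm2 f + t ^+ 2 * sqc b * nrm2 g - 2 * t * sqc b.
  have := nrm2_ge0 (fun x => f x - (t%:C%C * b) * g x).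
  rewrite (nrm2B L2f (L2Z (t%:C%C * b) L2g)) nrm2Z// innerZr// -/b sqcM.
  have -> : (t%:C%C * b)^* * b = (t * sqc b)%:C%C.
    rewrite (rmorphM Num.conj) -mulrA [_^* * b]mulrC mul_conjc.
    by rewrite [RHS]rmorphM; congr (_ * _); apply: cplxP => //=; rewrite oppr0.
  by rewrite [sqc t%:C%C]sqcE /= expr0n/= addr0; lra.
have [g0|g0] := eqVneq (nrm2 g) 0.
  rewrite g0 mulr0; have [//|] := leP (sqc b) 0; move: key; move: (sqc b) => s key b0.
  (* For [g] of norm 0 the quadratic is affine, and this t makes it equal to -1. *)
  have := key ((nrm2 f + 1) / (2 * s)); rewrite g0 mulr0 addr0.
  have -> : 2 * ((nrm2 f + 1) / (2 * s)) * s = nrm2 f + 1.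
    by field; rewrite lt0r_neq0.
  lra.
have gpos : 0 < nrm2 g by rewrite lt0r g0 nrm2_ge0.
have := key (nrm2 g)^-1.
have -> : nrm2 f + (nrm2 g)^-1 ^+ 2 * sqc b * nrm2 g - 2 * (nrm2 g)^-1 * sqc b =
          nrm2 f - sqc b / nrm2 g by field.
by rewrite subr_ge0 ler_pdivrMr.
Qed.

Lemma inner_ae f f' g g' : L2 mu f -> L2 mu f' -> L2 mu g -> L2 mu g' ->
  {ae mu, forall x, f x = f' x} -> {ae mu, forall x, g x = g' x} ->
  inner mu f g = inner mu f' g'.
Proof.
move=> L2f L2f' L2g L2g' ff gg; apply: ae_eq_cintegral.
- exact: cintegrable_meas (cintegrable_inner L2f L2g).
- exact: cintegrable_meas (cintegrable_inner L2f' L2g').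
- by apply: filterS2 ff gg => x -> ->.
Qed.

Lemma nrm2_ae f g : L2 mu f -> L2 mu g -> {ae mu, forall x, f x = g x} ->
  nrm2 f = nrm2 g.
Proof. by move=> L2f L2g fg; rewrite !nrm2E// (inner_ae L2f L2g L2f L2g). Qed.

Lemma nrm2_cvg (u : nat -> T -> R[i]) (B : T -> R) :
  (forall n, cmeasurable (u n)) -> mu.-integrable setT (EFin \o B) ->
  (forall n x, sqc (u n x) <= B x) ->
  (forall x, (fun n => sqc (u n x)) @ \oo --> (0 : R)) ->
  (fun n => nrm2 (u n)) @ \oo --> (0 : R).
Proof.
move=> hu Bi uB u0.
have := @dominated_convergence _ _ _ mu _ measurableT
  (fun n => EFin \o (fun x => sqc (u n x))) (cst 0%E) (EFin \o B).
case=> //.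
- by move=> n; apply/measurable_EFinP; exact: measurable_sqc.
- by apply: aeW => x _; apply: cvg_EFin; [exact: nearW|exact: u0].
- apply: aeW => x n _ /=; rewrite lee_fin ger0_norm ?sqc_ge0//; exact: uB.
- move=> _ _; rewrite integral0 => /fine_cvg; exact.
Qed.

End SquareIntegrable.

(** * Discrete subgroups and the dual group *)

(** The near-covering form of compactness is applied to the filter on [seq T] generated by the sets
    of all sequences containing a given one: along it, every point of [K] is eventually covered
    together with its neighbours. *)
Lemma compact_nbhs_cover (T : topologicalType) (K : set T) (N : T -> set T) :
  compact K -> (forall x, K x -> nbhs x (N x)) ->
  exists2 s : seq T, {in s, forall x, K x} &
    forall y, K y -> exists2 x, x \in s & N x y.
Proof.
move=> /compact_near_coveringP cK KN.
pose F (A : set (seq T)) := exists s0 : seq T, forall s, {subset s0 <= s} -> A s.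
have FF : Filter F.
  split; first by exists [::].
    move=> A B [a aA] [b bB]; exists (a ++ b) => s abs; split; [apply: aA|apply: bB];
      by move=> x xa; apply: abs; rewrite mem_cat xa ?orbT.
  by move=> A B AB [a aA]; exists a => s /aA /AB.
have [|s0 /(_ s0) s0P] := cK (seq T) F (fun s y => exists x, [/\ x \in s, K x & N x y]) FF.
  move=> x Kx; exists (N x, [set s : seq T | x \in s]) => /=.
    by split; [exact: KN|exists [:: x] => s; apply; rewrite mem_head].
  by move=> [y s] [/= Nxy xs]; exists x.
exists [seq x <- s0 | `[<K x>]] => [x|y Ky].
  by rewrite mem_filter => /andP[/asboolP].
have [|x [xs Kx Nxy]] := s0P _ y Ky; first by [].
by exists x => //; rewrite mem_filter xs andbT; apply/asboolP.
Qed.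

Section DiscreteSubgroups.
Context {G : topologicalZmodType}.
Implicit Types (L K U : set G) (x y : G).

Definition discrete_at0 L := exists2 U, nbhs (0 : G) U & forall x, L x -> U x -> x = 0.

Lemma subgroupN L x : is_subgroup L -> L x -> L (- x).
Proof. by move=> [L0 LB] Lx; rewrite -sub0r; exact: LB. Qed.

Lemma subgroupD L x y : is_subgroup L -> L x -> L y -> L (x + y).
Proof.
by move=> sL Lx Ly; rewrite -[y]opprK; apply: sL.2 => //; exact: subgroupN.
Qed.

Lemma nbhs0_sub U : nbhs 0 U ->
  exists2 W, nbhs 0 W & forall x y, W x -> W y -> U (x - y).
Proof.
move=> U0; have := @sub_continuous G (0, 0) U; rewrite /= subr0 => /(_ U0).
move=> [[A B] /= [A0 B0] AB]; exists (A `&` B); first exact: filterI.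
by move=> x y [Ax _] [_ By]; exact: (AB (x, y)).
Qed.

Lemma nbhs_shift U x : nbhs 0 U -> nbhs x [set y | U (y - x)].
Proof.
move=> U0; have := @sub_continuous G (x, x) U; rewrite /= subrr => /(_ U0).
move=> [[A B] /= [Ax Bx] AB]; apply: filterS Ax => y Ay.
exact: (AB (y, x) (conj Ay (nbhs_singleton Bx))).
Qed.

Lemma translate_continuous x : continuous (+%R x : G -> G).
Proof.
move=> y U Uxy; have [[A B] /= [Ax By] AB] := @add_continuous G (x, y) U Uxy.
by apply: filterS By => z Bz; exact: (AB (x, z) (conj (nbhs_singleton Ax) Bz)).
Qed.

Lemma imageDlE x (A : set G) : +%R x @` A = [set y | A (y - x)].
Proof.
apply/seteqP; split=> [_ [z Az <-]|y Ay] /=; first by rewrite addrC addKr.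
by exists (y - x) => //; rewrite addrC subrK.
Qed.

(** If the differences of [W] stay in a neighbourhood isolating 0, each translate of [W] holds at
    most one point of [L], and finitely many translates cover [K]. *)
Lemma discrete_finite L K : is_subgroup L -> discrete_at0 L -> compact K ->
  finite_set (L `&` K).
Proof.
move=> [_ LB] [U U0 LU] cK; have [W W0 WU] := nbhs0_sub U0.
have [s _ sK] := compact_nbhs_cover cK (fun x _ => nbhs_shift x W0).
apply: (@sub_finite_set _ _ (\bigcup_(x in [set` s]) (L `&` [set y | W (y - x)]))).
  by move=> y [Ly /sK[x xs Wyx]]; exists x.
apply: bigcup_finite; first exact: finite_seq.
move=> x _; have [[y [Ly Wy]]|n] := pselect (exists y, (L `&` [set y | W (y - x)]) y).
  apply: (@sub_finite_set _ _ [set y]); last exact: finite_set1.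
  move=> z [/= Lz Wz]; apply/eqP; rewrite -subr_eq0; apply/eqP; apply: LU.
    exact: LB.
  by have := WU _ _ Wz Wy; rewrite opprB addrA subrK.
rewrite (_ : _ `&` _ = set0); first exact: finite_set0.
by apply/seteqP; split=> // y Hy; exfalso; apply: n; exists y.
Qed.

Lemma discrete_countable L : is_subgroup L -> discrete_at0 L -> sigma_compact G ->
  countable L.
Proof.
move=> LS dL [K [cK KT]].
have -> : L = \bigcup_n (L `&` K n) by rewrite -setI_bigcupr KT setIT.
apply: bigcup_countable => // n _; apply: finite_set_countable.
exact: discrete_finite.
Qed.

Lemma lattice_subgroup L : lattice L -> is_subgroup L.
Proof. by case. Qed.

Lemma lattice_discrete L : lattice L -> discrete_at0 L.
Proof.
move=> [[L0 _] [iL _]]; have [_ [U U0 UL]] := iL _ L0.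
by exists U => // x Lx Ux; have : (U `&` L) x by []; rewrite UL.
Qed.

Lemma locally_compactP : locally_compact [set: G] ->
  forall x : G, exists2 K, compact K & nbhs x K.
Proof.
move=> lc x; have [K xK [cK _]] := lc x I; exists K => //.
by apply: filterS (xK : nbhs x [set y | setT y -> K y]) => y; exact.
Qed.

(** The quotient map is open, so images of compact neighbourhoods cover the compact quotient;
    finitely many suffice, and their union is [C]. *)
Lemma lattice_cocompact L : locally_compact [set: G] -> lattice L ->
  exists2 C, compact C & forall x, exists2 c, C c & L (x - c).
Proof.
move=> /locally_compactP lc [LS [_ cQ]].
have /choice[N NP] : forall x : G, exists K : set G, compact K /\ nbhs x K.
  by move=> x; have [K cK Kx] := lc x; exists K.
have [cN Nx] : (forall x, compact (N x)) /\ (forall x, nbhs x (N x)).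
  by split => x; case: (NP x).
pose Q := quotient_group LS; pose p : G -> Q := \pi_Q%qT.
have pE x y : p x = p y -> L (x - y).
  by move/eqmodP => /= /asboolP.
have pL x y : L (x - y) -> p x = p y.
  by move=> Lxy; apply/eqmodP/asboolP.
have pN (q : Q) : [set: Q] q -> nbhs q (p @` N (repr q)).
  move=> _; rewrite nbhsE; exists (p @` (N (repr q))°).
    split; last first.
      exists (repr q); first exact: Nx.
      by rewrite /p reprK.
    rewrite /open /= /quotient_open.
    (* The saturation of an open set is the union of its translates by [L], hence open. *)
    have -> : \pi_Q%qT @^-1` (p @` (N (repr q))°) =
      \bigcup_(l in L) [set y | (N (repr q))° (l + y)].
      apply/seteqP; split => [y [z Nz] /pE Lzy|y [l Ll Nly]].
        by exists (z - y) => //=; rewrite subrK.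
      by exists (l + y) => //; apply: pL; rewrite addrK.
    apply: bigcup_open => l _; apply: open_comp; last exact: open_interior.
    by move=> y _; exact: translate_continuous.
  by apply: image_subset; exact: interior_subset.
have [s _ sQ] := compact_nbhs_cover cQ pN.
exists (\big[setU/set0]_(q <- s) N (repr q)).
  by apply: bigsetU_compact => q _; exact: cN.
move=> x; have [//|q qs [c Nc /esym/pE Lxc]] := sQ (p x).
by exists c => //; rewrite -bigcup_seq; exists q.
Qed.

End DiscreteSubgroups.

Lemma normc_subC (R : realType) (z w : R[i]) :
  Normc.normc (z - w) = Normc.normc (w - z).
Proof. by rewrite -opprB normcN. Qed.

Lemma normc_triangle (R : realType) (v z w : R[i]) :
  Normc.normc (z - w) <= Normc.normc (z - v) + Normc.normc (v - w).
Proof. by rewrite -[z - w](subrKA v); exact: le_normcD. Qed.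

(** * Unitary characters near the identity *)

Section UnitCharacters.
Context {R : realType} {G : topologicalZmodType}.

(** Continuity is left out, so that pointwise limits of characters qualify before they are known to
    be continuous. *)
Definition character_like (g : G -> R[i]) :=
  (forall x, Normc.normc (g x) = 1) /\ (forall x y, g (x + y) = g x * g y).

Lemma character_like0 g : character_like g -> g 0 = 1.
Proof.
move=> [g1 gD]; have g0 : g 0 != 0.
  by apply/eqP => g0; move: (g1 0); rewrite g0 Normc.normc0 => /esym/eqP; rewrite oner_eq0.
by apply: (mulfI g0); rewrite -gD addr0 mulr1.
Qed.

Lemma character_likeN g : character_like g -> forall x, g (- x) = (g x)^*.
Proof.
move=> gc x; have [g1 gD] := gc; have := character_like0 gc.
rewrite -(subrr x) gD => gx; have := mul_conjc (g x); have gx0 : g x != 0.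
  by apply/eqP => g0; move: (g1 x); rewrite g0 Normc.normc0 => /esym/eqP; rewrite oner_eq0.
by rewrite g1 expr1n -[RHS]/(1 : R[i]) -gx => /(mulfI gx0).
Qed.

Lemma character_likeB g : character_like g -> forall x y,
  Normc.normc (g x - g y) = Normc.normc (g (x - y) - 1).
Proof.
move=> [g1 gD] x y.
have -> : g x = g (x - y) * g y by rewrite -gD subrK.
by rewrite -[X in _ * _ - X]mul1r -mulrBl Normc.normcM g1 mulr1.
Qed.

(* |z - 1| = |z^2 - 1| / |z + 1| and |z + 1| >= 3/2 once |z - 1| <= 1/2 *)
Lemma character_like_halve g : character_like g -> forall n x,
  (forall j, (j <= n)%N -> Normc.normc (g (x *+ 2 ^ j) - 1) <= 2^-1) ->
  Normc.normc (g x - 1) <= (2 / 3) ^+ n / 2.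
Proof.
move=> [g1 gD]; elim=> [|n IH] x gx.
  by rewrite expr0 mul1r; have := gx 0%N isT; rewrite expn0 mulr1n.
have /IH : forall j, (j <= n)%N -> Normc.normc (g ((x + x) *+ 2 ^ j) - 1) <= 2^-1.
  by move=> j jn; rewrite -mulr2n -mulrnA -expnS; exact: gx.
have g2 : g (x + x) - 1 = (g x - 1) * (g x + 1) by rewrite gD; ring.
rewrite g2 Normc.normcM.
have : 3 / 2 <= Normc.normc (g x + 1).
  have := gx 0%N isT; rewrite expn0 mulr1n => gx0.
  have := le_normcD (g x + 1) (1 - g x).
  have -> : g x + 1 + (1 - g x) = (2%:R)%:C%C.
    by rewrite rmorph_nat; ring.
  have -> : Normc.normc (2%:R)%:C%C = 2 :> R.
    by rewrite /= expr0n/= addr0 sqrtr_sqr ger0_norm.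
  by rewrite (normc_subC 1); lra.
have := normc_ge0 (g x - 1); rewrite exprS.
move: (Normc.normc (g x - 1)) (Normc.normc (g x + 1)) ((2 / 3) ^+ n : R) => a b c.
move=> a0 b32 abc.
have : 3 / 2 * a <= a * b by nra. lra.
Qed.

Lemma pow23_lt (e : R) : 0 < e -> exists n, (2 / 3) ^+ n / 2 < e.
Proof.
move=> e0; have /cvgrPdist_lt/(_ e e0) : (fun n : nat => (2 / 3 : R) ^+ n) @ \oo --> 0.
  by apply: cvg_expr; rewrite ger0_norm; lra.
case=> n _ /(_ n (leqnn n)); rewrite /= sub0r normrN ger0_norm ?exprn_ge0//.
by move=> h; exists n; have : 0 <= (2 / 3 : R) ^+ n by []; lra.
Qed.

(** [U] consists of the points whose first [n] doublings stay in [K], with [n] depending only on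
    [e]: the same neighbourhood serves all [g]. *)
Lemma equicontinuous_at0 (K : set G) (e : R) : nbhs 0 K -> 0 < e ->
  exists2 U, nbhs 0 U & forall g, character_like g ->
    (forall x, K x -> Normc.normc (g x - 1) <= 2^-1) ->
    forall x, U x -> Normc.normc (g x - 1) < e.
Proof.
move=> K0 /pow23_lt[n ne].
have U0 : forall m, nbhs 0 [set x : G | forall j, (j <= m)%N -> K (x *+ 2 ^ j)].
  move=> m; have dbl j : nbhs (0 : G) [set x | K (x *+ 2 ^ j)].
    elim: j => [|j IH]; first by apply: filterS K0 => x; rewrite /= expn0 mulr1n.
    have [[A B] /= [A0 B0] AB] := @add_continuous G (0, 0) [set x | K (x *+ 2 ^ j)]
      ltac:(by rewrite /= addr0).
    apply: filterS2 A0 B0 => x Ax Bx /=.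
    by rewrite expnS mulrnA mulr2n; exact: (AB (x, x)).
  elim: m => [|m IH].
    by apply: filterS (dbl 0%N) => x Kx j; rewrite leqn0 => /eqP ->.
  apply: filterS2 IH (dbl m.+1) => x IHx Kx j.
  by rewrite leq_eqVlt => /predU1P[->//|]; rewrite ltnS => /IHx.
exists [set x | forall j, (j <= n)%N -> K (x *+ 2 ^ j)]; first exact: U0.
move=> g gc gK x Ux; apply: le_lt_trans ne.
by apply: character_like_halve => // j jn; apply: gK; exact: Ux.
Qed.

(** The disc of radius 1/2 about 1 contains no nontrivial subgroup of the circle: every doubling
    stays in it, so the halving bound holds for all [n]. *)
Lemma character_like_trivial g : character_like g ->
  (forall x, Normc.normc (g x - 1) <= 2^-1) -> forall x, g x = 1.
Proof.
move=> gc g2 x; apply/eqP; rewrite -subr_eq0; apply/eqP; apply: Normc.eq0_normc.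
apply/eqP; rewrite eq_le normc_ge0 andbT; apply/ler_addgt0Pr => e e0.
have [n ne] := pow23_lt e0; rewrite add0r (le_trans _ (ltW ne))//.
exact: character_like_halve.
Qed.

End UnitCharacters.

(** * Topology of the dual group: compact neighbourhoods and discrete annihilators *)

Section DualTopology.
Context {R : realType} {G : topologicalZmodType}.
Local Notation D := (dual_group R G).
Implicit Types (chi psi : D) (K : set G).

Lemma dual_like chi : character_like chi.
Proof.
split; last exact: characterD.
by move=> x; apply/normc1P; exact: character_norm.
Qed.

Lemma dualN chi x : chi (- x) = (chi x)^*.
Proof. exact: character_likeN (dual_like chi) x. Qed.

Lemma dual_normc chi x : Normc.normc (chi x) = 1.
Proof. by have [] := dual_like chi. Qed.

Lemma dual_nbhs chi K (e : R) : compact K -> 0 < e ->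
  nbhs chi [set psi : D | forall x, K x -> Normc.normc (chi x - psi x) < e].
Proof.
move=> cK e0; have eC : 0 < e%:C%C :> R[i] by rewrite ltcR.
apply: filterS (dual_nbhs_uniform chi cK eC) => psi h x /h.
by rewrite normE ltcR.
Qed.

Lemma dual_eval_nbhs chi x (e : R) : 0 < e ->
  nbhs chi [set psi : D | Normc.normc (chi x - psi x) < e].
Proof.
by move=> e0; apply: filterS (dual_nbhs chi (@compact_set1 G x) e0) => psi; apply.
Qed.

Lemma character_nbhs chi x (e : R) : 0 < e ->
  nbhs x [set y | Normc.normc (chi x - chi y) < e].
Proof.
move=> e0; have eC : 0 < e%:C%C :> R[i] by rewrite ltcR.
have /cvgrPdist_lt/(_ _ eC) := @character_continuous _ _ chi x.
by apply: filterS => y; rewrite normE ltcR.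
Qed.

(** Converse to [dual_nbhs]: the topology of the dual is that of uniform convergence on compact
    sets. An arbitrary filter is allowed because the lemma is applied to ultrafilters. *)
Lemma dual_cvg (F : set_system D) chi : Filter F ->
  (forall K (e : R), compact K -> 0 < e ->
    F [set psi : D | forall x, K x -> Normc.normc (chi x - psi x) < e]) ->
  F --> chi.
Proof.
move=> FF h; pose inc (c : D) : {compact-open, G -> R[i]^o} := character_fun c.
have [_ cv] := @compact_open_fam_compactP G R[i]^o (character_fun chi)
  (inc @ F) (@character_continuous _ _ chi) (fmap_filter inc FF).
have {}cv : inc @ F --> inc chi.
  apply: cv; apply/fam_cvgP => K cK P /uniform_nbhs[E [entE EP]].
  move: entE; rewrite -entourage_ballE => -[e /= e0 eE].
  (* The radius of the entourage lives in [R[i]], where being positive forces it to be real. *)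
  have [er _ eeq] : exists2 r, 0 < r & e = r%:C%C.
    move: e0; rewrite /mkset; case: (e) => a b; rewrite ltcE /= => /andP[/eqP -> a0].
    by exists a.
  have er0 : 0 < er by move: e0; rewrite eeq /= ltcR.
  apply: filterS (h K er cK er0) => psi hpsi.
  apply: EP => x Kx; apply: eE => /=; rewrite /ball /= eeq normE ltcR.
  exact: hpsi.
move=> A [B [[C oC <-]] Cchi CA]; apply: filterS CA _.
by apply: cv; exact: open_nbhs_nbhs.
Qed.

Lemma dual_hausdorff : hausdorff_space D.
Proof.
move=> chi psi cp; apply: dualP => x; apply/eqP; rewrite -subr_eq0; apply/eqP.
apply: Normc.eq0_normc; apply/eqP; rewrite eq_le normc_ge0 andbT.
apply/ler_addgt0Pr => e e0; rewrite add0r.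
have e2 : 0 < e / 2 by rewrite divr_gt0.
have [c [/= cc pc]] := cp _ _ (dual_eval_nbhs chi x e2) (dual_eval_nbhs psi x e2).
rewrite (le_trans (normc_triangle (c x) _ _))// [leRHS]splitr.
by rewrite lerD ?ltW// normc_subC.
Qed.

(** The radius is the one that starts the doubling argument. These sets are neighbourhoods of 0 for
    [K] compact, and compact for [K] a neighbourhood of 0. *)
Definition dual_ball K : set D :=
  [set chi | forall x, K x -> Normc.normc (chi x - 1) <= 2^-1].

(** Real and imaginary parts of psi(x) stay in the compact segment [-1, 1], where the image
    ultrafilters converge. *)
Lemma ultra_normc_limit (F : set_system D) : UltraFilter F ->
  forall x, exists z : R[i], forall e : R, 0 < e ->
    F [set psi : D | Normc.normc (z - psi x) < e].
Proof.
move=> FU x; have lim (u : D -> R) : (forall psi, `|u psi| <= 1) ->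
    exists a : R, u @ F --> a.
  move=> u1; have uU : UltraFilter (u @ F).
    split; first exact: fmap_proper_filter.
    move=> H HF uH; apply/seteqP; split => //.
    move=> A HA; have [//|nA] := in_ultra_setVsetC (u @^-1` A) FU.
    have : H (~` A) by apply: uH.
    by move=> /(filterI HA); rewrite setICr => H0; case: (filter_not_empty H).
  have := @segment_compact R (-1) 1; rewrite compact_ultra => /(_ (u @ F) uU)[].
    by apply: (@filterE _ F) => psi /=; rewrite in_itv/=; have := u1 psi; rewrite ler_norml.
  by move=> a [_ ua]; exists a.
have [psi|a ca] := lim (fun psi => cRe (psi x)).
  by rewrite -(dual_normc psi x) norm_Re_le.
have [psi|b cb] := lim (fun psi => cIm (psi x)).
  by rewrite -(dual_normc psi x) norm_Im_le.
exists (Complex a b) => e e0; have e2 : 0 < e / 2 by rewrite divr_gt0.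
move/cvgrPdist_lt/(_ _ e2): ca; move/cvgrPdist_lt/(_ _ e2): cb.
apply: filterS2 => psi hb ha /=; rewrite (le_lt_trans (normc_le _))//.
rewrite cReD cImD [ltRHS]splitr /=.
by move: hb ha => /=; case: (psi x) => u v /=; lra.
Qed.

(* An ultrafilter converges pointwise to a character of G, and the bound on the
   neighbourhood K makes the characters of the ball equicontinuous. *)
Lemma dual_ball_compact K : nbhs 0 K -> compact (dual_ball K).
Proof.
move=> K0; rewrite compact_ultra => F FU FK.
have FF : Filter F by have [FP _] := FU; exact: (@filter_filter _ _ FP).
have /choice[g gP] := ultra_normc_limit FU.
have near_eq (z : R[i]) : (forall e : R, 0 < e -> Normc.normc z <= e) -> z = 0.
  move=> h; apply: Normc.eq0_normc; apply/eqP; rewrite eq_le normc_ge0 andbT.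
  by apply/ler_addgt0Pr => e e0; rewrite add0r h.
have g1 x : Normc.normc (g x) = 1.
  apply/eqP; rewrite -subr_eq0 -normr_eq0 eq_le normr_ge0 andbT.
  apply/ler_addgt0Pr => e e0; rewrite add0r.
  have [psi /= hpsi] := filter_ex (gP x e e0).
  have h1 := normc_triangle (psi x) (g x) 0; have h2 := normc_triangle (g x) (psi x) 0.
  move: h1 h2; rewrite !subr0 dual_normc (normc_subC (psi x)) => h1 h2.
  by rewrite ler_norml; lra.
have gc : character_like g.
  split => // x y; apply/eqP; rewrite -subr_eq0; apply/eqP; apply: near_eq => e e0.
  have e3 : 0 < e / 3 by rewrite divr_gt0.
  have [psi /= [[hxy hx] hy]] := filter_ex
    (filterI (filterI (gP (x + y) _ e3) (gP x _ e3)) (gP y _ e3)).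
  have -> : g (x + y) - g x * g y = (g (x + y) - psi (x + y)) -
      ((g x - psi x) * psi y + (g y - psi y) * g x).
    by rewrite characterD; ring.
  have := le_normcD (g (x + y) - psi (x + y))
    (- ((g x - psi x) * psi y + (g y - psi y) * g x)).
  rewrite normcN; have := le_normcD ((g x - psi x) * psi y) ((g y - psi y) * g x).
  by rewrite !Normc.normcM dual_normc g1 !mulr1; lra.
have gK x : K x -> Normc.normc (g x - 1) <= 2^-1.
  move=> Kx; apply/ler_addgt0Pr => e e0.
  have [psi [/= hpsi /(_ x Kx) psiK]] := filter_ex (filterI (gP x e e0) FK).
  by have := normc_triangle (psi x) (g x) 1; lra.
have gcont : continuous (g : G -> R[i]^o).
  move=> x; apply/cvgrPdist_lt => e.
  case: e => er ei; rewrite ltcE /= => /andP[/eqP -> er0].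
  have [U U0 Ug] := equicontinuous_at0 K0 er0.
  apply: filterS (nbhs_shift x U0) => y Uy; rewrite normE ltcR normc_subC.
  by rewrite character_likeB//; exact: Ug.
have gn x : `|g x| = 1 by apply/normc1P.
pose chi : D := Character gcont gn gc.2.
exists chi; split => //; apply: dual_cvg => C e cC e0.
have e3 : 0 < e / 3 by rewrite divr_gt0.
have [U U0 Ug] := equicontinuous_at0 K0 e3.
(* Equicontinuity turns convergence at the finitely many centres [s] into uniform convergence on
   [C], with three errors of e/3. *)
have [s _ sC] := compact_nbhs_cover cC (fun x _ => nbhs_shift x U0).
have : F [set psi : D | forall x, x \in s -> Normc.normc (g x - psi x) < e / 3].
  elim: s {sC} => [|x s IH]; first by apply: filterE.
  apply: filterS2 (gP x _ e3) IH => psi hx IH y.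
  by rewrite inE => /predU1P[->//|/IH].
apply: filterS2 FK => psi psiK hs y Cy; have [x xs Uyx] := sC y Cy.
have := normc_triangle (g x) (g y) (psi y).
have := normc_triangle (psi x) (g x) (psi y).
rewrite (character_likeB gc) (normc_subC (psi x)) (character_likeB (dual_like psi)).
have := Ug _ gc gK _ Uyx; have := Ug _ (dual_like psi) psiK _ Uyx.
by have := hs x xs => /=; lra.
Qed.

Lemma dual_ball_nbhs K : compact K -> nbhs 0 (dual_ball K).
Proof.
move=> cK; have h2 : 0 < 2^-1 :> R by rewrite invr_gt0.
apply: filterS (dual_nbhs 0 cK h2) => psi h x Kx.
by rewrite normc_subC; exact/ltW/(h x Kx).
Qed.

Lemma dual_compact_nbhs : locally_compact [set: G] ->
  exists2 N : set D, compact N & nbhs 0 N.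
Proof.
move=> /locally_compactP/(_ 0)[K cK K0]; exists (dual_ball K).
  exact: dual_ball_compact.
exact: dual_ball_nbhs.
Qed.

(** A character is close to 1 on some metric ball of radius 1/(n+1) about 0, so it lies in one of
    countably many compact dual balls. *)
Lemma dual_sigma_compact : metrizable R G -> sigma_compact D.
Proof.
move=> [d [_ _ _ dN]]; pose U n := [set y : G | d 0 y < n.+1%:R^-1].
exists (fun n => dual_ball (U n)); split.
  move=> n; apply: dual_ball_compact; apply/dN; exists n.+1%:R^-1; first by rewrite invr_gt0.
  by [].
apply/seteqP; split => // chi _.
have h2 : 0 < 2^-1 :> R by rewrite invr_gt0.
have /dN[e e0 eU] := character_nbhs chi 0 h2.
have [n ne] : exists n, n.+1%:R^-1 < e.
  have /cvgrPdist_lt/(_ e e0)[n _ /(_ n (leqnn n))] := @cvg_harmonic R.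
  by rewrite /= sub0r normrN ger0_norm//; exists n.
exists n => // x Ux; rewrite normc_subC -(character_like0 (dual_like chi)).
by apply/ltW/eU/(lt_trans Ux).
Qed.

Lemma annihilator_subgroup (L : set G) : is_subgroup (annihilator L : set D).
Proof.
split=> [x _|x y hx hy z Lz]; first by [].
by rewrite dual_subE hx// hy// divr1.
Qed.

(* G = C + L with C compact, so a character in the annihilator that is close to 1 on C is
   close to 1 everywhere, hence trivial. *)
Lemma annihilator_discrete (L : set G) : locally_compact [set: G] -> lattice L ->
  discrete_at0 (annihilator L : set D).
Proof.
move=> lc /(lattice_cocompact lc)[C cC CL].
exists (dual_ball C); first exact: dual_ball_nbhs.
move=> chi chiL chiC; apply: dualP => x.
apply: (character_like_trivial (dual_like chi)) => y.
have [c Cc /chiL cL] := CL y.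
by rewrite -(subrK c y) characterD cL mul1r; exact: chiC.
Qed.

End DualTopology.

(** * Haar measures and fundamental domains *)

Section AlmostEverywhere.
Context {R : realType} {d : measure_display} {T : measurableType d}.
Variable mu : {measure set T -> \bar R}.

Lemma ae_countable (J : Type) (A : set J) (P : J -> T -> Prop) : countable A ->
  (forall j, A j -> {ae mu, forall x, P j x}) ->
  {ae mu, forall x, forall j, A j -> P j x}.
Proof.
move=> /countable_injP[f fI] hP.
have : {ae mu, forall x n j, A j -> f j = n -> P j x}.
  apply: ae_foralln => n.
  have [[j [Aj fj]]|nj] := pselect (exists j, A j /\ f j = n); last first.
    by apply: aeW => x j Aj fj; case: nj; exists j.
  apply: filterS (hP _ Aj) => x Px i Ai fi.
  by rewrite (fI i j) ?inE// fi.
by apply: filterS => x h j Aj; exact: h.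
Qed.

Lemma aeS (P Q : T -> Prop) : (forall x, P x -> Q x) ->
  {ae mu, forall x, P x} -> {ae mu, forall x, Q x}.
Proof. by move=> PQ; apply: filterS. Qed.

Lemma aeI (P Q : T -> Prop) : {ae mu, forall x, P x} -> {ae mu, forall x, Q x} ->
  {ae mu, forall x, P x /\ Q x}.
Proof. exact: filterI. Qed.

End AlmostEverywhere.

Section BorelMeasurability.
Context {R : realType}.

Lemma open_borel (G : topologicalZmodType) (A : set (borel G)) : open A -> measurable A.
Proof. by move=> oA; exact: sub_sigma_algebra. Qed.

Lemma closed_borel (G : topologicalZmodType) (A : set (borel G)) :
  closed A -> measurable A.
Proof.
by move=> cA; rewrite -[A]setCK; apply: measurableC; apply: open_borel; exact: closed_openC.
Qed.

Lemma continuous_borel_real (G : topologicalZmodType) (u : G -> R) :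
  continuous u -> measurable_fun setT (u : borel G -> R).
Proof.
move=> /continuousP cu; apply: (measurability _ (RGenOpens.measurableE R)) => _ [_ [a [b ->] <-]].
by rewrite setTI; apply: open_borel; apply: cu; exact: interval_open.
Qed.

Lemma continuous_cmeasurable (G : topologicalZmodType) (u : G -> R[i]) :
  (forall (x : G) (e : R), 0 < e -> nbhs x [set y | Normc.normc (u x - u y) < e]) ->
  cmeasurable (u : borel G -> R[i]).
Proof.
move=> cu; have cont (p : R[i] -> R) : (forall z w, `|p z - p w| <= Normc.normc (z - w)) ->
    continuous (fun x => p (u x)).
  move=> hp x U /nbhs_ballP[e /= e0 eU].
  apply: (@filterS _ (nbhs x) (nbhs_filter x) _ _ _ (cu x e e0)) => y xy.
  by apply: eU; exact: le_lt_trans xy.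
split; apply: continuous_borel_real; apply: cont => z w.
  by have := norm_Re_le (z - w); case: z w => a b [c d].
by have := norm_Im_le (z - w); case: z w => a b [c d].
Qed.

Lemma continuous_borel (G G' : topologicalZmodType) (p : G -> G') :
  continuous p -> measurable_fun setT (p : borel G -> borel G').
Proof.
move=> /continuousP cp; apply: (@measurability _ _ _ (borel G') _ _ open) => // _ [A oA <-].
by rewrite setTI; apply: open_borel; exact: cp.
Qed.

Lemma borel_translate (G : topologicalZmodType) (a : G) :
  measurable_fun setT (+%R a : borel G -> borel G).
Proof. by apply: continuous_borel; exact: translate_continuous. Qed.

End BorelMeasurability.

(** * Haar measure: invariance of integrals, positivity on neighbourhoods of 0 *)

Section TranslationInvariance.
Context {R : realType} {G : topologicalZmodType}.
Variable mu : {measure set (borel G) -> \bar R}.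
Hypothesis mu_haar : haar_measure mu.
Implicit Types (a : G) (A : set (borel G)).

Lemma haar_preimage a A : measurable A -> mu ((+%R a : borel G -> borel G) @^-1` A) = mu A.
Proof.
have [_ _ inv] := mu_haar; move=> mA; rewrite -(inv (- a) A mA).
by congr (mu _); rewrite imageDlE; apply/seteqP; split => x /=; rewrite opprK addrC.
Qed.

Lemma ae_translate a (P : set (borel G)) : {ae mu, forall x, P x} ->
  {ae mu, forall x : G, P (a + x)}.
Proof.
move=> [A [mA A0 PA]]; exists ((+%R a : borel G -> borel G) @^-1` A); split.
- by rewrite -[X in measurable X]setTI; exact: borel_translate.
- by rewrite haar_preimage.
- by move=> x nP; apply: PA.
Qed.

Lemma ge0_integral_translate a (f : borel G -> \bar R) :
  measurable_fun setT f -> (forall x, 0 <= f x)%E ->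
  (\int[mu]_x f (a + x)%R = \int[mu]_x f x)%E.
Proof.
move=> mf f0.
have := @ge0_integral_pushforward _ _ _ _ _ _ (borel_translate a) mu setT f
  measurableT mf (fun x _ => f0 x).
rewrite preimage_setT => <-.
apply: eq_measure_integral => [|? A mA _]; first exact: borel_translate.
exact: haar_preimage.
Qed.

Lemma integrable_translate a (f : borel G -> \bar R) :
  mu.-integrable setT f -> mu.-integrable setT (fun x : G => f (a + x)).
Proof.
move=> /integrableP[mf foo]; apply/integrableP; split.
  exact: (measurableT_comp mf (borel_translate a)).
rewrite (ge0_integral_translate a (f := fun x => `|f x|%E))//.
exact: measurableT_comp.
Qed.

Lemma Rintegral_translate a (f : borel G -> R) :
  mu.-integrable setT (EFin \o f) ->
  Rintegral mu setT (fun x : G => f (a + x)) = Rintegral mu setT f.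
Proof.
move=> fi; congr fine.
have mf : measurable_fun setT (EFin \o f) by exact: measurable_int fi.
have := @integral_pushforward _ _ _ _ _ _ (borel_translate a) mu setT _ mf
  (integrable_translate a fi) measurableT.
rewrite preimage_setT => <-.
apply: eq_measure_integral => [|? A mA _]; first exact: borel_translate.
exact: haar_preimage.
Qed.

Lemma cmeasurable_translate a (f : borel G -> R[i]) : cmeasurable f ->
  cmeasurable (fun x : borel G => f (a + x : G)).
Proof. by apply: cmeasurable_comp; exact: borel_translate. Qed.

Lemma cintegrable_translate a (f : borel G -> R[i]) : cintegrable mu f ->
  cintegrable mu (fun x : G => f (a + x)).
Proof.
move=> [rf jf]; split.
  exact: (integrable_translate a rf).
exact: (integrable_translate a jf).
Qed.

Lemma cintegral_translate a (f : borel G -> R[i]) : cintegrable mu f ->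
  cintegral mu (fun x : G => f (a + x)) = cintegral mu f.
Proof.
move=> [rf jf]; apply: cplxP.
  exact: (Rintegral_translate a rf).
exact: (Rintegral_translate a jf).
Qed.

Lemma L2_translate a (f : borel G -> R[i]) : L2 mu f ->
  L2 mu (fun x : G => f (a + x)).
Proof.
move=> L2f; apply: integrable_L2.
  by apply: cmeasurable_translate; case: L2f.
exact: (integrable_translate a (L2_integrable L2f)).
Qed.

Lemma nrm2_translate a (f : borel G -> R[i]) : L2 mu f ->
  nrm2 mu (fun x : G => f (a + x)) = nrm2 mu f.
Proof. by move=> L2f; exact: (Rintegral_translate a (L2_integrable L2f)). Qed.

Lemma compact_borel (K : set G) : hausdorff_space G -> compact K ->
  measurable (K : set (borel G)).
Proof. by move=> hG cK; apply: closed_borel; exact: compact_closed. Qed.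

(** If [U] were null, so would be every compact set, being covered by finitely many translates of
    [U], and hence the whole group. *)
Lemma haar_open_pos (U : set (borel G)) : sigma_compact G -> measurable U ->
  nbhs (0 : G) U -> mu U != 0%E.
Proof.
move=> [K [cK KT]] mU U0; have [mu0 _ _] := mu_haar; apply: contra_neq mu0 => muU.
apply/eqP; rewrite eq_le measure_ge0 andbT.
have negU x : mu ((+%R (- x) : borel G -> borel G) @^-1` U) = 0%E.
  by rewrite haar_preimage.
have mUx x : measurable ((+%R (- x) : borel G -> borel G) @^-1` U).
  by rewrite -[X in measurable X]setTI; exact: borel_translate.
have negK n : mu.-negligible (K n : set (borel G)).
  have [s _ sK] := compact_nbhs_cover (cK n) (fun x _ => nbhs_shift x U0).
  apply: (@negligibleS _ _ _ _
      (\big[setU/set0]_(x <- s) ((+%R (- x) : borel G -> borel G) @^-1` U))).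
    move=> y /sK[x xs Uyx]; rewrite -bigcup_seq; exists x => //=.
    by rewrite addrC.
  elim: (s) => [|x t IH]; first by rewrite big_nil; exact: negligible_set0.
  by rewrite big_cons; exact: (negligibleU (iffRL (negligibleP _ (mUx x)) (negU x)) IH).
have /negligible_bigcup : forall n, mu.-negligible (K n : set (borel G)) by [].
by rewrite KT => /negligibleP -> //; exact: measurableT.
Qed.

End TranslationInvariance.

(** * Complex-valued indicators *)

Section ComplexIndicator.
Context {R : realType} {d : measure_display} {T : measurableType d}.

Definition cind (A : set T) (x : T) : R[i] := (\1_A x)%:C%C.

Lemma cindE (A : set T) x : cind A x = if `[< A x >] then 1 else 0.
Proof.
rewrite /cind indicE; case: asboolP => Ax; first by rewrite mem_set.
by rewrite memNset.
Qed.

Lemma cind_in (A : set T) x : A x -> cind A x = 1.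
Proof. by move=> Ax; rewrite cindE asboolT. Qed.

Lemma cind_out (A : set T) x : ~ A x -> cind A x = 0.
Proof. by move=> Ax; rewrite cindE asboolF. Qed.

Lemma cindC (A : set T) x : (cind A x)^* = cind A x.
Proof. by rewrite cindE; case: asboolP; rewrite ?rmorph1 ?rmorph0. Qed.

Lemma cind_idem (A : set T) x : cind A x * cind A x = cind A x.
Proof. by rewrite cindE; case: asboolP; rewrite ?mulr1 ?mulr0. Qed.

Lemma normc_cind (A : set T) x : Normc.normc (cind A x) <= 1.
Proof. by rewrite cindE; case: asboolP; rewrite ?Normc.normc1 ?Normc.normc0. Qed.

Lemma cmeasurable_cind (A : set T) : measurable A -> cmeasurable (cind A).
Proof. by move=> mA; apply: cmeasurable_real; exact: measurable_indic. Qed.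

Lemma sqc_cind (A : set T) x : sqc (cind A x) = \1_A x.
Proof.
by rewrite cindE indicE; case: asboolP => Ax; rewrite ?Normc.normc1 ?Normc.normc0
  ?expr1n ?expr0n ?(mem_set Ax)// memNset.
Qed.

Variable mu : {measure set T -> \bar R}.

Lemma L2_cind (A : set T) : measurable A -> (mu A < +oo)%E -> L2 mu (cind A).
Proof.
move=> mA Aoo; apply: (@L2_le _ _ _ _ _ (\1_A)); first exact: cmeasurable_cind.
  apply/integrableP; split; first exact/measurable_EFinP/measurable_indic.
  rewrite (eq_integral (fun x => (\1_A x)%:E)); last first.
    by move=> t _; rewrite gee0_abs// lee_fin.
  by rewrite integral_indic// setIT.
by move=> x; rewrite sqc_cind.
Qed.

Lemma nrm2_cind (A : set T) : measurable A -> nrm2 mu (cind A) = fine (mu A).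
Proof.
move=> mA; rewrite /nrm2; under eq_Rintegral do rewrite sqc_cind.
by rewrite /Rintegral integral_indic// setIT.
Qed.

Lemma L2_indM (W : set T) (h : T -> R[i]) : measurable W -> L2 mu h ->
  L2 mu (fun g => h g * cind W g).
Proof.
move=> mW L2h; under eq_fun do rewrite mulrC.
by apply: (L2M (M := 1)) => //; [exact: cmeasurable_cind|move=> g; exact: normc_cind].
Qed.

Lemma nrm2_indM (W : set T) (h : T -> R[i]) : measurable W -> L2 mu h ->
  nrm2 mu (fun g => h g * cind W g) <= nrm2 mu h.
Proof.
move=> mW L2h; apply: le_Rintegral => //.
- exact: L2_integrable (L2_indM mW L2h).
- exact: L2_integrable.
- move=> g _; rewrite sqcM ler_piMr ?sqc_ge0//.
  by rewrite exprn_ile1// ?normc_ge0// normc_cind.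
Qed.

(** Existence and uniqueness as a sum of indicators equal to 1; applied to translates in a tiling
    and to coset representatives. *)
Lemma sum_unique (J : eqType) (s : seq J) (P : J -> Prop) j : uniq s -> j \in s ->
  P j -> (forall i, i \in s -> P i -> i = j) ->
  \sum_(i <- s) (if `[< P i >] then 1 else 0) = 1 :> R[i].
Proof.
move=> us js Pj uj; rewrite (bigD1_seq j)//= asboolT// big_seq_cond big1 ?addr0//.
move=> i /andP[is_ ij]; rewrite asboolF// => Pi.
by move: ij; rewrite (uj i)// eqxx.
Qed.

End ComplexIndicator.

(** * Finite windows and unfolding along a fundamental domain *)

Section FundamentalDomain.
Context {R : realType} {D : topologicalZmodType}.
Variable nu : {measure set (borel D) -> \bar R}.
Hypothesis nu_haar : haar_measure nu.
Hypothesis hD : hausdorff_space D.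
Implicit Types (A S V : set D).

Lemma compact_sub (S S' : set D) : compact S -> compact S' ->
  compact [set x - y | x in S & y in S'].
Proof.
move=> cS cS'; have -> : [set x - y | x in S & y in S'] =
    (fun p : D * D => p.1 - p.2) @` (S `*` S').
  apply/seteqP; split => [_ [x Sx [y Sy <-]]|_ [[x y] [/= Sx Sy] <-]].
    by exists (x, y).
  by exists x => //; exists y.
apply: continuous_compact; last exact: compact_setX.
by apply: continuous_subspaceT; exact: sub_continuous.
Qed.

(* For g in S' the terms of sum_(w in A) h(w + g), with h supported in S, that may be
   nonzero have w in Om. *)
Definition window A S S' (Om : seq D) :=
  [/\ uniq Om, forall w, w \in Om -> A w
    & forall w g, A w -> S' g -> S (w + g) -> w \in Om].

(** The relevant w lie in the compact set S - S', which meets the discrete subgroup in finitely many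
    points. *)
Lemma window_exists A S S' : is_subgroup A -> discrete_at0 A ->
  compact S -> compact S' -> exists Om, window A S S' Om.
Proof.
move=> sA dA cS cS'.
have /finite_seqP[s sE] := discrete_finite sA dA (compact_sub cS cS').
exists (undup s); split; first exact: undup_uniq.
  move=> w; rewrite mem_undup => ws; have : [set` s] w by [].
  by rewrite -sE => -[].
move=> w g Aw S'g Swg; rewrite mem_undup.
suff : [set` s] w by [].
by rewrite -sE; split=> //; exists (w + g) => //; exists g => //; rewrite addrK.
Qed.

Lemma window_sub A S S' S0 S0' Om : S0 `<=` S -> S0' `<=` S' ->
  window A S S' Om -> window A S0 S0' Om.
Proof.
move=> SS SS' [uO AO OO]; split=> // w g Aw /SS' S'g /SS Sg; exact: (OO w g).
Qed.

(** Finite stand-in for the sum over a whole lattice: for [h] supported in the first set of a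
    window, the two agree at points of its second set, and only there is the value meaningful. *)
Definition periodize (Om : seq D) (h : D -> R[i]) : D -> R[i] :=
  fun g => \sum_(w <- Om) h (w + g).

Lemma L2_periodize s (h : borel D -> R[i]) : L2 nu h -> L2 nu (periodize s h).
Proof. by move=> L2h; apply: L2_sum => w; exact: L2_translate. Qed.

Variables A V : set D.
Hypothesis cA : countable A.
Hypothesis fdV : fundamental_domain nu A V.

Lemma fd_measurable : measurable (V : set (borel D)).
Proof. by case: fdV. Qed.

Lemma fd_compact : compact (closure V).
Proof. by case: fdV => _; rewrite precompactE. Qed.

Lemma fd_finite : (nu V < +oo)%E.
Proof.
have [_ cfin _] := nu_haar.
apply: le_lt_trans (cfin _ fd_compact); apply: le_measure; rewrite ?inE.
- exact: fd_measurable.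
- by apply: compact_borel => //; exact: fd_compact.
- exact: subset_closure.
Qed.

Lemma translate_borel a (W : set (borel D)) : measurable W ->
  measurable ([set g | W (g - a)] : set (borel D)).
Proof.
move=> mW; have -> : [set g : borel D | W ((g : D) - a)] = (+%R (- a) : borel D -> borel D) @^-1` W.
  by apply/seteqP; split => g /=; rewrite addrC.
by rewrite -[X in measurable X]setTI; exact: borel_translate.
Qed.

(** Countability of [A] merges the null sets of all pairs of translates into one, off which the
    translates of [V] form an exact partition. *)
Lemma fd_tiling : {ae nu, forall g : D,
  (exists2 w, A w & V (g - w)) /\
  (forall x, A x -> forall y, A y -> V (g - x) -> V (g - y) -> x = y)}.
Proof.
have [mV _ dV nV] := fdV.
have h1 : {ae nu, forall g : D, exists2 w, A w & V (g - w)}.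
  apply: negligibleS nV => g /= ng [w Aw]; rewrite imageDlE /= => Vg.
  by apply: ng; exists w.
have h2 : {ae nu, forall g : D,
    forall x, A x -> forall y, A y -> V (g - x) -> V (g - y) -> x = y}.
  apply: ae_countable => // x Ax; apply: ae_countable => // y Ay.
  have [->|xy] := pselect (x = y); first exact: aeW.
  have : nu.-negligible ((+%R x @` V) `&` (+%R y @` V)).
    apply/negligibleP; last exact: dV.
    by rewrite !imageDlE; apply: measurableI; exact: translate_borel.
  apply: negligibleS => g /= /not_implyP[Vx /not_implyP[Vy _]].
  by split; [exists (g - x)|exists (g - y)] => //; rewrite addrC subrK.
by apply: aeS (aeI h1 h2) => g []; split.
Qed.

Lemma fd_window S Om : window A S V Om ->
  {ae nu, forall g : D, S g -> \sum_(w <- Om) cind (V : set (borel D)) (g - w) = 1 :> R[i]}.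
Proof.
move=> [uO OA OV]; apply: aeS fd_tiling => g [[w Aw Vw] u] Sg.
under eq_bigr do rewrite cindE.
apply: (sum_unique (P := fun w => V (g - w)) (j := w)) => //.
  by apply: (OV _ (g - w)) => //; rewrite addrC subrK.
by move=> x /OA Ax Vx; exact: u.
Qed.

Lemma L2_fd : L2 nu (cind (V : set (borel D))).
Proof. by apply: L2_cind; [exact: fd_measurable|exact: fd_finite]. Qed.

Lemma cintegrable_cind (W : set (borel D)) (h : borel D -> R[i]) : measurable W ->
  cintegrable nu h -> cintegrable nu (fun g => h g * cind W g).
Proof.
move=> mW hi; apply: (cintegrable_le _ (cintegrable_normc hi)).
  by apply: cmeasurableM; [exact: cintegrable_meas hi|exact: cmeasurable_cind].
by move=> g; rewrite Normc.normcM ler_piMr ?normc_ge0// normc_cind.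
Qed.

(** On [S] the translates of the indicator of [V] by the window add up to 1; inserting this sum and
    translating each term moves the whole integral to [V]. *)
Lemma unfold S Om (h : borel D -> R[i]) : window A S V Om ->
  cintegrable nu h -> (forall g, ~ S g -> h g = 0) ->
  cintegral nu h =
  \sum_(w <- Om) cintegral nu (fun g : D => h (w + g) * cind (V : set (borel D)) g).
Proof.
move=> wO hi hS.
have hw w : cintegrable nu (fun g : D => h g * cind (V : set (borel D)) (g - w)).
  have -> : (fun g : D => h g * cind (V : set (borel D)) (g - w)) =
      (fun g => h g * cind ([set g : D | V (g - w)] : set (borel D)) g).
    by apply/funext => g; rewrite !cindE.
  by apply: cintegrable_cind => //; apply: translate_borel; exact: fd_measurable.
transitivity (cintegral nu (fun g : D => \sum_(w <- Om) h g * cind (V : set (borel D)) (g - w))).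
  apply: ae_eq_cintegral.
  - exact: cintegrable_meas hi.
  - by apply: cmeasurable_sum => w; exact: cintegrable_meas (hw w).
  - apply: aeS (fd_window wO) => g Sg; rewrite -mulr_sumr.
    by have [/Sg ->|/hS ->] := pselect (S g); rewrite ?mulr1 ?mul0r.
rewrite cintegral_sum//; apply: eq_bigr => w _.
rewrite -(cintegral_translate nu_haar w (hw w)).
by congr cintegral; apply/funext => g; rewrite [w + g]addrC addrK.
Qed.

End FundamentalDomain.

(** The indicator of [W] is unfolded along [V]: above almost every g in [V] there are exactly [d]
    elements w of [A] with w + g in [W], one in each coset of [B]. *)
Lemma fd_index {R : realType} {D : topologicalZmodType}
  (nu : {measure set (borel D) -> \bar R}) (nu_haar : haar_measure nu)
  (hD : hausdorff_space D) (A B V W : set D) (d : nat) (r : 'I_d -> D) :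
  is_subgroup A -> is_subgroup B -> discrete_at0 A -> countable A -> B `<=` A ->
  fundamental_domain nu A V -> fundamental_domain nu B W ->
  coset_representatives A B r ->
  fine (nu W) = d%:R * fine (nu V).
Proof.
move=> sA sB dA cA BA fV fW [rA rU].
have cB : countable B by exact: sub_countable (subset_card_le BA) cA.
have AB a b : A a -> A b -> A (a - b) by case: sA => _ h; exact: h.
have A0 : A 0 by case: sA.
have AN a : A a -> A (- a) by exact: subgroupN.
have AD a b : A a -> A b -> A (a + b) by exact: subgroupD.
have B0 : B 0 by case: sB.
have BB a b : B a -> B b -> B (a - b) by case: sB => _ h; exact: h.
have cW := fd_compact fW; have cV := fd_compact fV.
have [Om wO] := window_exists sA dA cW cV.
have wO' : window A (closure W) V Om by apply: window_sub wO => //; exact: subset_closure.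
have mW := fd_measurable fW; have mV := fd_measurable fV.
have L2W := L2_fd nu_haar hD fW; have L2V := L2_fd nu_haar hD fV.
have iE (X : set (borel D)) : (cind X : borel D -> R[i]) = (fun g => cind X g * (cind X g)^*).
  by apply/funext => g; rewrite cindC cind_idem.
have Wi : cintegrable nu (cind (W : set (borel D))).
  by rewrite iE; exact: cintegrable_inner.
have IE (X : set D) : measurable (X : set (borel D)) -> L2 nu (cind (X : set (borel D))) ->
    cintegral nu (cind (X : set (borel D))) = (fine (nu X))%:C%C.
  move=> mX L2X; rewrite -(nrm2_cind nu mX) -inner_nrm2//.
  by congr cintegral; apply/funext => g; rewrite cindC cind_idem.
have Vi : cintegrable nu (cind (V : set (borel D))).
  by rewrite iE; exact: cintegrable_inner.
suff : ((fine (nu W))%:C = (d%:R * fine (nu V))%:C :> R[i])%C by case.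
rewrite -(IE W mW L2W).
have -> : (d%:R * fine (nu V))%:C%C = d%:R * (fine (nu V))%:C%C :> R[i].
  by rewrite rmorphM rmorph_nat.
rewrite -(IE V mV L2V) -(cintegralZ _ Vi).
rewrite (unfold nu_haar cA fV wO' Wi); last first.
  by move=> g nW; rewrite cind_out// => /subset_closure.
rewrite -cintegral_sum; last first.
  move=> w; apply: cintegrable_cind => //.
  exact: (cintegrable_translate nu_haar w Wi).
apply: ae_eq_cintegral.
- apply: cmeasurable_sum => w; apply: cmeasurableM; last exact: cmeasurable_cind.
  by apply: cmeasurable_translate; exact: cmeasurable_cind.
- by apply: cmeasurableM; [exact: cmeasurable_cst|exact: cmeasurable_cind].
have tW : {ae nu, forall g : D, forall l,
  (exists2 w, B w & W (r l + g - w)) /\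
  (forall x, B x -> forall y, B y -> W (r l + g - x) -> W (r l + g - y) -> x = y)}.
  have : {ae nu, forall g : D, forall l, [set: 'I_d] l ->
    (exists2 w, B w & W (r l + g - w)) /\
    (forall x, B x -> forall y, B y -> W (r l + g - x) -> W (r l + g - y) -> x = y)}.
    apply: ae_countable; first exact: finite_set_countable.
    by move=> l _; have := ae_translate nu_haar (r l) (fd_tiling cB fW).
  by apply: aeS => g h l; exact: h.
apply: aeS tW => g tW; rewrite -mulr_suml.
have [Vg|nV] := pselect (V g); last by rewrite cind_out ?mulr0.
congr (_ * _); have [uO OA OV] := wO'.
(* Each w is attributed to its unique coset representative; summing over w first then leaves one
   term for each [l]. *)
transitivity (\sum_(w <- Om) \sum_(l < d)
    (if `[< W (w + g) /\ B (w - r l) >] then 1 else 0) : R[i]).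
  rewrite big_seq [RHS]big_seq; apply: eq_bigr => w wO''.
  have [l [Bl ul]] := rU w (OA _ wO'').
  rewrite cindE; case: asboolP => Ww; last first.
    by rewrite big1// => i _; rewrite asboolF// => -[].
  rewrite (sum_unique (P := fun l => W (w + g) /\ B (w - r l)) (j := l))//.
  - exact: index_enum_uniq.
  - exact: mem_index_enum.
  - by move=> i _ [_ /ul].
rewrite exchange_big /= (eq_bigr (fun=> 1)); last first.
  move=> l _; have [[b Bb Wb] ub] := tW l.
  (* Here [b] is the element of [B] whose translate of [W] contains r l + g, so w = r l - b is the
     element of the coset that brings g into [W]. *)
  apply: (sum_unique (P := fun w => W (w + g) /\ B (w - r l)) (j := r l - b)) => //.
  - apply: (OV _ g) => //; first by apply: AB => //; exact: BA.
    by apply: subset_closure; rewrite addrAC.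
  - rewrite addrAC; split => //.
    by rewrite addrAC subrr -[0 - b]/(0 - b); exact: BB.
  - move=> w _ [Ww Bw]; have Bw' : B (r l - w) by rewrite -opprB -sub0r; exact: BB.
    have -> : b = r l - w; last by rewrite opprB addrC subrK.
    by apply: ub => //; rewrite opprB addrC addrA subrK.
by rewrite sumr_const cardT size_enum_ord.
Qed.

(** * Completeness of the characters on a fundamental domain *)

Section OrthogonalFamily.
Context {R : realType} {d : measure_display} {T : measurableType d}.
Variable mu : {measure set T -> \bar R}.
Context {J : choiceType}.
Variables (L : set J) (e : J -> T -> R[i]) (c : R).
Hypothesis c0 : 0 < c.
Hypothesis L2e : forall l, L2 mu (e l).
Hypothesis e_orth : forall k l, L k -> L l ->
  inner mu (e k) (e l) = if k == l then c%:C%C else 0.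
Implicit Types (u v : T -> R[i]) (s t : seq J).

Definition span_proj s u : T -> R[i] :=
  fun x => \sum_(l <- s) (inner mu u (e l) / c%:C%C) * e l x.

(** Squared distance from [u] to the span of the e l with l in [s] ([residE]), written with the
    coefficients so that it visibly decreases in [s]. The factor 1/c compensates for vectors of
    squared norm [c]. *)
Definition resid s u : R := nrm2 mu u - c^-1 * \sum_(l <- s) sqc (inner mu u (e l)).

Definition family_seq s := uniq s /\ {in s, forall l, L l}.

Lemma L2_proj s u : L2 mu (span_proj s u).
Proof. by apply: L2_sum => l; exact: L2Z. Qed.

Lemma inner_projB s u k : L2 mu u -> {in s, forall l, L l} -> L k -> k \notin s ->
  inner mu (fun x => u x - span_proj s u x) (e k) = inner mu u (e k).
Proof.
move=> L2u sL Lk ks; rewrite innerBl//; last exact: L2_proj.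
rewrite /span_proj inner_suml//; last by move=> l; exact: L2Z.
rewrite big_seq big1 ?subr0// => l ls; rewrite innerZl// e_orth//; last exact: sL.
by case: eqP ls ks => [->->|]//; rewrite mulr0.
Qed.

Lemma residE s u : L2 mu u -> family_seq s ->
  resid s u = nrm2 mu (fun x => u x - span_proj s u x).
Proof.
move=> L2u; elim: s => [|k s IH] [us sL].
  rewrite /resid big_nil mulr0 subr0; congr nrm2; apply/funext => x.
  by rewrite /span_proj big_nil subr0.
move: us => /= /andP[ks us].
have sL' : {in s, forall l, L l} by move=> l ls; apply: sL; rewrite inE ls orbT.
have Lk : L k by apply: sL; rewrite inE eqxx.
set b := inner mu u (e k); have L2r := L2B L2u (L2_proj s u).
have -> : (fun x => u x - span_proj (k :: s) u x) =
    (fun x => (u x - span_proj s u x) - (b / c%:C%C) * e k x).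
  by apply/funext => x; rewrite /span_proj big_cons opprD addrA addrAC.
rewrite (nrm2B L2r (L2Z _ (L2e k))) (nrm2Z _ (L2e k)) innerZr// inner_projB// -/b.
rewrite -IH; last by split.
have ek : nrm2 mu (e k) = c by rewrite nrm2E// e_orth// eqxx.
rewrite ek /resid big_cons -/b.
have -> : b / c%:C%C = c^-1%:C%C * b by rewrite mulrC fmorphV.
have -> : (c^-1%:C%C * b)^* * b = (c^-1 * sqc b)%:C%C.
  rewrite (rmorphM Num.conj) -mulrA [_^* * b]mulrC mul_conjc.
  by rewrite [RHS]rmorphM; congr (_ * _); apply: cplxP => //=; rewrite oppr0.
rewrite sqcM [sqc c^-1%:C%C]sqcE /= expr0n/= addr0.
by field; rewrite lt0r_neq0.
Qed.

Lemma resid_ge0 s u : L2 mu u -> family_seq s -> 0 <= resid s u.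
Proof. by move=> L2u fs; rewrite residE// nrm2_ge0. Qed.

Lemma resid_le s u : resid s u <= nrm2 mu u.
Proof.
rewrite /resid gerBl mulr_ge0 ?invr_ge0 ?(ltW c0)// sumr_ge0// => l _.
exact: sqc_ge0.
Qed.

Lemma le_sum_sub (F : J -> R) s t : (forall l, 0 <= F l) -> uniq s -> uniq t ->
  {subset s <= t} -> \sum_(l <- s) F l <= \sum_(l <- t) F l.
Proof.
move=> F0 us ut st; rewrite [leRHS](bigID (mem s))/=.
have -> : \sum_(l <- t | l \in s) F l = \sum_(l <- s) F l.
  rewrite -big_filter; apply: perm_big; apply: uniq_perm => //.
    exact: filter_uniq.
  by move=> l; rewrite mem_filter; case: (boolP (l \in s)) => // /st ->.
by rewrite lerDl sumr_ge0.
Qed.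

Lemma resid_mono s t u : uniq s -> uniq t -> {subset s <= t} ->
  resid t u <= resid s u.
Proof.
move=> us ut st; rewrite /resid lerD2l lerN2 ler_wpM2l ?invr_ge0 ?(ltW c0)//.
by apply: le_sum_sub => // l; exact: sqc_ge0.
Qed.

Lemma resid_D s u v : L2 mu u -> L2 mu v -> family_seq s ->
  resid s (fun x => u x + v x) <= 2 * resid s u + 2 * resid s v.
Proof.
move=> L2u L2v fs; rewrite !residE//; last exact: L2D.
have := nrm2D_le (L2B L2u (L2_proj s u)) (L2B L2v (L2_proj s v)).
suff -> : (fun x => u x - span_proj s u x + (v x - span_proj s v x)) =
  (fun x => u x + v x - span_proj s (fun x => u x + v x) x) by [].
apply/funext => x; rewrite addrACA -opprD; congr (_ - _).
rewrite /span_proj -big_split /=; apply: eq_bigr => l _.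
by rewrite innerDl// mulrDl mulrDl.
Qed.

Lemma family_seqU s t : family_seq s -> family_seq t ->
  exists r, [/\ family_seq r, {subset s <= r} & {subset t <= r}].
Proof.
move=> [us sL] [ut tL]; exists (undup (s ++ t)); split.
- split; first exact: undup_uniq.
  by move=> l; rewrite mem_undup mem_cat => /orP[/sL|/tL].
- by move=> l ls; rewrite mem_undup mem_cat ls.
- by move=> l ls; rewrite mem_undup mem_cat ls orbT.
Qed.

(** Membership in the closed linear span. Measuring distance by [resid] lets two approximating lists
    be merged, since enlarging the list only helps. *)
Definition closed_span u := L2 mu u /\
  forall eps : R, 0 < eps -> exists2 s, family_seq s & resid s u <= eps.

Lemma closed_spanD u v : closed_span u -> closed_span v ->
  closed_span (fun x => u x + v x).
Proof.
move=> [L2u hu] [L2v hv]; split; first exact: L2D.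
move=> eps eps0; have e4 : 0 < eps / 4 by rewrite divr_gt0.
have [s fs su] := hu _ e4; have [t ft tv] := hv _ e4.
have [r [fr sr tr]] := family_seqU fs ft; exists r => //.
have := resid_D L2u L2v fr.
have := resid_mono u fs.1 fr.1 sr; have := resid_mono v ft.1 fr.1 tr.
by move: su tv; lra.
Qed.

Lemma closed_spanZ a u : closed_span u -> closed_span (fun x => a * u x).
Proof.
move=> [L2u hu]; split; first exact: L2Z.
move=> eps eps0; have a1 : 0 < sqc a + 1 by rewrite ltr_wpDl ?sqc_ge0.
have [s fs su] := hu _ (divr_gt0 eps0 a1); exists s => //.
have -> : resid s (fun x => a * u x) = sqc a * resid s u.
  rewrite /resid nrm2Z// mulrBr; congr (_ - _); rewrite mulrCA; congr (_ * _).
  by rewrite mulr_sumr; apply: eq_bigr => l _; rewrite innerZl// sqcM.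
apply: (@le_trans _ _ ((sqc a + 1) * resid s u)).
  by rewrite ler_wpM2r ?resid_ge0// lerDl.
by rewrite mulrC -ler_pdivlMr.
Qed.

Lemma closed_span0 : closed_span (fun=> 0).
Proof.
split; first exact: L2_0.
move=> eps eps0; exists [::]; first by split.
apply: le_trans (resid_le _ _) _; rewrite nrm2E; last exact: L2_0.
by rewrite /inner; under eq_fun do rewrite mul0r; rewrite cintegral0 ltW.
Qed.

Lemma closed_span_sum (K : eqType) (s : seq K) (h : K -> T -> R[i]) :
  {in s, forall k, closed_span (h k)} -> closed_span (fun x => \sum_(k <- s) h k x).
Proof.
elim: s => [_|k s IH hs].
  by under eq_fun do rewrite big_nil; exact: closed_span0.
under eq_fun do rewrite big_cons; apply: closed_spanD.
  by apply: hs; rewrite inE eqxx.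
by apply: IH => i is_; apply: hs; rewrite inE is_ orbT.
Qed.

Lemma closed_span_e l : L l -> closed_span (e l).
Proof.
move=> Ll; split=> // eps eps0; exists [:: l].
  by split => // k; rewrite inE => /eqP ->.
rewrite /resid big_seq1 e_orth// eqxx.
have -> : nrm2 mu (e l) = c by rewrite nrm2E// e_orth// eqxx.
rewrite sqcE /= expr0n/= addr0 expr2 mulrA mulVf ?lt0r_neq0// mul1r subrr.
exact: ltW.
Qed.

Lemma closed_span_lim u : L2 mu u ->
  (forall eps : R, 0 < eps ->
     exists2 v, closed_span v & nrm2 mu (fun x => u x - v x) <= eps) ->
  closed_span u.
Proof.
move=> L2u h; split=> // eps eps0; have e4 : 0 < eps / 4 by rewrite divr_gt0.
have [v [L2v hv] uv] := h _ e4; have [s fs sv] := hv _ e4; exists s => //.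
have := resid_D L2v (L2B L2u L2v) fs.
have -> : (fun x => v x + (u x - v x)) = u by apply/funext => x; rewrite addrC subrK.
have := resid_le s (fun x => u x - v x).
by move: uv sv; lra.
Qed.

Lemma closed_span_approx u : closed_span u -> forall eps : R, 0 < eps ->
  exists2 s, {in s, forall l, L l} &
    nrm2 mu (fun x => u x - span_proj s u x) <= eps.
Proof.
move=> [L2u h] eps /h[s [us sL] su]; exists s => //.
by rewrite -residE//; split.
Qed.

(** Nonnegative residuals bound every finite partial sum, and small residuals give the converse. The
    family is not normalized, whence the factor [c]. *)
Lemma parseval u : closed_span u ->
  \esum_(l in L) (sqc (inner mu u (e l)))%:E = (c * nrm2 mu u)%:E.
Proof.
move=> [L2u hu]; apply/eqP; rewrite eq_le; apply/andP; split.
  apply: ge_ereal_sup => _ [X [fX XL] <-].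
  have /finite_seqP[s0 Xs0] := fX.
  have Xs : X = [set` undup s0].
    by rewrite Xs0; apply/seteqP; split => l /=; rewrite mem_undup.
  rewrite Xs -fsbig_seq ?undup_uniq// sumEFin lee_fin.
  have fs : family_seq (undup s0).
    by split; [exact: undup_uniq|move=> l ls; apply: XL; rewrite Xs].
  have := resid_ge0 L2u fs; rewrite /resid subr_ge0 mulrC ler_pdivrMr// => h.
  by rewrite [leRHS]mulrC.
apply/lee_addgt0Pr => eps eps0; have ec : 0 < eps / c by rewrite divr_gt0.
have [s [us sL]] := hu _ ec; rewrite /resid lerBlDr => su.
pose S : R := \sum_(l <- s) sqc (inner mu u (e l)).
apply: (@le_trans _ _ (S%:E + eps%:E)%E).
  rewrite -EFinD lee_fin.
  have : c * nrm2 mu u <= c * (eps / c + c^-1 * S) by rewrite ler_pM2l.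
  by rewrite mulrDr mulrCA divff ?lt0r_neq0// mulr1 mulrA divff ?lt0r_neq0// mul1r addrC.
rewrite leeD2r//; apply: ereal_sup_ge; exists S%:E => //.
exists [set` s]; first by split; [exact: finite_seq|move=> l; exact: sL].
by rewrite -fsbig_seq// sumEFin.
Qed.

End OrthogonalFamily.

Section AbsoluteValueIteration.
Context {R : realType}.

(* Polynomials in t increasing to |t| on [-1, 1], as in the proof of Stone-Weierstrass. *)
Fixpoint abs_iter (t : R) n : R :=
  if n is m.+1 then abs_iter t m + (t ^+ 2 - abs_iter t m ^+ 2) / 2 else 0.

(** With a = |t| and p the current iterate, the next error is (a - p)(1 - (a + p)/2): the old error
    times a factor between 0 and 1 - a/2. *)
Lemma abs_iter_bounds (t : R) n : `|t| <= 1 ->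
  0 <= abs_iter t n <= `|t| /\ `|t| - abs_iter t n <= (1 - `|t| / 2) ^+ n.
Proof.
have := normr_ge0 t.
elim: n => [|n IH] /= t0 t1; first by rewrite lexx t0 subr0 expr0.
have [/andP[p0 pt] tp] := IH t0 t1.
rewrite -[t ^+ 2]real_normK ?num_real// [(1 - _) ^+ n.+1]exprS.
move: (abs_iter t n) (`|t|) ((1 - `|t| / 2) ^+ n) t0 t1 p0 pt tp => p a z a0 a1 p0 pa apz.
have h : a - (p + (a ^+ 2 - p ^+ 2) / 2) = (a - p) * (1 - (a + p) / 2) by field.
have h1 : 0 <= (a - p) * (1 - (a + p) / 2) by apply: mulr_ge0; lra.
split; first by apply/andP; split; nra.
by rewrite h [leLHS]mulrC; apply: ler_pM; lra.
Qed.

Lemma abs_iter_cvg (t : R) : `|t| <= 1 -> abs_iter t n @[n --> \oo] --> `|t|.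
Proof.
(* At 0 the geometric ratio would be 1, but there all the iterates vanish. *)
move=> t1; have [->|t0] := eqVneq t 0.
  rewrite normr0 (_ : (fun n => _) = fun=> 0); first exact: cvg_cst.
  by apply/funext; elim=> //= n ->; rewrite expr0n subr0 mul0r addr0.
have : `|t| - abs_iter t n @[n --> \oo] --> (0 : R).
  apply: (@squeeze_cvgr _ _ _ _ (fun=> 0) (fun n => (1 - `|t| / 2) ^+ n)).
  - apply: nearW => n; have [/andP[_ h] ->] := abs_iter_bounds n t1.
    by rewrite subr_ge0 h.
  - exact: cvg_cst.
  - apply: cvg_expr; have := normr_gt0 t; rewrite t0 => t0'.
    by rewrite ger0_norm; lra.
move=> h; suff : `|t| - (`|t| - abs_iter t n) @[n --> \oo] --> `|t| - 0.
  by rewrite subr0; under eq_fun do rewrite subKr.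
by apply: cvgB => //; exact: cvg_cst.
Qed.

End AbsoluteValueIteration.

(** Layer-cake formula for an integer: it will turn a hit count into a sum of indicators of
    superlevel sets. *)
Lemma sum_ltn_ord n N : (\sum_(j < N) (j < n)%N = minn n N)%N.
Proof.
elim: N => [|N IH]; first by rewrite big_ord0 minn0.
rewrite big_ord_recr /= {}IH; have [nN|Nn] := leqP n N.
  by rewrite (minn_idPl (leqW nN)) addn0.
by rewrite (minn_idPr Nn) addn1.
Qed.

Lemma eq_big_supp (J : eqType) (W : nmodType) (F : J -> W) s t : uniq s -> uniq t ->
  (forall x, F x != 0 -> (x \in s) = (x \in t)) ->
  \sum_(x <- s) F x = \sum_(x <- t) F x.
Proof.
move=> us ut st; rewrite (bigID (fun x => F x != 0))/= [RHS](bigID (fun x => F x != 0))/=.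
congr (_ + _).
  rewrite -big_filter -[RHS]big_filter; apply: perm_big; apply: uniq_perm.
  - exact: filter_uniq.
  - exact: filter_uniq.
  - by move=> x; rewrite !mem_filter; case: (boolP (F x != 0)) => // /st ->.
by rewrite !big1// => x /negbNE/eqP.
Qed.

(** * Lattice characters on a fundamental domain and their Parseval identity *)

Section PeriodicParseval.
Context {R : realType} {G : topologicalZmodType}.
Local Notation D := (dual_group R G).
Variable nu : {measure set (borel D) -> \bar R}.
Hypothesis nu_haar : haar_measure nu.

Lemma eval_cmeasurable (x : G) : cmeasurable (fun g : borel D => (g : D) x).
Proof. by apply: continuous_cmeasurable => g e; exact: dual_eval_nbhs. Qed.

Variables (L : set G) (V : set D).
Local Notation A := (annihilator L : set D).
Hypothesis L_subgroup : is_subgroup L.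
Hypothesis L_countable : countable L.
Hypothesis A_discrete : discrete_at0 A.
Hypothesis A_countable : countable A.
Hypothesis fdV : fundamental_domain nu A V.
Hypothesis separated : forall l, L l -> l != 0 -> exists g : D, g l != 1.

Let hD : hausdorff_space D := @dual_hausdorff R G.
Local Notation indV := (cind (V : set (borel D))).
Local Notation c := (fine (nu V)).

(** If [V] were null, its countably many translates would be too, yet they cover the dual up to a
    null set. *)
Lemma fd_pos : 0 < fine (nu V).
Proof.
rewrite lt0r fine_ge0// andbT; apply/eqP => V0.
have [nuT _ _] := nu_haar; have Voo := fd_finite nu_haar hD fdV.
have {}V0 : nu V = 0%E by rewrite -[LHS]fineK ?V0// ge0_fin_numE.
have aeV : {ae nu, forall g : D, ~ V g}.
  by exists V; split=> //; [exact: fd_measurable fdV|move=> g /= /contrapT].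
have aeVw : {ae nu, forall g : D, forall w, A w -> ~ V (g - w)}.
  apply: ae_countable => // w _.
  have := ae_translate nu_haar (- w) aeV.
  by apply: aeS => g; rewrite addrC.
have [N [mN N0 NT]] : {ae nu, forall g : D, False}.
  apply: (@aeS _ _ _ _ _ (fun=> False) _ (aeI (fd_tiling A_countable fdV) aeVw)).
  by move=> g [[[w Aw Vw] _] /(_ w Aw)].
move: nuT => /eqP; apply; apply/eqP; rewrite eq_le measure_ge0 andbT -N0.
by apply: le_measure; rewrite ?inE//; move=> g _; exact: NT.
Qed.

(** The sign is chosen so that conjugation in [inner nu u (char_on l)] leaves the integral of [u]
    against g(l) over [V]. *)
Definition char_on (l : G) : borel D -> R[i] := fun g => (g : D) (- l) * indV g.

Lemma L2_char_on l : L2 nu (char_on l).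
Proof.
apply: (@L2M _ _ _ _ 1); first exact: eval_cmeasurable.
  by move=> g; rewrite dual_normc.
exact: L2_fd fdV.
Qed.

(** Since g |-> g(l) is invariant under the annihilator, its integral is the same over [V] and over
    a translate of [V]. Translating by a character [g0] with g0(l) different from 1 multiplies it by
    g0(l), so it vanishes. *)
Lemma integral_char_on l : L l -> l != 0 ->
  cintegral nu (fun g : borel D => (g : D) l * indV g) = 0.
Proof.
move=> Ll l0; have [g0 g0l] := separated Ll l0.
have int_char (W : set (borel D)) : measurable W -> (nu W < +oo)%E ->
    cintegrable nu (fun g : borel D => (g : D) l * cind W g).
  move=> mW Woo.
  have L2W := L2_cind mW Woo.
  have L2c : L2 nu (fun g : borel D => (g : D) l * cind W g).
    apply: (@L2M _ _ _ _ 1) => //; first exact: eval_cmeasurable.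
    by move=> g; rewrite dual_normc.
  have -> : (fun g : borel D => (g : D) l * cind W g) =
    (fun g => (g : D) l * cind W g * (cind W g)^*).
    by apply/funext => g; rewrite cindC -mulrA cind_idem.
  exact: cintegrable_inner.
have mV := fd_measurable fdV; have Voo := fd_finite nu_haar hD fdV.
set I := cintegral nu _.
pose W := [set g : D | V (g0 + g)].
have mW : measurable (W : set (borel D)).
  by rewrite -[X in measurable X]setTI; exact: borel_translate.
have Woo : (nu W < +oo)%E by rewrite (haar_preimage nu_haar g0 mV).
have hi := int_char W mW Woo.
have I1 : I = g0 l * cintegral nu (fun g : borel D => (g : D) l * cind (W : set (borel D)) g).
  rewrite -cintegralZ// /I -(cintegral_translate nu_haar g0 (int_char V mV Voo)).
  congr cintegral; apply/funext => g; rewrite dual_addE mulrA; congr (_ * _).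
(* What remains is independence of the fundamental domain: the integral over [W], that is [V]
   shifted by - g0, is unfolded along [V], where exactly one translate contributes. *)
suff I2 : cintegral nu (fun g : borel D => (g : D) l * cind (W : set (borel D)) g) = I.
  move: I1; rewrite I2 => /eqP; rewrite -subr_eq0 -[X in X - _]mul1r -mulrBl mulf_eq0.
  by rewrite subr_eq0 eq_sym (negbTE g0l) => /eqP.
pose S := [set g : D | closure V (g0 + g)].
have cS : compact S.
  have -> : S = +%R (- g0) @` closure V.
    by rewrite imageDlE; apply/seteqP; split => g; rewrite /S /= opprK addrC.
  apply: continuous_compact; last exact: fd_compact fdV.
  by apply: continuous_subspaceT; exact: translate_continuous.
have [Om wO] := window_exists (annihilator_subgroup L) A_discrete cS (fd_compact fdV).
have wO1 : window A S V Om by apply: window_sub wO => //; exact: subset_closure.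
rewrite (unfold nu_haar A_countable fdV wO1 hi); last first.
  move=> g nS; rewrite cind_out ?mulr0// => Vg; apply: nS.
  exact: subset_closure.
have hw w : cintegrable nu (fun g : D => (w + g) l * cind (W : set (borel D)) (w + g) * indV g).
  by apply: cintegrable_cind => //; exact: (cintegrable_translate nu_haar w hi).
rewrite -cintegral_sum//; apply: ae_eq_cintegral.
- by apply: cmeasurable_sum => w; exact: cintegrable_meas (hw w).
- exact: cintegrable_meas (int_char V mV Voo).
have [uO OA OV] := wO1.
have := ae_translate nu_haar g0 (fd_tiling A_countable fdV).
apply: aeS => g [[w Aw Vw] uw].
have [Vg|nV] := pselect (V g); last first.
  by rewrite cind_out// mulr0 big1// => x _; rewrite mulr0.
rewrite -mulr_suml; congr (_ * _).
transitivity (g l * \sum_(w <- Om) cind (W : set (borel D)) (w + g)).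
  rewrite mulr_sumr big_seq [RHS]big_seq; apply: eq_bigr => x /OA Ax.
  by rewrite dual_addE Ax// mul1r.
under eq_bigr do rewrite cindE.
have AN a : A a -> A (- a) by apply: subgroupN; exact: annihilator_subgroup.
rewrite (sum_unique (P := fun w => W (w + g)) (j := - w)) ?mulr1//.
- apply: (OV _ g) => //; first exact: AN.
  by apply: subset_closure; rewrite addrCA addrC.
- by rewrite /W /= addrCA addrC.
- move=> x /OA Ax Wx; rewrite (uw w Aw (- x) (AN _ Ax) Vw) ?opprK//.
  by rewrite [g0 + _ + _]addrC addrCA.
Qed.

Lemma char_on_orth k l : L k -> L l ->
  inner nu (char_on k) (char_on l) = if k == l then (fine (nu V))%:C%C else 0.
Proof.
move=> Lk Ll; have [L0 LB] := L_subgroup.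
have -> : inner nu (char_on k) (char_on l) =
    cintegral nu (fun g : borel D => (g : D) (l - k) * indV g).
  congr cintegral; apply/funext => g; rewrite /char_on rmorphM/= cindC.
  by rewrite mulrACA cind_idem -[X in _ * X * _]dualN opprK -characterD addrC.
have [<-|kl] := eqVneq k l; last first.
  apply: integral_char_on; first exact: LB.
  by rewrite subr_eq0 eq_sym.
rewrite subrr -(nrm2_cind nu (fd_measurable fdV)) -inner_nrm2; last exact: L2_fd fdV.
congr cintegral; apply/funext => g.
by rewrite (character_like0 (dual_like _)) mul1r cindC cind_idem.
Qed.


Local Notation e := char_on.
Local Notation spanned := (closed_span nu L e c).

Let c0 : 0 < c := fd_pos.
Let L2e := L2_char_on.
Let e_orth := char_on_orth.
Let mV := fd_measurable fdV.
Let L2V : L2 nu indV := L2_fd nu_haar hD fdV.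
Let sA : is_subgroup A := annihilator_subgroup L.
Let L0 : L 0 := L_subgroup.1.
Let LN l : L l -> L (- l).
Proof. exact: subgroupN. Qed.
Let LD k l : L k -> L l -> L (k + l).
Proof. exact: subgroupD. Qed.

Lemma L2_char_mul m (u : borel D -> R[i]) : L2 nu u ->
  L2 nu (fun g : borel D => (g : D) m * u g).
Proof.
move=> L2u; apply: (@L2M _ _ _ _ 1) => //; first exact: eval_cmeasurable.
by move=> g; rewrite dual_normc.
Qed.

(** Multiplication by g(m) is an isometry that sends e l to e (l - m), so it preserves the closed
    span. *)
Lemma spanned_char m u : L m -> spanned u ->
  spanned (fun g : borel D => (g : D) m * u g).
Proof.
move=> Lm uP; have L2u : L2 nu u by case: uP.
apply: (closed_span_lim c0 L2e e_orth) => //; first exact: L2_char_mul.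
move=> eps eps0; have [s sL us] := closed_span_approx c0 L2e e_orth uP eps0.
exists (fun g : borel D => (g : D) m * span_proj nu e c s u g).
  have -> : (fun g : borel D => (g : D) m * span_proj nu e c s u g) =
      (fun g : borel D => \sum_(l <- s) (inner nu u (e l) / c%:C%C) * e (l - m) g).
    apply/funext => g; rewrite /span_proj mulr_sumr; apply: eq_bigr => l _.
    by rewrite mulrCA /char_on opprB characterD; congr (_ * _); rewrite mulrA.
  apply: (closed_span_sum c0 L2e e_orth) => l ls; apply: (closed_spanZ c0 L2e e_orth).
  by apply: (closed_span_e c0 L2e e_orth) => //; apply: LD; [exact: sL|exact: LN].
apply: le_trans us; rewrite /nrm2 le_eqVlt; apply/orP; left; apply/eqP.
by apply: eq_Rintegral => g _; rewrite -mulrBr sqcM dual_normc expr1n mul1r.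
Qed.

(* These functions form an algebra closed under bounded pointwise limits on V; it will be
   shown to contain the periodizations of all indicators of relatively compact Borel sets,
   whence the completeness of the characters in L^2(V). *)
Definition approximable (u : borel D -> R[i]) :=
  [/\ cmeasurable u, exists M, forall g, Normc.normc (u g) <= M
    & spanned (fun g => u g * indV g)].

Lemma approximableD u v : approximable u -> approximable v ->
  approximable (fun g => u g + v g).
Proof.
move=> [hu [M uM] su] [hv [N vN] sv]; split; first exact: cmeasurableD.
  by exists (M + N) => g; apply: le_trans (le_normcD _ _) _; rewrite lerD.
by under eq_fun do rewrite mulrDl; exact: (closed_spanD c0 L2e e_orth).
Qed.

Lemma approximableZ a u : approximable u -> approximable (fun g => a * u g).
Proof.
move=> [hu [M uM] su]; split.
- by apply: cmeasurableM => //; exact: cmeasurable_cst.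
- exists (Normc.normc a * M) => g.
  by rewrite Normc.normcM ler_wpM2l// normc_ge0.
- by under eq_fun do rewrite -mulrA; exact: (closed_spanZ c0 L2e e_orth).
Qed.

Lemma approximable_char l : L l -> approximable (fun g : borel D => (g : D) l).
Proof.
move=> Ll; split; first exact: eval_cmeasurable.
  by exists 1 => g; rewrite dual_normc.
have -> : (fun g : borel D => (g : D) l * indV g) = e (- l).
  by apply/funext => g; rewrite /char_on opprK.
by apply: (closed_span_e c0 L2e e_orth) => //; exact: LN.
Qed.

Lemma approximable1 : approximable (fun=> 1).
Proof.
have := approximable_char L0; congr approximable; apply/funext => g.
exact: character_like0 (dual_like _).
Qed.

Lemma approximable_cst a : approximable (fun=> a).
Proof.
by have := approximableZ a approximable1; under eq_fun do rewrite mulr1.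
Qed.

(** If a finite combination p of the e l approximates [v] on [V], then u p is a combination of
    characters times u 1_V, hence spanned by [spanned_char]; boundedness of [u] controls the
    error. *)
Lemma approximableM u v : approximable u -> approximable v ->
  approximable (fun g => u g * v g).
Proof.
move=> [hu [M uM] su] [hv [N vN] sv].
have M0 : 0 <= M by apply: le_trans (normc_ge0 _) (uM point).
split; first exact: cmeasurableM.
  exists (M * N) => g; rewrite Normc.normcM.
  by apply: ler_pM; rewrite ?normc_ge0.
have L2w (w : borel D -> R[i]) : L2 nu w -> L2 nu (fun g => u g * w g).
  by move=> L2w; exact: (L2M hu uM).
apply: (closed_span_lim c0 L2e e_orth) => //.
  by under eq_fun do rewrite -mulrA; apply: L2w; case: sv.
(* The bound is M^2; adding 1 keeps the divisor positive. *)
move=> eps eps0; have M1 : 0 < M ^+ 2 + 1 by rewrite ltr_wpDl// sqr_ge0.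
have [s sL vs] := closed_span_approx c0 L2e e_orth sv (divr_gt0 eps0 M1).
set p := span_proj _ _ _ _ _ in vs.
exists (fun g => u g * p g).
  have -> : (fun g => u g * p g) = (fun g : borel D =>
    \sum_(l <- s) (inner nu (fun g => v g * indV g) (e l) / c%:C%C) *
      ((g : D) (- l) * (u g * indV g))).
    apply/funext => g; rewrite /p /span_proj mulr_sumr; apply: eq_bigr => l _.
    by rewrite mulrCA; congr (_ * _); rewrite /char_on mulrCA.
  apply: (closed_span_sum c0 L2e e_orth) => l ls; apply: (closed_spanZ c0 L2e e_orth).
  by apply: spanned_char => //; apply: LN; exact: sL.
have L2p : L2 nu p by apply: L2_proj => // l; exact: L2e.
have L2d : L2 nu (fun g => v g * indV g - p g) by apply: L2B => //; case: sv.
apply: (@le_trans _ _ (M ^+ 2 * nrm2 nu (fun g => v g * indV g - p g))).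
  rewrite /nrm2 -RintegralZl//; last exact: L2_integrable.
  apply: le_Rintegral => //.
  - apply: L2_integrable; apply: L2B; last exact: L2w.
    by under eq_fun do rewrite -mulrA; apply: L2w; case: sv.
  - exact: (integrableZl measurableT _ (L2_integrable L2d)).
  - move=> g _; rewrite -mulrA -mulrBr sqcM ler_wpM2r ?sqc_ge0//.
    by rewrite lerXn2r ?nnegrE ?normc_ge0.
apply: (@le_trans _ _ ((M ^+ 2 + 1) * nrm2 nu (fun g => v g * indV g - p g))).
  by rewrite ler_wpM2r ?nrm2_ge0// lerDl.
by rewrite mulrC -ler_pdivlMr.
Qed.

Lemma approximableX u n : approximable u -> approximable (fun g => u g ^+ n).
Proof.
move=> ua; elim: n => [|n IH]; first exact: approximable1.
by under eq_fun do rewrite exprS; exact: approximableM.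
Qed.

(** Dominated convergence on [V], which has finite measure: squared differences are at most (2M)^2.
    Convergence off [V] is irrelevant to the restrictions. *)
Lemma approximable_lim (M : R) (u_ : nat -> borel D -> R[i]) (u : borel D -> R[i]) :
  (forall n, approximable (u_ n)) -> cmeasurable u ->
  (forall n g, Normc.normc (u_ n g) <= M) -> (forall g, Normc.normc (u g) <= M) ->
  (forall g, V g -> sqc (u_ n g - u g) @[n --> \oo] --> (0 : R)) ->
  approximable u.
Proof.
move=> hu mu uM ulM cv; split => //; first by exists M.
have L2w (w : borel D -> R[i]) : cmeasurable w -> (forall g, Normc.normc (w g) <= M) ->
    L2 nu (fun g => w g * indV g) by move=> mw wM; exact: (L2M mw wM).
have mu_ n : cmeasurable (u_ n) by case: (hu n).
apply: (closed_span_lim c0 L2e e_orth) => //; first exact: L2w.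
move=> eps eps0.
have : nrm2 nu (fun g => u g * indV g - u_ n g * indV g) @[n --> \oo] --> (0 : R).
  apply: (@nrm2_cvg _ _ _ _ _ (fun g => 4 * M ^+ 2 * sqc (indV g))).
  - by move=> n; have [] := L2B (L2w _ mu ulM) (L2w _ (mu_ n) (uM n)).
  - exact: (integrableZl measurableT _ (L2_integrable L2V)).
  - move=> n g; rewrite -mulrBl sqcM ler_wpM2r ?sqc_ge0//.
    have -> : 4 * M ^+ 2 = (M + M) ^+ 2 by ring.
    rewrite lerXn2r ?nnegrE ?normc_ge0//.
      by rewrite addr_ge0// (le_trans (normc_ge0 _) (ulM g)).
    by apply: le_trans (le_normcD _ _) _; rewrite normcN lerD.
  - move=> g; under eq_fun do rewrite -mulrBl sqcM normc_subC.
    have [/cv h|nV] := pselect (V g).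
      suff : sqc (u_ n g - u g) * sqc (indV g) @[n --> \oo] --> 0 * sqc (indV g).
        by rewrite mul0r.
      by apply: cvgM => //; exact: cvg_cst.
    by rewrite cind_out// Normc.normc0 expr0n/=; under eq_fun do rewrite mulr0; exact: cvg_cst.
move=> /cvgrPdist_lt/(_ _ eps0)[n _ /(_ n (leqnn n))].
rewrite /= sub0r normrN ger0_norm ?nrm2_ge0// => h.
by exists (fun g => u_ n g * indV g); [case: (hu n)|exact: ltW].
Qed.

Definition rapproximable (q : borel D -> R) := approximable (fun g => (q g)%:C%C).

Lemma normc_real (a : R) : Normc.normc a%:C%C = `|a|.
Proof. by rewrite /= expr0n/= addr0 sqrtr_sqr. Qed.

Lemma rapproximable_meas q : rapproximable q -> measurable_fun setT q.
Proof. by case => -[]. Qed.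

Lemma rapproximable_lim (M : R) (q_ : nat -> borel D -> R) (q : borel D -> R) :
  (forall n, rapproximable (q_ n)) -> measurable_fun setT q ->
  (forall n g, `|q_ n g| <= M) -> (forall g, `|q g| <= M) ->
  (forall g, V g -> q_ n g @[n --> \oo] --> q g) ->
  rapproximable q.
Proof.
move=> hq mq qM qlM cv; apply: (approximable_lim (M := M) hq).
- exact: cmeasurable_real.
- by move=> n g; rewrite normc_real.
- by move=> g; rewrite normc_real.
- move=> g /cv h; under eq_fun do rewrite -rmorphB normc_real real_normK ?num_real//.
  have : (q_ n g - q g) @[n --> \oo] --> (0 : R).
    by rewrite -(subrr (q g)); apply: cvgB => //; exact: cvg_cst.
  move=> h0; suff : (q_ n g - q g) * (q_ n g - q g) @[n --> \oo] --> (0 * 0 : R).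
    by rewrite mulr0; under eq_fun do rewrite -expr2.
  exact: cvgM.
Qed.

Lemma rapproximableD p q : rapproximable p -> rapproximable q ->
  rapproximable (fun g => p g + q g).
Proof.
move=> hp hq; have := approximableD hp hq.
by congr approximable; apply/funext => g; rewrite -rmorphD.
Qed.

Lemma rapproximableM p q : rapproximable p -> rapproximable q ->
  rapproximable (fun g => p g * q g).
Proof.
move=> hp hq; have := approximableM hp hq.
by congr approximable; apply/funext => g; rewrite -rmorphM.
Qed.

Lemma rapproximable_cst a : rapproximable (fun=> a).
Proof. exact: approximable_cst. Qed.

Lemma rapproximableX q n : rapproximable q -> rapproximable (fun g => q g ^+ n).
Proof.
move=> hq; have := approximableX n hq.
by congr approximable; apply/funext => g; rewrite -rmorphXn.
Qed.

Lemma rapproximable_Re u : approximable u -> approximable (fun g => (u g)^*) ->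
  rapproximable (fun g => cRe (u g)).
Proof.
move=> hu hC; have := approximableZ (2^-1)%:C%C (approximableD hu hC).
congr approximable; apply/funext => g; case: (u g) => a b.
by rewrite conjcE; apply: cplxP => /=; field.
Qed.

(** The iterates [abs_iter] are polynomials in [q], so they stay in the algebra; their bounded limit
    is |q|. *)
Lemma rapproximable_abs q : rapproximable q -> (forall g, `|q g| <= 1) ->
  rapproximable (fun g => `|q g|).
Proof.
move=> hq q1; apply: (rapproximable_lim (M := 1) (q_ := fun n g => abs_iter (q g) n)).
- elim=> [|n IH] /=; first exact: rapproximable_cst.
  apply: (rapproximableD IH).
  under eq_fun do rewrite mulrC -mulN1r.
  apply: rapproximableM; first exact: rapproximable_cst.
  apply: rapproximableD; first exact: rapproximableX.
  by apply: rapproximableM; [exact: rapproximable_cst|exact: rapproximableX].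
- by apply: measurableT_comp => //; exact: rapproximable_meas.
- move=> n g; have [/andP[p0 pq] _] := abs_iter_bounds n (q1 g).
  by rewrite ger0_norm// (le_trans pq).
- by move=> g; rewrite normr_id.
- by move=> g _; exact: abs_iter_cvg.
Qed.

Lemma rapproximable_char_Re l : L l ->
  rapproximable (fun g : borel D => cRe ((g : D) l)).
Proof.
move=> Ll; apply: rapproximable_Re; first exact: approximable_char.
by under eq_fun do rewrite -dualN; apply: approximable_char; exact: LN.
Qed.

Lemma rapproximable_char_Im l : L l ->
  rapproximable (fun g : borel D => cIm ((g : D) l)).
Proof.
move=> Ll; have hu := approximableZ (Complex 0 (-1)) (approximable_char Ll).
have hC := approximableZ (Complex 0 1) (approximable_char (LN Ll)).
have := rapproximable_Re hu; rewrite /rapproximable => h.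
have -> : (fun g : borel D => (cIm ((g : D) l))%:C%C) =
    (fun g : borel D => (cRe (Complex 0 (-1) * (g : D) l))%:C%C).
  by apply/funext => g; rewrite cReM /= mul0r sub0r mulN1r opprK.
apply: h; move: hC; congr approximable; apply/funext => g.
rewrite dualN; case: ((g : D) l) => a b; rewrite conjcE.
by apply: cplxP => /=; ring.
Qed.

Lemma rapproximable_bounded q : rapproximable q -> exists2 M, 0 < M & forall g, `|q g| <= M.
Proof.
move=> [_ [M qM] _]; exists (`|M| + 1); first by rewrite ltr_wpDl.
by move=> g; rewrite -normc_real (le_trans (qM g))// (le_trans (ler_norm M))// lerDl.
Qed.

Definition approximable_set (S : set (borel D)) := rapproximable (\1_S).

Lemma approximable_set_meas S : approximable_set S -> measurable S.
Proof.
move=> /rapproximable_meas mS; have := mS measurableT [set 1%R] (measurable_set1 _).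
rewrite setTI; congr measurable; apply/seteqP; split => g /=; rewrite indicE.
  by case: (boolP (g \in S)) => [/set_mem|_ /eqP]; rewrite // eq_sym oner_eq0.
by move=> Sg; rewrite mem_set.
Qed.

(** The limit lemma for a constant sequence: values off [V] may be changed at will. *)
Lemma approximable_setP (S : set (borel D)) q : measurable S -> rapproximable q ->
  (forall g : borel D, V g -> \1_S g = q g) -> approximable_set S.
Proof.
move=> mS hq Sq; have [M M0 qM] := rapproximable_bounded hq.
rewrite /approximable_set; apply: (rapproximable_lim (M := 1 + M) (q_ := fun=> q)) => //.
- by move=> _ g; rewrite (le_trans (qM g))// lerDr.
- by move=> g; rewrite indicE; case: (g \in S); rewrite ?normr0 ?normr1; lra.
- by move=> g /Sq ->; exact: cvg_cst.
Qed.

Lemma approximable_setT : approximable_set setT.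
Proof.
by apply: (approximable_setP _ (rapproximable_cst 1)) => // g _; rewrite indicT.
Qed.

Lemma approximable_setI S S' : approximable_set S -> approximable_set S' ->
  approximable_set (S `&` S').
Proof.
move=> hS hS'; have := rapproximableM hS hS'.
by congr rapproximable; apply/funext => g; rewrite indicI.
Qed.

Lemma approximable_setD S S' : approximable_set S -> approximable_set S' ->
  S' `<=` S -> approximable_set (S `\` S').
Proof.
move=> hS hS' SS.
have := rapproximableD hS (rapproximableM (rapproximable_cst (-1)) hS').
congr rapproximable; apply/funext => g; rewrite !indicE in_setD.
case: (boolP (g \in S')) => [|_]; last by rewrite mulr0 addr0 andbT.
by move=> /set_mem/SS/mem_set ->; rewrite mulr1 subrr.
Qed.

Lemma approximable_setC S : approximable_set S -> approximable_set (~` S).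
Proof.
by move=> hS; rewrite -setTD; exact: (approximable_setD approximable_setT hS (@subsetT _ _)).
Qed.

Lemma approximable_bigcup (F : nat -> set (borel D)) : nondecreasing_seq F ->
  (forall n, approximable_set (F n)) -> approximable_set (\bigcup_n F n).
Proof.
move=> ndF hF; apply: (rapproximable_lim (M := 1) (q_ := fun n => \1_(F n))) => //.
- by apply/measurable_indic/bigcupT_measurable => n; exact: approximable_set_meas.
- by move=> n g; rewrite indicE; case: (g \in F n); rewrite ?normr0 ?normr1.
- by move=> g; rewrite indicE; case: (g \in _); rewrite ?normr0 ?normr1.
- move=> g _; have [[n _ Fng]|nF] := pselect ((\bigcup_n F n) g); last first.
    have nFn m : (g \in F m) = false.
      by rewrite memNset// => Fm; apply: nF; exists m.
    rewrite indicE memNset//; under eq_fun do rewrite indicE nFn.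
    exact: cvg_cst.
  rewrite indicE mem_set; last by exists n.
  apply: cvg_near_cst; exists n => // m nm; rewrite indicE mem_set//.
  by have := ndF _ _ nm; rewrite subsetEset => /(_ g Fng).
Qed.

Lemma approximable_setU S S' : approximable_set S -> approximable_set S' ->
  approximable_set (S `|` S').
Proof.
move=> hS hS'; rewrite -[S `|` S']setCK setCU; apply: approximable_setC.
by apply: approximable_setI; exact: approximable_setC.
Qed.

Lemma approximable_bigcup_countable (J : Type) (C : set J) (F : J -> set (borel D)) :
  countable C -> (forall j, C j -> approximable_set (F j)) ->
  approximable_set (\bigcup_(j in C) F j).
Proof.
move=> /countable_injP[f fI] hF.
pose H n := \bigcup_(j in [set j | C j /\ f j = n]) F j.
have hH n : approximable_set (H n).
  have [[j [Cj fj]]|nj] := pselect (exists j, C j /\ f j = n).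
    rewrite (_ : H n = F j); first exact: hF.
    apply/seteqP; split=> [g [i [Ci fi] Fg]|g Fg]; last by exists j.
    by rewrite -(fI i j) ?inE// fi.
  rewrite (_ : H n = ~` setT); first exact/approximable_setC/approximable_setT.
  by rewrite setCT; apply/seteqP; split=> // g [i Ci _]; case: nj; exists i.
rewrite (_ : \bigcup_(j in C) F j = \bigcup_n \big[setU/set0]_(i < n) H i).
  apply: approximable_bigcup.
    apply/nondecreasing_seqP => n; rewrite subsetEset big_ord_recr /=.
    exact: subsetUl.
  elim=> [|n IH]; last by rewrite big_ord_recr /=; exact: (approximable_setU IH (hH n)).
  by rewrite big_ord0 -setCT; exact/approximable_setC/approximable_setT.
apply/seteqP; split=> [g [j Cj Fg]|g [n _]].
  exists (f j).+1 => //; rewrite -bigcup_mkord; exists (f j) => /=; first exact: ltnSn.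
  by exists j.
by rewrite -bigcup_mkord => -[i _ [j [Cj _] Fg]]; exists j.
Qed.

(* on [0, 1], the powers (1 - q)^n tend to the indicator of q = 0 *)
Lemma approximable_gt0 q : rapproximable q -> approximable_set [set g | 0 < q g].
Proof.
move=> hq; have [M M0 qM] := rapproximable_bounded hq.
have hqM : rapproximable (fun g => M^-1 * q g).
  exact: (rapproximableM (rapproximable_cst _) hq).
have qM1 g : `|M^-1 * q g| <= 1.
  by rewrite normrM gtr0_norm ?invr_gt0// mulrC ler_pdivrMr ?mul1r.
(* The positive part of q/M: it takes values in [0, 1] and is positive exactly where [q] is. *)
pose p g := 2^-1 * (M^-1 * q g + `|M^-1 * q g|).
have hp : rapproximable p.
  apply: rapproximableM; first exact: rapproximable_cst.
  exact: (rapproximableD hqM (rapproximable_abs hqM qM1)).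
have p01 g : 0 <= p g <= 1.
  have := qM1 g; rewrite /p ler_norml; have := ler_norm (M^-1 * q g).
  have := ler_norm (- (M^-1 * q g)); rewrite normrN.
  have := normr_ge0 (M^-1 * q g); rewrite -ler_norml; have := qM1 g.
  by move: (M^-1 * q g) => t; lra.
have pE g : (0 < p g) = (0 < q g).
  have Mq : (0 < M^-1 * q g) = (0 < q g) by rewrite pmulr_rgt0// invr_gt0.
  rewrite -Mq /p; move: (M^-1 * q g) => t; have [t0|t0] := ltP 0 t.
    by rewrite gtr0_norm//; lra.
  by rewrite ler0_norm// addrN mulr0 ltxx.
rewrite -[[set g | _]]setCK; apply: approximable_setC.
have mq := rapproximable_meas hq.
apply: (rapproximable_lim (M := 1) (q_ := fun n g => (1 - p g) ^+ n)).
- move=> n; apply: rapproximableX; apply: rapproximableD; first exact: rapproximable_cst.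
  under eq_fun do rewrite -mulN1r.
  exact: (rapproximableM (rapproximable_cst _) hp).
- apply: measurable_indic; apply: measurableC.
  have := mq measurableT `]0, +oo[%classic (measurable_itv _).
  by rewrite setTI; congr measurable; apply/seteqP; split => g /=; rewrite in_itv/= andbT.
- move=> n g; have := p01 g => /andP[p0 p1].
  by rewrite normrX exprn_ile1// ger0_norm; lra.
- by move=> g; rewrite indicE; case: (g \in _); rewrite ?normr0 ?normr1.
- move=> g _; rewrite indicE; have [/= q0|q0] := boolP (0 < q g).
    rewrite memNset /=; last by [].
    apply: cvg_expr; have := p01 g; have := pE g; rewrite q0 => p0 /andP[_ p1].
    by rewrite ger0_norm; move: p0 p1; lra.
  rewrite mem_set /=; last exact/negP.
  have -> : p g = 0.
    by apply/eqP; rewrite eq_le; case/andP: (p01 g) => -> _; rewrite leNgt pE q0.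
  by under eq_fun do rewrite subr0 expr1n; exact: cvg_cst.
Qed.


Definition cpart (b : bool) (z : R[i]) : R := if b then cRe z else cIm z.

(** Open half-plane conditions on g(l): [b] selects the real or imaginary part, [s] the side, and
    the threshold [r] is rational so that a countable [L] gives countably many sets. *)
Definition halfspace (k : G * bool * bool * rat) : set (borel D) :=
  let: (l, b, s, r) := k in
  [set g : borel D | 0 < (-1) ^+ s * (cpart b ((g : D) l) - ratr r)].

Lemma approximable_halfspace k : L k.1.1.1 -> approximable_set (halfspace k).
Proof.
case: k => -[[l b] s] r /= Ll; apply: approximable_gt0.
apply: rapproximableM; first exact: rapproximable_cst.
apply: rapproximableD; last exact: rapproximable_cst.
by case: b => /=; [exact: rapproximable_char_Re|exact: rapproximable_char_Im].
Qed.

(** A rational strictly between differing coordinates of x(l) and y(l) works: a strict inequality at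
    [y] persists nearby. *)
Lemma halfspace_separates (x y : D) l : x l <> y l ->
  exists k, [/\ k.1.1.1 = l, halfspace k x & nbhs y (~` halfspace k)].
Proof.
move=> xy; have [b bxy] : exists b, cpart b (x l) != cpart b (y l).
  have [rxy|] := eqVneq (cRe (x l)) (cRe (y l)); last by exists true.
  by exists false; apply/eqP => ixy; apply: xy; exact: cplxP.
have part_nbhs (t : R) : 0 < t -> nbhs y [set g : D | `|cpart b (g l) - cpart b (y l)| < t].
  move=> /(dual_eval_nbhs y l).
  apply: (@filterS _ (nbhs y) (nbhs_filter y)) => g /=; apply: le_lt_trans.
  rewrite normc_subC /cpart; have := norm_Re_le (g l - y l); have := norm_Im_le (g l - y l).
  by case: (b); case: (g l) (y l) => ? ? [? ?].
have [yx|xy'|] := ltgtP (cpart b (y l)) (cpart b (x l));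
  last by move/esym/eqP; rewrite (negbTE bxy).
- have [r /andP[yr rx]] : exists r : rat, cpart b (y l) < ratr r < cpart b (x l).
    by have [r] := rat_in_itvoo yx; rewrite in_itv /=; exists r.
  exists (l, b, false, r); split => //=; first by rewrite expr0 mul1r subr_gt0.
  have yr' : 0 < ratr r - cpart b (y l) by rewrite subr_gt0.
  apply: (@filterS _ (nbhs y) (nbhs_filter y) _ _ _ (part_nbhs _ yr')) => g /=.
  rewrite expr0 mul1r => h1 h2.
  by move: (ler_norm (cpart b (g l) - cpart b (y l))); lra.
- have [r /andP[xr ry]] : exists r : rat, cpart b (x l) < ratr r < cpart b (y l).
    by have [r] := rat_in_itvoo xy'; rewrite in_itv /=; exists r.
  exists (l, b, true, r); split => //=; first by rewrite expr1 mulN1r opprB subr_gt0.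
  have ry' : 0 < cpart b (y l) - ratr r by rewrite subr_gt0.
  apply: (@filterS _ (nbhs y) (nbhs_filter y) _ _ _ (part_nbhs _ ry')) => g /=.
  rewrite expr1 mulN1r opprB distrC => h1 h2.
  by move: (ler_norm (cpart b (y l) - cpart b (g l))); lra.
Qed.

(** For g in [U] and y outside the periodic set [U], some l in [L] has g(l) different from y(l), so
    a half-space contains g and misses a neighbourhood of y. By compactness of closure V minus [U],
    finitely many half-spaces around g suffice. On [V], then, [U] is a countable union of finite
    intersections of half-spaces. *)
Lemma approximable_periodic_open (U : set D) : open U ->
  (forall w g, A w -> U g -> U (w + g)) -> approximable_set (U : set (borel D)).
Proof.
move=> oU pU; have cV := fd_compact fdV.
pose K := [set k : G * bool * bool * rat | L k.1.1.1].
have cK : countable K.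
  have [f fI] := elimT (countable_injP _) L_countable.
  apply/countable_injP; exists (fun k => pickle (f k.1.1.1, k.1.1.2, k.1.2, k.2)).
  move=> [[[l b] s] r] [[[l' b'] s'] r']; rewrite !inE /K /= => Ll Ll'.
  move=> /(pcan_inj pickleK)[fl -> -> ->].
  by rewrite (fI l l') ?inE.
pose B (X : set (G * bool * bool * rat)) := \bigcap_(k in X) halfspace k.
have hB X : X `<=` K -> finite_set X -> approximable_set (B X).
  move=> XK /finite_seqP[s Xs]; rewrite {}Xs in XK *.
  elim: s XK => [|k s IH] sK.
    rewrite /B (_ : \bigcap_(_ in _) _ = setT); first exact: approximable_setT.
    by apply/seteqP; split => // g _ k.
  have -> : B [set` k :: s] = halfspace k `&` B [set` s].
    apply/seteqP; split=> [g Bg|g [hk Bs] j /=].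
      split; first by apply: Bg; rewrite /= inE eqxx.
      by move=> j js; apply: Bg; rewrite /= inE js orbT.
    by rewrite inE => /predU1P[->//|]; exact: Bs.
  apply: approximable_setI.
    by apply: approximable_halfspace; apply: (sK k); rewrite /= inE eqxx.
  by apply: IH => j js; apply: sK; rewrite /= inE js orbT.
(* The finite families of half-spaces whose intersection stays inside [U] on the closure of [V];
   only countably many exist. *)
pose C := [set X | (X `<=` K /\ finite_set X) /\
  forall g, B X g -> closure V g -> U g].
have cC : countable C.
  by apply: sub_countable (countable_finite_subset cK); apply: subset_card_le => X [].
have hW : approximable_set (\bigcup_(X in C) B X).
  by apply: approximable_bigcup_countable => // X [[XK fX] _]; exact: hB.
apply: (approximable_setP _ hW).
  exact: open_borel.
move=> g Vg; rewrite !indicE; congr (_%:R); congr nat_of_bool.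
apply/idP/idP => /set_mem h; apply/mem_set; last first.
  by case: h => X [_ XU] BX; apply: XU => //; exact: subset_closure.
have [k kP] : exists k : D -> G * bool * bool * rat, forall y, ~ U y ->
    [/\ K (k y), halfspace (k y) g & nbhs y (~` halfspace (k y))].
  have : forall y, exists k : G * bool * bool * rat, ~ U y ->
      [/\ K k, halfspace k g & nbhs y (~` halfspace k)].
    move=> y; have [Uy|nUy] := pselect (U y).
      by exists (0, true, true, 0).
    (* Otherwise y - g would annihilate [L], and periodicity of [U] would put y in [U]. *)
    have [l Ll gyl] : exists2 l, L l & g l <> y l.
      apply: contrapT => /forall2NP gy; apply: nUy.
      have -> : y = (y - g) + g by rewrite subrK.
      apply: pU => // l Ll; rewrite dual_subE.
      have [//|/contrapT ->] := gy l.
      by rewrite divff// -normr_eq0 character_norm oner_eq0.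
    by have [k [kl kg ky]] := halfspace_separates gyl; exists k => _; split=> //; rewrite /K /= kl.
  by move=> /choice[k kP]; exists k.
have cE : compact (closure V `&` ~` U) by apply: compact_closedI => //; exact: open_closedC.
have nE y : (closure V `&` ~` U) y -> nbhs y (~` halfspace (k y)).
  by move=> [_ nUy]; have [] := kP y nUy.
have [s sE sC] := compact_nbhs_cover cE nE.
exists [set` map k s]; last first.
  move=> _ /mapP[y ys ->]; have [_ nUy] := sE y ys.
  by have [] := kP y nUy.
split; first split; last 1 first.
- move=> x Bx Vx; apply: contrapT => nUx.
  have [y ys nyx] := sC x (conj Vx nUx); apply: nyx; apply: Bx.
  by apply/mapP; exists y.
- move=> _ /mapP[y ys ->]; have [_ nUy] := sE y ys.
  by have [] := kP y nUy.
- exact: finite_seq.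
Qed.


(** The constant is crude and depends on [s]; it serves as continuity of periodization in L^2. *)
Lemma nrm2_periodize s : exists2 C, 0 < C & forall h : borel D -> R[i], L2 nu h ->
  nrm2 nu (periodize s h) <= C * nrm2 nu h.
Proof.
elim: s => [|w s [C C0 IH]].
  exists 1 => // h L2h; rewrite mul1r nrm2E; last exact: L2_periodize.
  rewrite /inner /periodize; under eq_fun do rewrite big_nil mul0r.
  by rewrite cintegral0 nrm2_ge0.
exists (2 + 2 * C); first by rewrite addr_gt0// mulr_gt0.
move=> h L2h; rewrite /periodize; under eq_fun do rewrite big_cons.
apply: (le_trans (nrm2D_le (L2_translate nu_haar w L2h) (L2_periodize nu_haar s L2h))).
by rewrite nrm2_translate//; have := IH _ L2h; rewrite /periodize; nra.
Qed.

(** * Periodizations of functions supported in a relatively compact open set *)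

Section Window.
Variables (O S' : set D) (Om : seq D).
Hypothesis oO : open O.
Hypothesis cS' : compact S'.
Hypothesis OS' : O `<=` S'.
Hypothesis window_Om : window A S' V Om.

(** The periodized indicator of [B], as a real function. For [B] inside [S'] and g in [V] it counts
    all w in [A] with w + g in [B]. *)
Definition hits (B : set (borel D)) (g : borel D) : R :=
  \sum_(w <- Om) \1_B (w + g : D).

Lemma rapproximable_eq (q r : borel D -> R) (M : R) : rapproximable q ->
  measurable_fun setT r -> (forall g, `|r g| <= M) ->
  (forall g, V g -> r g = q g) -> rapproximable r.
Proof.
move=> [_ _ sq] mr rM rq; split; first exact: cmeasurable_real.
  by exists M => g; rewrite normc_real.
move: sq; congr closed_span; apply/funext => g.
have [Vg|nV] := pselect (V g); first by rewrite rq.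
by rewrite cind_out// !mulr0.
Qed.

Lemma measurable_hits B : measurable B -> measurable_fun setT (hits B).
Proof.
move=> mB; apply: measurable_sum => w.
have mi : measurable_fun setT (\1_B : borel D -> R) by exact: measurable_indic.
exact: (measurableT_comp mi (borel_translate w)).
Qed.

Lemma hits_bounded B g : `|hits B g| <= (size Om)%:R.
Proof.
rewrite ger0_norm ?sumr_ge0// /hits -sum1_size natr_sum; apply: ler_sum => w _.
by rewrite indicE; case: (_ \in _).
Qed.

(* on V, a point is hit more than j times iff it lies in a fixed open periodic set *)
Lemma rapproximable_hits_open (B : set D) : open B -> B `<=` S' -> rapproximable (hits B).
Proof.
move=> oB BS'; have [uO OA OV] := window_Om.
(* The points with more than [j] lattice translates in [B]. The witnesses range over all of [A]
   instead of [Om], which makes the set exactly periodic. *)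
pose U j : set D := [set g | exists t : seq D,
  [/\ uniq t, (j < size t)%N, {in t, forall w, A w} & {in t, forall w, B (w + g)}]].
have oU j : open (U j).
  rewrite openE => g [t [ut jt tA tB]]; rewrite /interior.
  have : nbhs g [set h : D | {in t, forall w, B (w + h)}].
    elim: t tB {ut jt tA} => [|w t IH] tB; first exact: filterE.
    have hw : nbhs g [set h : D | B (w + h)].
      apply: translate_continuous; apply: open_nbhs_nbhs; split=> //.
      by apply: tB; rewrite inE eqxx.
    have ht : nbhs g [set h : D | {in t, forall w, B (w + h)}].
      by apply: IH => v vt; apply: tB; rewrite inE vt orbT.
    apply: (@filterS2 _ (nbhs g) (nbhs_filter g) _ _ _ _ hw ht) => h hw' ht' v.
    by rewrite inE => /predU1P[->//|/ht'].
  by apply: (@filterS _ (nbhs g) (nbhs_filter g)) => h tBh; exists t.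
have pU j w g : A w -> U j g -> U j (w + g).
  move=> Aw [t [ut jt tA tB]]; exists [seq v - w | v <- t]; split.
  - by rewrite map_inj_uniq//; exact: addIr.
  - by rewrite size_map.
  - by move=> _ /mapP[v vt ->]; apply: (annihilator_subgroup L).2 => //; exact: tA.
  - by move=> _ /mapP[v vt ->]; rewrite addrA subrK; exact: tB.
have hU j := approximable_periodic_open (oU j) (pU j).
have hsum : rapproximable (fun g => \sum_(j < size Om) \1_(U j : set (borel D)) g).
  elim: (size Om) => [|n IH].
    by under eq_fun do rewrite big_ord0; exact: rapproximable_cst.
  under eq_fun do rewrite big_ord_recr /=.
  exact: (rapproximableD IH (hU n)).
apply: (rapproximable_eq hsum (measurable_hits (open_borel oB)) (hits_bounded B)).
move=> g Vg; pose n := count (fun w : D => (w + g : borel D) \in (B : set (borel D))) Om.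
have -> : hits B g = n%:R.
  by rewrite /hits /n -sum1_count natr_sum [RHS]big_mkcond /=; apply: eq_bigr => w _;
    rewrite indicE; case: (_ \in _).
have Uj j : \1_(U j : set (borel D)) g = ((j < n)%N)%:R :> R.
  rewrite indicE; congr (_%:R); congr nat_of_bool; apply/idP/idP => [/set_mem|jn].
    move=> [t [ut jt tA tB]]; apply: (leq_trans jt); rewrite /n -size_filter.
    apply: uniq_leq_size => // w wt; rewrite mem_filter; apply/andP; split.
      by apply/mem_set; exact: tB.
    by apply: (OV w g) => //; [exact: tA|apply: BS'; exact: tB].
  apply/mem_set; exists [seq w <- Om | (w + g : borel D) \in (B : set (borel D))]; split.
  - exact: filter_uniq.
  - by rewrite size_filter.
  - by move=> w; rewrite mem_filter => /andP[_ /OA].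
  - by move=> w; rewrite mem_filter => /andP[/set_mem].
under eq_bigr do rewrite Uj.
have nO : (n <= size Om)%N by exact: count_size.
rewrite -natr_sum; congr (_%:R).
by rewrite sum_ltn_ord (minn_idPl nO).
Qed.

(** Dynkin's argument: open sets form a pi-system generating the Borel sets, and the good sets form
    a lambda-system. Cutting with [O] brings every set, the whole space included, inside [S']. *)
Lemma rapproximable_hits (B : set (borel D)) : measurable B ->
  rapproximable (hits (B `&` O)).
Proof.
move=> mB; have mO : measurable (O : set (borel D)) by exact: open_borel.
pose H : set (set (borel D)) :=
  [set X : set (borel D) | measurable X /\ rapproximable (hits (X `&` O))].
suff : (measurable : set (set (borel D))) `<=` H by move=> /(_ _ mB)[].
apply: (@lambda_system_subset _ (open : set (set (borel D)))); last by [].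
- by move=> X Y; exact: openI.
- split; first by move=> X _; exact: subsetT.
  + split; first exact: measurableT.
    by rewrite setTI; exact: rapproximable_hits_open.
  + move=> X Y YX [mX hX] [mY hY]; split; first exact: measurableD.
    have -> : hits ((X `\` Y) `&` O) = (fun g => hits (X `&` O) g + (-1) * hits (Y `&` O) g).
      apply/funext => g; rewrite /hits mulr_sumr -big_split /=; apply: eq_bigr => w _.
      rewrite !indicE !in_setI.
      rewrite -[fun x : D => ~ Y x]/(~` Y) in_setC.
      case: (boolP ((w + g : D) \in Y)) => [/set_mem/YX/mem_set ->|_] /=.
        by rewrite mulN1r subrr.
      by rewrite mulr0 addr0 andbT.
    exact: (rapproximableD hX (rapproximableM (rapproximable_cst _) hY)).
  + move=> F ndF HF; have mF : measurable (\bigcup_n F n).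
      by apply: bigcupT_measurable => n; case: (HF n).
    split; first exact: mF.
    apply: (rapproximable_lim
      (M := (size Om)%:R) (q_ := fun n => hits (F n `&` O))).
    * by move=> n; case: (HF n).
    * by apply: measurable_hits; exact: measurableI.
    * by move=> n g; exact: hits_bounded.
    * by move=> g; exact: hits_bounded.
    * move=> g _; rewrite /hits.
      elim: (Om) => [|w t IH].
        by rewrite big_nil; under eq_fun do rewrite big_nil; exact: cvg_cst.
      rewrite big_cons; under eq_fun do rewrite big_cons.
      apply: cvgD IH.
      have [[n _ Fn]|nF] := pselect ((\bigcup_n F n) (w + g : D)); last first.
        have nFn n : ((w + g : D) \in F n `&` O) = false.
          by rewrite memNset// => -[Fn _]; apply: nF; exists n.
        under eq_fun do rewrite indicE nFn.
        rewrite indicE (_ : (_ \in _) = false); first exact: cvg_cst.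
        by rewrite memNset// => -[].
      apply: cvg_near_cst; exists n => // m nm; rewrite !indicE !in_setI.
      have Fm : F m (w + g : D) by have := ndF _ _ nm; rewrite subsetEset => /(_ _ Fn).
      have Fu : (\bigcup_n F n) (w + g : D) by exists n.
      by rewrite (mem_set Fm) (mem_set Fu).
- move=> X oX; split; first exact: open_borel.
  apply: rapproximable_hits_open; first exact: openI.
  by move=> g [_ /OS'].
Qed.


Definition spanned_periodization (h : borel D -> R[i]) :=
  L2 nu h /\ spanned (fun g => periodize Om h g * indV g).

Lemma spanned_periodizationD h k : spanned_periodization h -> spanned_periodization k ->
  spanned_periodization (fun g => h g + k g).
Proof.
move=> [L2h sh] [L2k sk]; split; first exact: L2D.
have -> : (fun g => periodize Om (fun g => h g + k g) g * indV g) =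
  (fun g => periodize Om h g * indV g + periodize Om k g * indV g).
  by apply/funext => g; rewrite -mulrDl /periodize -big_split.
exact: (closed_spanD c0 L2e e_orth).
Qed.

Lemma spanned_periodizationZ a h : spanned_periodization h ->
  spanned_periodization (fun g => a * h g).
Proof.
move=> [L2h sh]; split; first exact: L2Z.
have -> : (fun g => periodize Om (fun g => a * h g) g * indV g) =
  (fun g => a * (periodize Om h g * indV g)).
  by apply/funext => g; rewrite /periodize -mulr_sumr mulrA.
exact: (closed_spanZ c0 L2e e_orth).
Qed.

Lemma spanned_periodization0 : spanned_periodization (fun=> 0).
Proof.
split; first exact: L2_0.
rewrite (_ : (fun _ => _) = fun=> 0); first exact: closed_span0.
by apply/funext => g; rewrite /periodize big1 ?mul0r.
Qed.

(** The class is closed in L^2 because periodization over [Om] is bounded there. *)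
Lemma spanned_periodization_lim h : L2 nu h ->
  (forall eps : R, 0 < eps -> exists2 k, spanned_periodization k &
     nrm2 nu (fun g => h g - k g) <= eps) ->
  spanned_periodization h.
Proof.
move=> L2h hk; split; first exact: L2h.
apply: (closed_span_lim c0 L2e e_orth).
  by apply: L2_indM => //; exact: L2_periodize.
move=> eps eps0; have [C C0 hC] := nrm2_periodize Om.
have [k [L2k sk] hkC] := hk _ (divr_gt0 eps0 C0).
exists (fun g => periodize Om k g * indV g) => //.
have L2d := L2B L2h L2k.
have -> : (fun g => periodize Om h g * indV g - periodize Om k g * indV g) =
  (fun g => periodize Om (fun g => h g - k g) g * indV g).
  by apply/funext => g; rewrite -mulrBl /periodize sumrB.
apply: (le_trans (nrm2_indM mV (L2_periodize nu_haar Om L2d))).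
by apply: (le_trans (hC _ L2d)); rewrite mulrC -ler_pdivlMr.
Qed.

Let mO : measurable (O : set (borel D)) := open_borel oO.

Lemma spanned_periodization_ind (B : set (borel D)) : measurable B ->
  spanned_periodization (cind (B `&` O)).
Proof.
move=> mB; split.
  apply: L2_cind; first exact: measurableI.
  have [_ cfin _] := nu_haar; apply: le_lt_trans (cfin _ cS').
  apply: le_measure; rewrite ?inE; [exact: measurableI|exact: compact_borel|].
  by move=> g [_ /OS'].
have [_ _] := rapproximable_hits mB.
congr closed_span; apply/funext => g; congr (_ * _).
by rewrite /hits /periodize rmorph_sum.
Qed.

Lemma spanned_periodization_nneg (f : borel D -> R) : (forall g, 0 <= f g) ->
  (forall g, ~ O g -> f g = 0) -> L2 nu (fun g => (f g)%:C%C) ->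
  spanned_periodization (fun g => (f g)%:C%C).
Proof.
move=> f0 fO L2f; have mf : measurable_fun setT f by case: L2f => -[].
have mfE : measurable_fun setT (EFin \o f) by exact/measurable_EFinP.
pose f_ n : borel D -> R := nnsfun_approx measurableT mfE n.
have f_0 n g : 0 <= f_ n g by exact: fun_ge0.
have f_le n g : f_ n g <= f g.
  have fE0 x : setT x -> (0 <= (EFin \o f) x)%E by move=> _; rewrite /= lee_fin.
  by rewrite -lee_fin /f_ nnsfun_approxE; exact: (le_approx n fE0).
have mf_ n : measurable_fun setT (f_ n) by [].
have sqcR (a : R) : sqc a%:C%C = a ^+ 2 by rewrite sqcE /= expr0n/= addr0.
have L2f_ n : L2 nu (fun g => (f_ n g)%:C%C).
  apply: (L2_le _ (L2_integrable L2f)); first exact: cmeasurable_real.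
  by move=> g /=; rewrite !sqcR lerXn2r ?nnegrE.
apply: spanned_periodization_lim => // eps eps0.
have : nrm2 nu (fun g => (f g)%:C%C - (f_ n g)%:C%C) @[n --> \oo] --> (0 : R).
  apply: (nrm2_cvg _ (L2_integrable L2f)).
  - by move=> n; case: (L2B L2f (L2f_ n)).
  - move=> n g; rewrite -rmorphB /= !sqcR lerXn2r ?nnegrE ?subr_ge0//.
    by rewrite gerBl.
  - move=> g; under eq_fun do rewrite -rmorphB sqcR expr2.
    have cf : f_ n g @[n --> \oo] --> f g.
      rewrite /f_; under eq_fun do rewrite nnsfun_approxE.
      have fE0 x : setT x -> (0 <= (EFin \o f) x)%E by move=> _; rewrite /= lee_fin.
      exact: (cvg_approx fE0 (x := g) I (ltry _)).
    have cf0 : (f g - f_ n g) @[n --> \oo] --> (0 : R).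
      by rewrite -[X in _ --> X](subrr (f g)); apply: cvgB => //; exact: cvg_cst.
    suff : (f g - f_ n g) * (f g - f_ n g) @[n --> \oo] --> (0 * 0 : R) by rewrite mulr0.
    exact: cvgM.
move=> /cvgrPdist_lt/(_ _ eps0)[n _ /(_ n (leqnn n))].
rewrite /= sub0r normrN ger0_norm ?nrm2_ge0// => hn.
exists (fun g => (f_ n g)%:C%C); last exact: ltW.
have /finite_seqP[s0 rE] : finite_set (range (f_ n)) by exact: fimfunP.
pose s := undup s0.
have {}rE : range (f_ n) = [set` s].
  by rewrite rE; apply/seteqP; split => y /=; rewrite mem_undup.
(* The simple function is split into its level sets. Cutting them with [O] is harmless, since 0 <=
   f_n <= f forces f_n to vanish off [O]. *)
have -> : (fun g => (f_ n g)%:C%C) =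
  (fun g => \sum_(y <- s) y%:C%C * cind (f_ n @^-1` [set y] `&` O) g).
  apply/funext => g; have [Og|nO] := pselect (O g); last first.
    rewrite big1; last by move=> y _; rewrite cind_out ?mulr0// => -[].
    by have := f_le n g; rewrite fO// => h; congr (_%:C%C); apply/eqP; rewrite eq_le h f_0.
  rewrite {1}/f_ fimfunE -/(f_ n) rE -fsbig_seq ?undup_uniq// rmorph_sum; apply: eq_bigr => y _.
  rewrite rmorphM; congr (_ * _); congr (_%:C%C).
  by rewrite indicI /= [X in _ = _ * X]indicE (mem_set Og) mulr1.
elim: (s) => [|y t IH].
  by under eq_fun do rewrite big_nil; exact: spanned_periodization0.
under eq_fun do rewrite big_cons; apply: spanned_periodizationD; last exact: IH.
apply: spanned_periodizationZ; apply: spanned_periodization_ind.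
by rewrite -[X in measurable X]setTI; apply: mf_ => //; exact: measurable_set1.
Qed.

Lemma spanned_periodization_real (f : borel D -> R) :
  (forall g, ~ O g -> f g = 0) -> L2 nu (fun g => (f g)%:C%C) ->
  spanned_periodization (fun g => (f g)%:C%C).
Proof.
move=> fO L2f; have mf : measurable_fun setT f by case: L2f => -[].
have sqcR (a : R) : sqc a%:C%C = a ^+ 2 by rewrite sqcE /= expr0n/= addr0.
have part (u : borel D -> R) : measurable_fun setT u -> (forall g, 0 <= u g <= `|f g|) ->
    spanned_periodization (fun g => (u g)%:C%C).
  move=> mu hu; apply: spanned_periodization_nneg.
  - by move=> g; case/andP: (hu g).
  - move=> g /fO fg; apply/eqP; have := hu g.
    by rewrite fg normr0 eq_le andbC.
  - apply: (L2_le _ (L2_integrable L2f)); first exact: cmeasurable_real.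
    move=> g /=; rewrite !sqcR -[f g ^+ 2]real_normK ?num_real//.
    by have /andP[? ?] := hu g; rewrite lerXn2r ?nnegrE.
have hp : spanned_periodization (fun g => (2^-1 * (`|f g| + f g))%:C%C).
  apply: part.
    by apply: measurable_funM => //; apply: measurable_funD => //; exact: measurableT_comp.
  move=> g; have := ler_norm (f g); have := ler_norm (- f g); rewrite normrN.
  by move: (`|f g|) (f g) => a b; lra.
have hn : spanned_periodization (fun g => (2^-1 * (`|f g| - f g))%:C%C).
  apply: part.
    by apply: measurable_funM => //; apply: measurable_funB => //; exact: measurableT_comp.
  move=> g; have := ler_norm (f g); have := ler_norm (- f g); rewrite normrN.
  by move: (`|f g|) (f g) => a b; lra.
have := spanned_periodizationD hp (spanned_periodizationZ (-1) hn).
congr spanned_periodization; apply/funext => g.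
by rewrite mulN1r -rmorphB; congr (_%:C%C); field.
Qed.

Lemma spanned_periodization_all (h : borel D -> R[i]) : L2 nu h ->
  (forall g, ~ O g -> h g = 0) -> spanned_periodization h.
Proof.
move=> L2h hO; have [[rh ih] _] := L2h.
have sqcR (a : R) : sqc a%:C%C = a ^+ 2 by rewrite sqcE /= expr0n/= addr0.
have hr : spanned_periodization (fun g => (cRe (h g))%:C%C).
  apply: spanned_periodization_real; first by move=> g /hO ->.
  apply: (L2_le _ (L2_integrable L2h)); first exact: cmeasurable_real.
  by move=> g /=; rewrite sqcR sqcE lerDl sqr_ge0.
have hi : spanned_periodization (fun g => (cIm (h g))%:C%C).
  apply: spanned_periodization_real; first by move=> g /hO ->.
  apply: (L2_le _ (L2_integrable L2h)); first exact: cmeasurable_real.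
  by move=> g /=; rewrite sqcR sqcE lerDr sqr_ge0.
have := spanned_periodizationD hr (spanned_periodizationZ (Complex 0 1) hi).
congr spanned_periodization; apply/funext => g; case: (h g) => a b.
by apply: cplxP => /=; ring.
Qed.


End Window.

Lemma cintegrable_char (S : set D) (h : borel D -> R[i]) l : compact S -> L2 nu h ->
  (forall g, ~ S g -> h g = 0) -> cintegrable nu (fun g : borel D => h g * (g : D) l).
Proof.
move=> cS L2h hS; have mS : measurable (S : set (borel D)) by exact: compact_borel.
have Soo : (nu S < +oo)%E by have [_ cfin _] := nu_haar; exact: cfin.
have -> : (fun g : borel D => h g * (g : D) l) =
    (fun g : borel D => h g * ((g : D) (- l) * cind (S : set (borel D)) g)^*).
  apply/funext => g; rewrite rmorphM/= cindC -dualN opprK.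
  have [Sg|/hS ->] := pselect (S g); last by rewrite !mul0r.
  by rewrite cind_in// mulr1.
apply: cintegrable_inner => //; apply: (@L2M _ _ _ _ 1).
- exact: eval_cmeasurable.
- by move=> g; rewrite dual_normc.
- exact: L2_cind.
Qed.

Lemma open_compact_nbhs (S N : set D) : compact S -> compact N -> nbhs 0 N ->
  exists O S' : set D, [/\ open O, compact S', O `<=` S' & S `<=` O].
Proof.
move=> cS cN N0.
exists (\bigcup_(x in S) [set g | N° (g - x)]).
(* This is S + N, written as S - (0 - N) so that [compact_sub] gives its compactness. *)
exists [set x - y | x in S & y in [set a - b | a in [set 0] & b in N]]; split.
- apply: bigcup_open => x _; apply: open_comp; last exact: open_interior.
  move=> g _; have -> : (fun g : D => g - x) = (+%R (- x)) by apply/funext => h; rewrite addrC.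
  exact: translate_continuous.
- by apply: compact_sub => //; apply: compact_sub => //; exact: compact_set1.
- move=> g [x Sx /interior_subset Ngx]; exists x => //.
  exists (0 - (g - x)); first by exists 0 => //; exists (g - x).
  by rewrite sub0r opprK addrC subrK.
- by move=> x Sx; exists x => //=; rewrite subrr.
Qed.

(** Let [u] be the periodization of [h] cut to [V]. Unfolding identifies the coefficients of [u]
    with the integrals of [h] against g(l), and the squared norm of [u] with the inner product of
    [h] and its periodization; [parseval] for [u] does the rest. The window [Om'] is taken for
    points of [V], whereas [Om] only sees points of [S]. *)
Lemma parseval_periodize (S : set D) (Om : seq D) (h : borel D -> R[i]) :
  (exists2 N : set D, compact N & nbhs 0 N) ->
  compact S -> window A S S Om -> L2 nu h -> (forall g, ~ S g -> h g = 0) ->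
  \esum_(l in L) (sqc (cintegral nu (fun g : borel D => h g * (g : D) l)))%:E =
  (c * cRe (inner nu h (periodize Om h)))%:E.
Proof.
move=> [N cN N0] cS wS L2h hS.
have [ O [S' [oO cS' OS' SO]]] := open_compact_nbhs cS cN N0.
have [Om' wO'] := window_exists sA A_discrete cS' (fd_compact fdV).
have wV : window A S' V Om' by apply: window_sub wO' => //; exact: subset_closure.
have wSV : window A S V Om' by apply: window_sub wV => // g /SO/OS'.
have hO g : ~ O g -> h g = 0 by move=> nO; apply: hS => /SO.
have [_ sp] := spanned_periodization_all oO cS' OS' wV L2h hO.
set u := fun g => _ in sp; have L2u : L2 nu u by case: sp.
have [uO OA OV] := wV; have [uS SA SS] := wS.
have innerE l : L l -> inner nu u (e l) = cintegral nu (fun g : borel D => h g * (g : D) l).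
  move=> Ll; have hi := cintegrable_char l cS L2h hS.
  rewrite (unfold nu_haar A_countable fdV wSV hi); last by move=> g /hS ->; rewrite mul0r.
  rewrite -cintegral_sum; last first.
    move=> w; apply: cintegrable_cind => //.
    exact: (cintegrable_translate nu_haar w hi).
  congr cintegral; apply/funext => g; rewrite /u /char_on rmorphM/= cindC -dualN opprK.
  rewrite mulrACA cind_idem -mulr_suml; congr (_ * _).
  rewrite /periodize mulr_suml big_seq [RHS]big_seq; apply: eq_bigr => w /OA Aw.
  by rewrite Aw// mul1r.
have L2H := L2_periodize nu_haar Om L2h.
have -> : inner nu h (periodize Om h) = inner nu u u.
  have hi := cintegrable_inner L2h L2H.
  rewrite /inner (unfold nu_haar A_countable fdV wSV hi); last by move=> g /hS ->; rewrite mul0r.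
  rewrite -cintegral_sum; last first.
    move=> w; apply: cintegrable_cind => //.
    exact: (cintegrable_translate nu_haar w hi).
  congr cintegral; apply/funext => g; rewrite /u rmorphM/= cindC mulrACA cind_idem -mulr_suml.
  have [Vg|nV] := pselect (V g); last by rewrite cind_out// !mulr0.
  congr (_ * _); rewrite {2}/periodize mulr_suml big_seq [RHS]big_seq.
  apply: eq_bigr => w /OA Aw.
  have [->|hw] := eqVneq (h (w + g : D)) 0; first by rewrite !mul0r.
  have Swg : S (w + g) by apply: contrapT => /hS/eqP; rewrite (negbTE hw).
  congr (_ * _^*); rewrite /periodize.
  (* Both lists index the same lattice sum: [Om], a window at the point w + g of [S], shifted by w,
     has the same nonzero terms as [Om'], a window at the point g of [V]. *)
  transitivity (\sum_(v <- [seq x + w | x <- Om]) h (v + g : D)).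
    by rewrite big_map; apply: eq_bigr => x _; rewrite addrA.
  apply: eq_big_supp => //; first by rewrite map_inj_uniq//; exact: addIr.
  move=> v hv; have Svg : S (v + g) by apply: contrapT => /hS/eqP; rewrite (negbTE hv).
  apply/idP/idP => [/mapP[x /SA Ax vE]|/OA Av].
    apply: (OV v g) => //; last exact/OS'/SO.
    by rewrite vE -[w]opprK; apply: sA.2 => //; rewrite -sub0r; apply: sA.2 => //; exact: sA.1.
  apply/mapP; exists (v - w); last by rewrite subrK.
  by apply: (SS _ (w + g)) => //; [exact: sA.2|rewrite addrA subrK].
rewrite -(nrm2E L2u) -(parseval c0 L2e e_orth sp).
by apply: eq_esum => l Ll; rewrite innerE.
Qed.

End PeriodicParseval.

(** * The Plancherel transform *)

Lemma nrm2_exhaustion {R : realType} {d : measure_display} {T : measurableType d}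
  (mu : {measure set T -> \bar R}) (E : nat -> set T) (f : T -> R[i]) :
  (forall n, measurable (E n)) -> nondecreasing_seq E -> \bigcup_n E n = setT ->
  L2 mu f -> forall eps : R, 0 < eps ->
  exists n, nrm2 mu (fun x => f x - f x * cind (E n) x) <= eps.
Proof.
move=> mE ndE ET L2f eps eps0.
have : nrm2 mu (fun x => f x - f x * cind (E n) x) @[n --> \oo] --> (0 : R).
  apply: (nrm2_cvg _ (L2_integrable L2f)).
  - move=> n; have [mf _] := L2f; apply: cmeasurableD => //.
    under eq_fun do rewrite -mulN1r.
    apply: cmeasurableM; first exact: cmeasurable_cst.
    by apply: cmeasurableM => //; exact: cmeasurable_cind.
  - move=> n x; rewrite cindE; case: asboolP => _.
      by rewrite mulr1 subrr Normc.normc0 expr0n sqc_ge0.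
    by rewrite mulr0 subr0.
  - move=> x; have : (\bigcup_n E n) x by rewrite ET.
    move=> [n _ Enx]; apply: cvg_near_cst; exists n => // m nm.
    rewrite cind_in ?mulr1 ?subrr ?Normc.normc0 ?expr0n//.
    by have := ndE _ _ nm; rewrite subsetEset => /(_ _ Enx).
move=> /cvgrPdist_lt/(_ _ eps0)[n _ /(_ n (leqnn n))].
by rewrite /= sub0r normrN ger0_norm ?nrm2_ge0// => /ltW; exists n.
Qed.

Lemma compact_exhaustion (T : topologicalType) : sigma_compact T ->
  exists K : nat -> set T, [/\ forall n, compact (K n), nondecreasing_seq K
    & \bigcup_n K n = setT].
Proof.
move=> [K [cK KT]]; exists (fun n => \big[setU/set0]_(i < n.+1) K i); split.
- by move=> n; apply: bigsetU_compact.
- apply/nondecreasing_seqP => n; rewrite subsetEset => x.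
  by rewrite [X in _ -> X x]big_ord_recr; left.
- apply/seteqP; split => // x _; have : (\bigcup_n K n) x by rewrite KT.
  by move=> [n _ Knx]; exists n => //; rewrite -bigcup_mkord; exists n => /=.
Qed.

Section Plancherel.
Context {R : realType} {G : topologicalZmodType}.
Local Notation D := (dual_group R G).
Variables (mu : {measure set (borel G) -> \bar R})
          (nu : {measure set (borel D) -> \bar R}).
Hypotheses (mu_haar : haar_measure mu) (nu_haar : haar_measure nu).
Hypothesis hG : hausdorff_space G.
Hypothesis scG : sigma_compact G.
Variable F : (borel G -> R[i]) -> (borel D -> R[i]).
Hypothesis F_plancherel : plancherel_transform mu nu F.
Implicit Types (f g : borel G -> R[i]) (phi : borel D -> R[i]).

Lemma plancherel_L2 f : L2 mu f -> L2 nu (F f).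
Proof. by case: F_plancherel => h _ _ _ /h[]. Qed.

Lemma plancherel_nrm2 f : L2 mu f -> nrm2 nu (F f) = nrm2 mu f.
Proof.
move=> L2f; have [h _ _ _] := F_plancherel; have [L2Ff] := h _ L2f.
by rewrite !sqnormE// => -[].
Qed.

Lemma plancherel_comb a f g : L2 mu f -> L2 mu g ->
  nrm2 nu (fun x => a * F f x + F g x) = nrm2 mu (fun x => a * f x + g x).
Proof.
move=> L2f L2g; have L2h := L2D (L2Z a L2f) L2g.
rewrite -(plancherel_nrm2 L2h); apply: nrm2_ae.
- by apply: L2D; [apply: L2Z|]; exact: plancherel_L2.
- exact: plancherel_L2.
- by have [_ h _ _] := F_plancherel; apply: aeS (h a f g L2f L2g) => x ->.
Qed.

(** Polarization: comparing the norms of a f + g before and after [F] gives the real part for a = 1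
    and the imaginary part for a = i. *)
Lemma plancherel_inner f g : L2 mu f -> L2 mu g ->
  inner nu (F f) (F g) = inner mu f g.
Proof.
move=> L2f L2g; have L2Ff := plancherel_L2 L2f; have L2Fg := plancherel_L2 L2g.
have key a : cRe (a * inner nu (F f) (F g)) = cRe (a * inner mu f g).
  have := plancherel_comb a L2f L2g.
  rewrite (nrm2D (L2Z a L2Ff) L2Fg) (nrm2D (L2Z a L2f) L2g) !nrm2Z// !innerZl//.
  by rewrite !plancherel_nrm2//; lra.
apply: cplxP; first by have := key 1; rewrite !mul1r.
have := key (Complex 0 1); rewrite !cReM /= !mul0r !sub0r !mul1r.
by move=> /oppr_inj.
Qed.

Lemma plancherel_dist f g : L2 mu f -> L2 mu g ->
  nrm2 nu (fun x => F f x - F g x) = nrm2 mu (fun x => f x - g x).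
Proof.
move=> L2f L2g; rewrite (nrm2B (plancherel_L2 L2f) (plancherel_L2 L2g)) (nrm2B L2f L2g).
by rewrite !plancherel_nrm2// plancherel_inner.
Qed.

Lemma translateE y f : translate y f = fun x : G => f (- y + x).
Proof. by apply/funext => x; rewrite /translate addrC. Qed.

Lemma L2_translation y f : L2 mu f -> L2 mu (translate y f).
Proof. by move=> L2f; rewrite translateE; exact: L2_translate. Qed.

Lemma character_cmeasurable (gamma : D) : cmeasurable (fun x : borel G => gamma (x : G)).
Proof. by apply: continuous_cmeasurable => x e; exact: character_nbhs. Qed.

Lemma fourier_translate y f (gamma : D) : cintegrable mu f ->
  fourier mu (translate y f) gamma = gamma (- y) * fourier mu f gamma.
Proof.
move=> fi.
have hi : cintegrable mu (fun x : G => f x * gamma (- x)).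
  apply: (cintegrable_le _ (cintegrable_normc fi)).
    apply: cmeasurableM; first exact: cintegrable_meas fi.
    by under eq_fun do rewrite dualN; apply: cmeasurableC; exact: character_cmeasurable.
  by move=> x; rewrite Normc.normcM dual_normc mulr1.
rewrite /fourier -(cintegralZ _ hi).
rewrite -(cintegral_translate mu_haar (- y) (cintegrableZ (gamma (- y)) hi)).
congr cintegral; apply/funext => x; rewrite /translate [x - y]addrC.
by rewrite mulrCA -characterD opprD opprK addrA addNr sub0r.
Qed.

(** For integrable functions this is [fourier_translate]; in general [f] is cut off to a large
    compact set, and both sides are isometric in [f]. A vanishing norm, instead of equality a.e., is
    the form that feeds the Cauchy-Schwarz inequality. *)
Lemma plancherel_translate y f : L2 mu f ->
  nrm2 nu (fun gamma : borel D => F (translate y f) gamma - (gamma : D) (- y) * F f gamma) = 0.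
Proof.
move=> L2f; have [K [cK ndK KT]] := compact_exhaustion scG.
have mK n : measurable (K n : set (borel G)) by exact: compact_borel.
have L2Ty := L2_translation y L2f.
have L2c (phi : borel D -> R[i]) : L2 nu phi ->
    L2 nu (fun gamma : borel D => (gamma : D) (- y) * phi gamma).
  exact: L2_char_mul.
have nrm2c (phi : borel D -> R[i]) :
    nrm2 nu (fun gamma : borel D => (gamma : D) (- y) * phi gamma) = nrm2 nu phi.
  by apply: eq_Rintegral => gamma _; rewrite sqcM dual_normc expr1n mul1r.
apply/eqP; rewrite eq_le nrm2_ge0 andbT; apply/ler_addgt0Pr => eps eps0; rewrite add0r.
have e4 : 0 < eps / 4 by rewrite divr_gt0.
have [n hn] := nrm2_exhaustion mK ndK KT L2f e4.
pose g : borel G -> R[i] := fun x => f x * cind (K n : set (borel G)) x.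
have L2g : L2 mu g by exact: L2_indM.
have ig : cintegrable mu g.
  rewrite (_ : g = fun x => f x * (cind (K n : set (borel G)) x)^*); last first.
    by apply/funext => x; rewrite cindC.
  apply: cintegrable_inner => //; apply: L2_cind => //.
  by have [_ cfin _] := mu_haar; exact: cfin.
have iTg : cintegrable mu (translate y g).
  by rewrite translateE; exact: cintegrable_translate.
have L2Tg := L2_translation y L2g.
have L2F1 := plancherel_L2 L2Ty; have L2F2 := plancherel_L2 L2Tg.
have L2F3 := L2c _ (plancherel_L2 L2f).
have := nrm2D_le (L2B L2F1 L2F2) (L2B L2F2 L2F3).
have -> : (fun gamma : borel D => F (translate y f) gamma - F (translate y g) gamma +
     (F (translate y g) gamma - (gamma : D) (- y) * F f gamma)) =
  (fun gamma : borel D => F (translate y f) gamma - (gamma : D) (- y) * F f gamma).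
  by apply/funext => gamma; rewrite addrA subrK.
move=> /le_trans; apply; rewrite plancherel_dist//.
have -> : nrm2 mu (fun x => translate y f x - translate y g x) = nrm2 mu (fun x => f x - g x).
  by rewrite !translateE -(nrm2_translate mu_haar (- y) (L2B L2f L2g)).
have -> : nrm2 nu (fun gamma : borel D => F (translate y g) gamma - (gamma : D) (- y) * F f gamma) =
    nrm2 mu (fun x => f x - g x).
  transitivity (nrm2 nu (fun gamma : borel D => (gamma : D) (- y) * (F g gamma - F f gamma))).
    apply: nrm2_ae; first exact: L2B.
      by apply: L2c; apply: L2B; exact: plancherel_L2.
    have [_ _ _ hF] := F_plancherel.
    apply: aeS (aeI (hF _ L2Tg iTg) (hF _ L2g ig)) => gamma [-> ->].
    by rewrite fourier_translate// mulrBr.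
  rewrite nrm2c plancherel_dist//; apply: eq_Rintegral => x _.
  by rewrite normc_subC.
by move: hn; rewrite -/g; lra.
Qed.

Lemma plancherel_invP phi : L2 nu phi ->
  L2 mu (plancherel_inv mu nu F phi) /\
  {ae nu, forall gamma, F (plancherel_inv mu nu F phi) gamma = phi gamma}.
Proof.
move=> L2phi; have [_ _ h _] := F_plancherel; have [f L2f Ff] := h _ L2phi.
apply: (@xgetPex _ (fun=> 0) [set f | L2 mu f /\ {ae nu, forall gamma, F f gamma = phi gamma}]).
by exists f.
Qed.

(** Moves the frame coefficients to the dual side, where [translate y] becomes the evaluation of
    characters at [y]. The value does not depend on the representative chosen by
    [plancherel_inv]. *)
Lemma inner_translate_plancherel_inv y f phi : L2 mu f -> L2 nu phi ->
  inner mu f (translate y (plancherel_inv mu nu F phi)) =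
  cintegral nu (fun gamma : borel D => F f gamma * (phi gamma)^* * (gamma : D) y).
Proof.
move=> L2f L2phi; have [L2p Fp] := plancherel_invP L2phi.
set p := plancherel_inv _ _ _ _ in L2p Fp *.
have L2Ff := plancherel_L2 L2f; have L2Tp := L2_translation y L2p.
rewrite -plancherel_inner//.
have L2c := L2_char_mul (- y) (plancherel_L2 L2p).
transitivity (inner nu (F f) (fun gamma : borel D => (gamma : D) (- y) * F p gamma)).
  apply/eqP; rewrite -subr_eq0; apply/eqP.
  have L2d := L2B (plancherel_L2 L2Tp) L2c.
  have := cauchy_schwarz L2Ff L2d; rewrite plancherel_translate// mulr0.
  have -> : inner nu (F f)
      (fun gamma : borel D => F (translate y p) gamma - (gamma : D) (- y) * F p gamma) =
     inner nu (F f) (F (translate y p)) -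
     inner nu (F f) (fun gamma : borel D => (gamma : D) (- y) * F p gamma).
    rewrite innerC// (innerBl (plancherel_L2 L2Tp) L2c L2Ff) rmorphB/=.
    by rewrite -!innerC//; exact: plancherel_L2.
  move: (_ - _) => z z0; apply: Normc.eq0_normc; apply/eqP.
  by rewrite -sqrf_eq0 eq_le z0 sqc_ge0.
transitivity (inner nu (F f) (fun gamma : borel D => (gamma : D) (- y) * phi gamma)).
  apply: inner_ae => //; first exact: L2_char_mul.
    exact: aeW.
  by apply: aeS Fp => gamma ->.
congr cintegral; apply/funext => gamma.
by rewrite rmorphM/= -dualN opprK -mulrA [_^* * _]mulrC.
Qed.

(* If every character were trivial at l, translation by l would act trivially on L^2(G). *)
Lemma characters_separate (lcG : locally_compact [set: G]) (l : G) : l != 0 ->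
  exists gamma : D, gamma l != 1.
Proof.
move=> l0; apply: contrapT => /forallNP h.
have h1 (gamma : D) : gamma (- l) = 1.
  by have := h gamma => /negP; rewrite negbK dualN => /eqP ->; rewrite rmorph1.
have [K cK K0] := locally_compactP lcG 0.
have : nbhs (0 : G) (~` [set l]).
  apply: open_nbhs_nbhs; split; last by move=> /esym/eqP; rewrite (negbTE l0).
  by apply: closed_openC; apply: accessible_closed_set1; exact: hausdorff_accessible.
move=> /nbhs0_sub[W W0 Wl].
(* Differences of points of [U] avoid [l], so [U] and its translate by [l] are disjoint, and [U] has
   finite measure. *)
pose U := (W `&` K)°; have U0 : nbhs (0 : G) U.
  by apply: open_nbhs_nbhs; split; [exact: open_interior|exact: filterI].
have mU : measurable (U : set (borel G)) by apply: open_borel; exact: open_interior.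
have Uoo : (mu U < +oo)%E.
  have [_ cfin _] := mu_haar; apply: le_lt_trans (cfin _ cK).
  apply: le_measure; rewrite ?inE//; first exact: compact_borel.
  by move=> x /interior_subset[].
have L2w := L2_cind mU Uoo.
have := plancherel_translate l L2w.
have -> : (fun gamma : borel D => F (translate l (cind (U : set (borel G)))) gamma -
    (gamma : D) (- l) * F (cind (U : set (borel G))) gamma) =
  (fun gamma : borel D => F (translate l (cind (U : set (borel G)))) gamma -
    F (cind (U : set (borel G))) gamma).
  by apply/funext => gamma; rewrite h1 mul1r.
have L2Tw := L2_translation l L2w.
rewrite (plancherel_dist L2Tw L2w) (nrm2B L2Tw L2w).
(* By disjointness the squared distance between the two indicators is twice the measure of [U],
   while triviality of all characters at [l] made it 0. *)
have -> : inner mu (translate l (cind (U : set (borel G)))) (cind (U : set (borel G))) = 0.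
  rewrite -(cintegral0 mu); congr cintegral; apply/funext => x.
  rewrite cindC /translate.
  have [Ux|nU] := pselect (U x); last by rewrite [X in _ * X]cind_out ?mulr0.
  rewrite cind_out ?mul0r// => Uxl; apply: (Wl x (x - l)).
  - by have /interior_subset[] := Ux.
  - by have /interior_subset[] := Uxl.
  - by rewrite /= opprB addrC subrK.
rewrite translateE (nrm2_translate mu_haar _ L2w) nrm2_cind// mulr0 subr0 => U2.
have : mu U != 0%E by exact: haar_open_pos.
apply/negP; rewrite negbK; apply/eqP.
have : fine (mu U) = 0 by lra.
by move=> U0'; rewrite -[LHS]fineK ?U0'// ge0_fin_numE.
Qed.

End Plancherel.

(** * The generalized shift-invariant system *)

(** The multiplier is first set to 0 where it exceeds |M|, a null set, so that the everywhere bound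
    demanded by [L2M] holds. *)
Lemma L2_ae_bounded {R : realType} {d : measure_display} {T : measurableType d}
  (mu : {measure set T -> \bar R}) (M : R) (u f : T -> R[i]) : cmeasurable u ->
  {ae mu, forall x, Normc.normc (u x) <= M} -> L2 mu f -> L2 mu (fun x => u x * f x).
Proof.
move=> hu uM L2f; pose E := [set x | Normc.normc (u x) <= `|M|].
have mE : measurable E.
  have mn := measurable_normc hu.
  have := mn measurableT `]-oo, `|M|]%classic (measurable_itv _).
  by rewrite setTI; congr measurable; apply/seteqP; split => x /=; rewrite in_itv.
have L2v : L2 mu (fun x => (u x * cind E x) * f x).
  apply: (@L2M _ _ _ _ `|M|) => //.
    by apply: cmeasurableM => //; exact: cmeasurable_cind.
  move=> x; rewrite cindE; case: asboolP => [|_]; first by rewrite mulr1.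
  by rewrite mulr0 Normc.normc0.
have mf : cmeasurable (fun x => u x * f x) by apply: cmeasurableM => //; case: L2f.
split => //; have [mv voo] := L2v; apply: le_lt_trans voo.
rewrite le_eqVlt; apply/orP; left; apply/eqP; apply: ae_eq_integral => //.
- by apply/measurable_EFinP; exact: measurable_sqc.
- by apply/measurable_EFinP; exact: measurable_sqc.
- apply: filterS uM => x uM _; rewrite cind_in ?mulr1//.
  by rewrite /E /= (le_trans uM)// ler_norm.
Qed.

(** Weighted Young inequality. Unlike [sqcD_le], it keeps the factor of the main term close to 1,
    which an inequality with sharp constant needs. *)
Lemma normc_le_near {R : realType} (z w : R[i]) (del : R) : 0 < del ->
  sqc (z + w) <= (1 + del) * sqc z + (1 + del^-1) * sqc w.
Proof.
move=> del0; rewrite sqcD.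
have h : 2 * cRe (z * w^*) <= del * sqc z + del^-1 * sqc w.
  have h1 : 2 * cRe (z * w^*) <= 2 * (Normc.normc z * Normc.normc w).
    rewrite ler_pM2l// (le_trans (ler_norm _))// (le_trans (norm_Re_le _))//.
    by rewrite Normc.normcM normcC.
  apply: le_trans h1 _; move: (Normc.normc z) (Normc.normc w) => a b.
  have := sqr_ge0 (del * a - b); have di : del * del^-1 = 1 by rewrite divff ?lt0r_neq0.
  have d0 : 0 < del^-1 by rewrite invr_gt0.
  move=> h; rewrite -subr_ge0.
  have -> : del * a ^+ 2 + del^-1 * b ^+ 2 - 2 * (a * b) = del^-1 * (del * a - b) ^+ 2.
    by field; rewrite lt0r_neq0.
  by rewrite mulr_ge0// ltW.
by move: h; lra.
Qed.

(** * Extending the Parseval identity from a dense set *)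

Section ParsevalDensity.
Context {R : realType} {d : measure_display} {T : measurableType d}.
Variable mu : {measure set T -> \bar R}.

Lemma nrm2D_near (u v : T -> R[i]) (del : R) : 0 < del -> L2 mu u -> L2 mu v ->
  nrm2 mu (fun x => u x + v x) <= (1 + del) * nrm2 mu u + (1 + del^-1) * nrm2 mu v.
Proof.
move=> d0 L2u L2v.
have iu := L2_integrable L2u; have iv := L2_integrable L2v.
rewrite /nrm2 -RintegralZl// -RintegralZl// -RintegralD//; last 2 first.
- exact: (integrableZl measurableT _ iu).
- exact: (integrableZl measurableT _ iv).
apply: le_Rintegral => //.
- exact: L2_integrable (L2D L2u L2v).
- exact: (integrableD measurableT (integrableZl measurableT _ iu) (integrableZl measurableT _ iv)).
- by move=> x _; exact: normc_le_near.
Qed.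

Context {J : choiceType}.
Variables (S : set J) (s : J -> T -> R[i]).
Hypothesis L2s : forall j, S j -> L2 mu (s j).
Local Notation energy f := (\esum_(j in S) (sqc (inner mu f (s j)))%:E).
Local Notation finite_part r := (uniq r /\ forall j, j \in r -> S j).

Lemma le_energy (r : seq J) g : finite_part r ->
  ((\sum_(j <- r) sqc (inner mu g (s j)))%:E <= energy g)%E.
Proof.
move=> [ur rS]; apply: ereal_sup_ubound; exists [set` r].
  by split; [exact: finite_seq|move=> j; exact: rS].
by rewrite -fsbig_seq// sumEFin.
Qed.

Lemma energy_le (C : R) g :
  (forall r, finite_part r -> \sum_(j <- r) sqc (inner mu g (s j)) <= C) ->
  (energy g <= C%:E)%E.
Proof.
move=> h; apply: ge_ereal_sup => _ [X [/finite_seqP[r0 Xr0] XS] <-].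
have Xr : X = [set` undup r0] by rewrite Xr0; apply/seteqP; split => l /=; rewrite mem_undup.
rewrite Xr -fsbig_seq ?undup_uniq// sumEFin lee_fin; apply: h.
by split; [exact: undup_uniq|move=> j js; apply: XS; rewrite Xr].
Qed.

Hypothesis dense : forall f, L2 mu f -> forall eps : R, 0 < eps -> exists g,
  [/\ L2 mu g, nrm2 mu (fun x => f x - g x) <= eps & energy g = (nrm2 mu g)%:E].

(** A finite partial sum is continuous in [f], so the bound passes from the dense set to [f]; the
    losses 1 + del incurred twice vanish as del tends to 0. *)
Lemma bessel_dense f (r : seq J) : L2 mu f -> finite_part r ->
  \sum_(j <- r) sqc (inner mu f (s j)) <= nrm2 mu f.
Proof.
move=> L2f fr; have [ur rS] := fr; pose C := \sum_(j <- r) nrm2 mu (s j).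
have C0 : 0 <= C by apply: sumr_ge0 => j _; exact: nrm2_ge0.
have near (del : R) : 0 < del -> del <= 1 ->
    \sum_(j <- r) sqc (inner mu f (s j)) <= nrm2 mu f + del * (3 * nrm2 mu f + 3).
  move=> d0 d1; have di0 : 0 < 1 + del^-1 by rewrite addr_gt0 ?invr_gt0.
  (* The tolerance del / ((1 + 1/del)(C + 1)) makes both error terms, with and without the norms [C]
     of the generators, at most del. *)
  have k0 : 0 < (1 + del^-1) * (C + 1) by rewrite mulr_gt0// ltr_wpDl.
  have [g [L2g fg Eg]] := dense L2f (divr_gt0 d0 k0).
  pose D := nrm2 mu (fun x => f x - g x).
  have D0 : 0 <= D by exact: nrm2_ge0.
  have Dk : (1 + del^-1) * (C + 1) * D <= del by rewrite mulrC -ler_pdivlMr.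
  have L2d := L2B L2f L2g.
  have gE : \sum_(j <- r) sqc (inner mu g (s j)) <= nrm2 mu g.
    by rewrite -lee_fin -Eg; exact: le_energy.
  have h1 : \sum_(j <- r) sqc (inner mu f (s j)) <=
      (1 + del) * \sum_(j <- r) sqc (inner mu g (s j)) + (1 + del^-1) * (C * D).
    rewrite mulr_sumr mulr_suml mulr_sumr -big_split big_seq [leRHS]big_seq.
    apply: ler_sum => j /rS Sj.
    have -> : inner mu f (s j) = inner mu g (s j) + inner mu (fun x => f x - g x) (s j).
      by rewrite (innerBl L2f L2g (L2s Sj)) addrC subrK.
    apply: le_trans (normc_le_near _ _ d0) _; rewrite lerD2l (ler_pM2l di0).
    by rewrite mulrC; exact: cauchy_schwarz (L2s Sj).
  have h2 : nrm2 mu g <= (1 + del) * nrm2 mu f + (1 + del^-1) * D.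
    have := nrm2D_near d0 L2f (L2B L2g L2f).
    have -> : (fun x => f x + (g x - f x)) = g by apply/funext => x; rewrite addrC subrK.
    suff -> : nrm2 mu (fun x => g x - f x) = D by [].
    by apply: eq_Rintegral => x _; rewrite normc_subC.
  have n0 := nrm2_ge0 mu f.
  have kD : (1 + del^-1) * D <= del by apply: le_trans Dk; rewrite -mulrA (ler_pM2l di0); nra.
  have kCD : (1 + del^-1) * (C * D) <= del.
    by apply: le_trans Dk; rewrite -mulrA (ler_pM2l di0); nra.
  move: gE h1 h2 n0 kD kCD; move: (\sum_(j <- r) sqc (inner mu g (s j))).
  move: (nrm2 mu f) (nrm2 mu g) ((1 + del^-1) * D) ((1 + del^-1) * (C * D)).
  move=> n m x y z zm h1 h2 n0 xd yd; apply: (le_trans h1).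
  have : (1 + del) * z <= (1 + del) * ((1 + del) * n + del).
    by rewrite ler_pM2l; lra.
  have dd : del * del <= del by rewrite ler_piMl// ltW.
  have ddn : del * del * n <= del * n by rewrite ler_wpM2r.
  by move: yd; nra.
apply/ler_addgt0Pr => eps eps0; have n0 := nrm2_ge0 mu f.
have e0 : 0 < eps / (3 * nrm2 mu f + 3) by rewrite divr_gt0//; lra.
(* [near] needs del <= 1; if the quotient exceeds 1, then del = 1 already loses less than eps. *)
have [le1|gt1] := leP (eps / (3 * nrm2 mu f + 3)) 1.
  apply: le_trans (near _ e0 le1) _; rewrite lerD2l divfK//.
  by rewrite lt0r_neq0//; lra.
apply: le_trans (near 1 ltr01 (lexx _)) _; rewrite lerD2l mul1r.
by move: gt1; rewrite ltr_pdivlMr ?mul1r; lra.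
Qed.

(** For a fixed finite [r] the defect [q] is a quadratic form, nonnegative by Bessel. With f = g +
    h, the parallelogram law gives q(f) <= 2 q(g) + 2 q(h), where q(g) is small by the choice of [r]
    and q(h) is at most the squared norm of h. *)
Lemma parseval_dense f : L2 mu f -> energy f = (nrm2 mu f)%:E.
Proof.
move=> L2f; apply/eqP; rewrite eq_le; apply/andP; split.
  by apply: energy_le => r; exact: bessel_dense.
apply/lee_addgt0Pr => eps eps0; have e4 : 0 < eps / 4 by rewrite divr_gt0.
have [g [L2g fg Eg]] := dense L2f e4; have L2d := L2B L2f L2g.
have [r fr hr] : exists2 r, finite_part r &
    nrm2 mu g - eps / 4 <= \sum_(j <- r) sqc (inner mu g (s j)).
  apply: contrapT => /forall2NP h.
  have : (energy g <= (nrm2 mu g - eps / 4)%:E)%E.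
    apply: energy_le => r fr; have [//|/negP] := h r.
    by rewrite -ltNge => /ltW.
  by rewrite Eg lee_fin; lra.
apply: (@le_trans _ _ ((\sum_(j <- r) sqc (inner mu f (s j)))%:E + eps%:E)%E); last first.
  by rewrite leeD2r//; exact: le_energy.
rewrite -EFinD lee_fin.
pose h : T -> R[i] := fun x => f x - g x.
pose q u := nrm2 mu u - \sum_(j <- r) sqc (inner mu u (s j)).
have par : q (fun x => g x + h x) + q (fun x => g x - h x) = 2 * q g + 2 * q h.
  rewrite /q (nrm2D L2g L2d) (nrm2B L2g L2d).
  have -> : \sum_(j <- r) sqc (inner mu (fun x => g x + h x) (s j)) =
      2 * \sum_(j <- r) sqc (inner mu g (s j)) + 2 * \sum_(j <- r) sqc (inner mu h (s j)) -
      \sum_(j <- r) sqc (inner mu (fun x => g x - h x) (s j)).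
    apply/eqP; rewrite eq_sym subr_eq eq_sym; apply/eqP.
    rewrite !mulr_sumr -!big_split big_seq [RHS]big_seq; apply: eq_bigr => j /fr.2 Sj.
    rewrite (innerDl L2g L2d (L2s Sj)) (innerBl L2g L2d (L2s Sj)).
    move: (inner mu g (s j)) (inner mu h (s j)) => z w.
    by rewrite !sqcE; case: z w => a b [c e] /=; ring.
  by ring.
have hf : (fun x => g x + h x) = f by apply/funext => x; rewrite /h addrC subrK.
have q1 : 0 <= q (fun x => g x - h x).
  by rewrite subr_ge0; apply: bessel_dense => //; exact: L2B.
have q2 : q h <= nrm2 mu h.
  by rewrite gerBl sumr_ge0// => j _; exact: sqc_ge0.
move: par; rewrite hf; move: fg hr q1 q2; rewrite -/h /q.
lra.
Qed.

End ParsevalDensity.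

(** * The isometry condition read on cosets *)

Section Splitting.
Context {R : realType} {D : topologicalZmodType}.
Variable nu : {measure set (borel D) -> \bar R}.
Hypothesis nu_haar : haar_measure nu.

Lemma ae_translates (A : set D) (P : borel D -> Prop) : countable A ->
  {ae nu, forall g, P g} -> {ae nu, forall g : D, forall a, A a -> P (a + g)}.
Proof. by move=> cA hP; apply: ae_countable => // a _; exact: ae_translate. Qed.

Variables A B V : set D.
Hypothesis sA : is_subgroup A.
Hypothesis sB : is_subgroup B.
Hypothesis cA : countable A.
Hypothesis BA : B `<=` A.
Hypothesis fdV : fundamental_domain nu A V.

(** Almost every point is moved into [V] by some element of the countable [A], along which the value
    does not change. *)
Lemma periodic_bounded (h : borel D -> R[i]) (M : R) :
  {ae nu, forall g, V g -> Normc.normc (h g) <= M} ->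
  (forall w, A w -> {ae nu, forall g : D, h (w + g : D) = h g}) ->
  {ae nu, forall g, Normc.normc (h g) <= M}.
Proof.
move=> hM per.
have h1 : {ae nu, forall g : D, forall w, A w -> h (w + g : D) = h g} by exact: ae_countable.
apply: aeS (aeI (aeI h1 (ae_translates cA hM)) (fd_tiling cA fdV)).
move=> g [[hper hb] [[w Aw Vw] _]]; have Aw' := subgroupN sA Aw.
by rewrite -(hper _ Aw'); apply: hb => //; rewrite addrC.
Qed.

Context {n d : nat}.
Variables (r : 'I_d -> D) (P : 'I_n -> borel D -> R[i]).
Hypothesis reps : coset_representatives A B r.
Hypothesis periodic : forall i w, B w -> {ae nu, forall g : D, P i (w + g : D) = P i g}.
Hypothesis isometry : {ae nu, forall g : D, V g -> forall l l',
  \sum_(i < n) (P i (g + r l : D))^* * P i (g + r l' : D) = if l == l' then d%:R else 0}.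

Let cB : countable B := sub_countable (subset_card_le BA) cA.

(** The hypothesis concerns g in [V] and shifts by representatives. A general g is moved to g - a in
    [V]; then g and w + g differ from g - a by representatives [r l] and [r l'] modulo [B], and l =
    l' exactly when w lies in [B]. *)
Lemma filter_orthogonality : {ae nu, forall g : D, forall w, A w ->
  \sum_(i < n) (P i g)^* * P i (w + g : D) = if `[< B w >] then d%:R else 0}.
Proof.
have h1 : {ae nu, forall g : D, forall i, [set: 'I_n] i -> forall b, B b ->
    P i (b + g : D) = P i g}.
  apply: ae_countable => [|i _]; first exact: finite_set_countable.
  by apply: ae_countable => // b Bb; exact: periodic.
have h2 := ae_translates cA h1.
have h3 := ae_translates cA isometry.
apply: aeS (aeI (aeI h2 h3) (fd_tiling cA fdV)).
move=> g [[per iso] [[a Aa Va] _]] w Aw.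
have [rA rU] := reps; have [l [Bl ul]] := rU _ Aa.
have [l' [Bl' ul']] := rU _ (subgroupD sA Aw Aa).
have Aa' := subgroupN sA Aa.
(* Periodicity under [B] replaces x + g by the base point g - a in [V] plus the representative of x
   + a. *)
have Pl i (m : 'I_d) x : A x -> B (x + a - r m) -> P i (x + g : D) = P i (- a + g + r m : D).
  move=> Ax Bm.
  have Am : A (r m - a) by exact: sA.2.
  have -> : x + g = (x + a - r m) + ((r m - a) + g) by rewrite !addrA subrK addrK.
  have -> : - a + g + r m = (r m - a) + g by rewrite addrC addrA.
  exact: (per (r m - a)).
have -> : \sum_(i < n) (P i g)^* * P i (w + g : D) =
    \sum_(i < n) (P i (- a + g + r l : D))^* * P i (- a + g + r l' : D).
  apply: eq_bigr => i _; rewrite (Pl i l' w Aw Bl').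
  have := Pl i l 0 sA.1; rewrite add0r => h.
  by have := h Bl; rewrite add0r => ->.
have Va' : V (- a + g) by rewrite addrC.
rewrite (iso _ Aa' Va'); congr (if _ then _ else _).
apply/eqP/asboolP => [ll'|Bw].
  have -> : w = (w + a - r l') - (a - r l) by rewrite ll' opprB addrA subrK addrK.
  exact: sB.2.
apply: ul; have -> : a - r l' = (w + a - r l') - w by rewrite -(addrA w a) addrAC subrr add0r.
exact: sB.2.
Qed.

(** The term of index w carries the factor sum_i conj(P_i(g)) P_i(w + g), which is d for w in [B]
    and 0 for the other w: the sum over [A] collapses to the smaller lattice. *)
Lemma periodize_splitting (Om : seq D) (h : borel D -> R[i]) (k : 'I_n -> borel D -> R[i]) :
  (forall w, w \in Om -> A w) -> L2 nu h -> (forall i, L2 nu (k i)) ->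
  (forall i, {ae nu, forall g, k i g = (P i g)^* * h g}) ->
  \sum_(i < n) inner nu (k i) (periodize Om (k i)) =
  d%:R * inner nu h (periodize [seq w <- Om | `[< B w >]] h).
Proof.
move=> OA L2h L2k kP.
have ih := cintegrable_inner L2h (L2_periodize nu_haar [seq w <- Om | `[< B w >]] L2h).
have ik i := cintegrable_inner (L2k i) (L2_periodize nu_haar Om (L2k i)).
rewrite /inner -cintegral_sum// -cintegralZ//; apply: ae_eq_cintegral.
- by apply: cmeasurable_sum => i; exact: cintegrable_meas (ik i).
- by apply: cmeasurableM; [exact: cmeasurable_cst|exact: cintegrable_meas ih].
have h1 : {ae nu, forall g : D, forall i, [set: 'I_n] i -> k i g = (P i g)^* * h g}.
  by apply: ae_countable => [|i _]; [exact: finite_set_countable|exact: kP].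
apply: aeS (aeI (ae_translates cA h1) filter_orthogonality) => g [kg orth].
have k0 i : k i g = (P i g)^* * h g by have := kg 0 sA.1 i I; rewrite add0r.
transitivity (\sum_(w <- Om) h g * (h (w + g : D))^* *
    \sum_(i < n) (P i g)^* * P i (w + g : D)).
  under eq_bigr do rewrite /periodize rmorph_sum mulr_sumr.
  rewrite exchange_big /= big_seq [RHS]big_seq; apply: eq_bigr => w /OA Aw.
  rewrite mulr_sumr; apply: eq_bigr => i _.
  by rewrite k0 (kg w Aw i I) rmorphM/= conjCK; ring.
rewrite /periodize rmorph_sum !mulr_sumr big_filter [RHS]big_mkcond /=.
rewrite big_seq [RHS]big_seq; apply: eq_bigr => w /OA Aw.
by rewrite (orth w Aw); case: ifP => _; rewrite ?mulr0//; ring.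
Qed.

End Splitting.

Lemma periodize_disjoint {R : realType} {D : topologicalZmodType}
  (nu : {measure set (borel D) -> \bar R}) (nu_haar : haar_measure nu)
  (hD : hausdorff_space D) (A S : set D) (Om : seq D) (h : borel D -> R[i]) :
  is_subgroup A -> countable A -> compact S -> window A S S Om ->
  (forall w w', A w -> A w' -> w <> w' ->
     nu ((+%R w @` S) `&` (+%R w' @` S)) = 0%E) ->
  L2 nu h -> (forall g, ~ S g -> h g = 0) ->
  inner nu h (periodize Om h) = (nrm2 nu h)%:C%C.
Proof.
move=> sA cA cS [uO OA OV] dS L2h hS; rewrite -inner_nrm2//.
have L2per := L2_periodize nu_haar Om L2h.
have mS : measurable (S : set (borel D)) by exact: compact_borel.
apply: ae_eq_cintegral.
- exact: cintegrable_meas (cintegrable_inner L2h L2per).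
- exact: cintegrable_meas (cintegrable_inner L2h L2h).
have : {ae nu, forall g : D, forall w, A w -> w <> 0 -> ~ (S g /\ S (w + g))}.
  apply: ae_countable => // w Aw; have [w0|w0] := pselect (w = 0); first exact: aeW.
  (* Having g and w + g both in [S] puts g in [S] and in its translate by - w. *)
  have : nu.-negligible ((+%R 0 @` S) `&` (+%R (- w) @` S)).
    apply/negligibleP.
      by rewrite !imageDlE; apply: measurableI; exact: translate_borel.
    apply: dS; [exact: sA.1|exact: subgroupN|].
    by move=> /eqP; rewrite eq_sym oppr_eq0 => /eqP.
  apply: negligibleS => g /= /not_implyP[_ /contrapT[Sg Swg]].
  by split; [exists g; rewrite ?add0r|exists (w + g); rewrite ?addKr].
apply: aeS => g disj; have [->|hg] := eqVneq (h g) 0; first by rewrite !mul0r.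
have Sg : S g by apply: contrapT => /hS/eqP; rewrite (negbTE hg).
congr (_ * _^*); have O0 : 0 \in Om by apply: (OV 0 g) => //; [exact: sA.1|rewrite add0r].
rewrite /periodize (bigD1_seq 0)//= add0r big_seq_cond big1 ?addr0// => w /andP[/OA Aw w0].
by apply: hS => Swg; apply: (disj w Aw) => //; apply/eqP.
Qed.

Lemma esum_ord {R : realType} (n : nat) (J : choiceType) (S : set J) (a : 'I_n -> J -> \bar R) :
  (forall i j, 0 <= a i j)%E ->
  \esum_(p in [set p | S p.2]) a p.1 p.2 = (\sum_(i < n) \esum_(j in S) a i j)%E.
Proof.
move=> a0; have -> : [set p : 'I_n * J | S p.2] = [set: 'I_n] `*`` (fun=> S).
  by apply/seteqP; split => p //= [].
rewrite -(esum_esum (a := a))// esum_fset; last first.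
- by move=> i _; exact: esum_ge0.
- exact: finite_finset.
have -> : [set: 'I_n] = [set` enum 'I_n] by apply/seteqP; split => i //= _; rewrite mem_enum.
by rewrite -fsbig_seq ?enum_uniq// big_enum.
Qed.

Section FilterRows.
Context {R : realType} {G : topologicalZmodType}.
Local Notation D := (dual_group R G).

(** The rows of [Pmx] as functions of the character, indexed as in its [col_mx], so that low-pass
    and high-pass filters are treated as one family. *)
Definition filter_rows (r : nat) (H : D -> R[i]) (Gm : 'I_r -> D -> R[i])
    (i : 'I_(1 + r)) : D -> R[i] :=
  if fintype.split i is inr m then Gm m else H.

Lemma Pmx_isometry (r d : nat) (H : D -> R[i]) (Gm : 'I_r -> D -> R[i])
    (t : 'I_d -> D) (g : D) :
  (Pmx H Gm t g)^t* *m Pmx H Gm t g = (d%:R)%:M ->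
  forall l l', \sum_(i < 1 + r) (filter_rows H Gm i (g + t l))^* *
    filter_rows H Gm i (g + t l') = if l == l' then d%:R else 0.
Proof.
move=> /matrixP E l l'; have := E l l'; rewrite !mxE mulrb => <-.
apply: eq_bigr => i _; rewrite !mxE /filter_rows.
by case: fintype.split => j; rewrite !mxE.
Qed.

End FilterRows.

(** * Coefficient energies at one level and across consecutive levels *)

Section Levels.
Context {R : realType} {G : topologicalZmodType}.
Local Notation D := (dual_group R G).
Hypothesis lcaG : lca_group R G.
Variables (mu : {measure set (borel G) -> \bar R})
          (nu : {measure set (borel D) -> \bar R}).
Hypotheses (mu_haar : haar_measure mu) (nu_haar : haar_measure nu).
Variable F : (borel G -> R[i]) -> (borel D -> R[i]).
Hypothesis F_plancherel : plancherel_transform mu nu F.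
Local Notation ann L := (annihilator L : set D).
Implicit Types (L : set G) (V S : set D) (h : borel D -> R[i]) (Om : seq D).

Lemma annihilator_countable L : lattice L -> countable (ann L).
Proof.
move=> latL; have [_ lcG metG _] := lcaG.
apply: discrete_countable; first exact: annihilator_subgroup.
  exact: annihilator_discrete.
exact: dual_sigma_compact.
Qed.

Definition coefficient_energy L h : \bar R :=
  \esum_(l in L) (sqc (cintegral nu (fun g : borel D => h g * (g : D) l)))%:E.

Lemma coefficient_energyE L V S Om h : lattice L -> fundamental_domain nu (ann L) V ->
  compact S -> window (ann L) S S Om -> L2 nu h -> (forall g, ~ S g -> h g = 0) ->
  coefficient_energy L h = (fine (nu V) * cRe (inner nu h (periodize Om h)))%:E.
Proof.
move=> latL fdV cS wS L2h hS; have [hG lcG metG scG] := lcaG.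
have sL := lattice_subgroup latL; have dL := lattice_discrete latL.
have cL := discrete_countable sL dL scG.
apply: (parseval_periodize nu_haar sL cL _ _ fdV _ _ cS wS) => //.
- exact: annihilator_discrete.
- exact: annihilator_countable.
- by move=> l _; exact: (characters_separate mu_haar hG scG F_plancherel lcG).
- exact: dual_compact_nbhs.
Qed.

Lemma coefficient_energy_disjoint L V S h : lattice L -> fundamental_domain nu (ann L) V ->
  compact S -> (forall w w', ann L w -> ann L w' -> w <> w' ->
     nu ((+%R w @` S) `&` (+%R w' @` S)) = 0%E) ->
  L2 nu h -> (forall g, ~ S g -> h g = 0) ->
  coefficient_energy L h = (fine (nu V) * nrm2 nu h)%:E.
Proof.
move=> latL fdV cS dS L2h hS; have [_ lcG _ _] := lcaG.
have sA := annihilator_subgroup (R := R) L.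
have dA : discrete_at0 (ann L) by exact: annihilator_discrete.
have [Om wO] := window_exists sA dA cS cS.
rewrite (coefficient_energyE latL fdV cS wO L2h hS).
rewrite (periodize_disjoint nu_haar (@dual_hausdorff R G) sA _ cS wO dS L2h hS)//.
exact: annihilator_countable.
Qed.

Lemma coefficient_energy_splitting L L' V V' S (n d : nat) (t : 'I_d -> D)
  (P : 'I_n -> borel D -> R[i]) h (k : 'I_n -> borel D -> R[i]) :
  lattice L -> lattice L' -> L `<=` L' ->
  fundamental_domain nu (ann L) V -> fundamental_domain nu (ann L') V' ->
  coset_representatives (ann L) (ann L') t ->
  (forall i w, ann L' w -> {ae nu, forall g : D, P i (w + g : D) = P i g}) ->
  {ae nu, forall g : D, V g -> forall l l',
    \sum_(i < n) (P i (g + t l : D))^* * P i (g + t l' : D) = if l == l' then d%:R else 0} ->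
  compact S -> L2 nu h -> (forall g, ~ S g -> h g = 0) ->
  (forall i, L2 nu (k i)) -> (forall i g, ~ S g -> k i g = 0) ->
  (forall i, {ae nu, forall g, k i g = (P i g)^* * h g}) ->
  (\sum_(i < n) coefficient_energy L (k i))%E = coefficient_energy L' h.
Proof.
move=> latL latL' LL' fdV fdV' reps per iso cS L2h hS L2k kS kP.
have [_ lcG _ _] := lcaG.
have sA := annihilator_subgroup (R := R) L; have sB := annihilator_subgroup (R := R) L'.
have dA : discrete_at0 (ann L) by exact: annihilator_discrete.
have BA : ann L' `<=` ann L by move=> w Bw l Ll; apply/Bw/LL'.
have cA := annihilator_countable latL.
have [Om wO] := window_exists sA dA cS cS; have [uO OA OV] := wO.
(* One window serves both levels: its part inside the smaller annihilator is a window for the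
   latter, which is the list produced by [periodize_splitting]. *)
have wO' : window (ann L') S S [seq w <- Om | `[< ann L' w >]].
  split; first exact: filter_uniq.
    by move=> w; rewrite mem_filter => /andP[/asboolP].
  move=> w g Bw Sg Swg; rewrite mem_filter; apply/andP; split; first exact/asboolP.
  by apply: (OV w g) => //; exact: BA.
rewrite (coefficient_energyE latL' fdV' cS wO' L2h hS).
under eq_bigr => i _ do rewrite (coefficient_energyE latL fdV cS wO (L2k i) (kS i)).
rewrite sumEFin -mulr_sumr; congr EFin.
rewrite (fd_index nu_haar (@dual_hausdorff R G) sA sB dA cA BA fdV fdV' reps).
rewrite mulrAC mulrC; congr (_ * _).
have := periodize_splitting nu_haar sA sB cA BA fdV reps per iso OA L2h L2k kP.
move=> /(congr1 (@complex.Re R)); rewrite raddf_sum => ->.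
by move: (inner _ _ _) => z; rewrite [_ * z]mulr_natl raddfMn mulr_natl.
Qed.

End Levels.

Lemma Tagged_inj (I : eqType) (T_ : I -> Type) (i : I) : injective (@Tagged I i T_).
Proof. by move=> x y /(congr1 (tagged_as (Tagged T_ x))); rewrite !tagged_asE. Qed.

Lemma L2C {R : realType} {d : measure_display} {T : measurableType d}
  (mu : {measure set T -> \bar R}) (f : T -> R[i]) : L2 mu f -> L2 mu (fun x => (f x)^*).
Proof.
move=> L2f; apply: (L2_le _ (L2_integrable L2f)); first by apply: cmeasurableC; case: L2f.
by move=> x; rewrite normcC.
Qed.

(** * Induction over a finite or infinite run of integers *)

Section ConsecutiveIntegers.
Variables (k0 : int) (I : set int).
Hypothesis consecutive : consecutive_integers k0 I.

Lemma consecutive_ge k : I k -> k0 <= k.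
Proof. by case: consecutive => [->//|[k1 _ ->]] /andP[]. Qed.

Lemma consecutive_sub k k' : k0 <= k -> k <= k' -> I k' -> I k.
Proof.
case: consecutive => [->//|[k1 _ ->]] /= h h' /andP[_ h1].
by rewrite h (le_trans h').
Qed.

Lemma consecutive_first : I k0.
Proof. by case: consecutive => [->|[k1 h ->]] /=; rewrite ?lexx. Qed.

Lemma consecutive_ind (P : int -> Prop) : P k0 ->
  (forall k, I k -> I (k + 1) -> P k -> P (k + 1)) -> forall k, I k -> P k.
Proof.
move=> P0 PS k Ik; have := consecutive_ge Ik; rewrite -subr_ge0.
case E : (k - k0) => [n|//] _.
have {E} kE : k = k0 + n%:Z by apply/eqP; rewrite addrC -subr_eq E.
rewrite kE in Ik *; elim: n Ik {kE} => [|n IHn]; first by rewrite addr0.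
rewrite -addn1 PoszD addrA => Ik; have Ik' : I (k0 + n%:Z).
  by apply: consecutive_sub Ik; rewrite ?lerDl.
exact: PS (IHn _).
Qed.

End ConsecutiveIntegers.

(** * Assembling the levels of the generalized shift-invariant system *)

Section System.
Context {R : realType} {G : topologicalZmodType}.
Local Notation D := (dual_group R G).
Hypothesis lcaG : lca_group R G.
Variables (mu : {measure set (borel G) -> \bar R})
          (nu : {measure set (borel D) -> \bar R}).
Hypotheses (mu_haar : haar_measure mu) (nu_haar : haar_measure nu).
Variable F : (borel G -> R[i]) -> (borel D -> R[i]).
Hypothesis F_plancherel : plancherel_transform mu nu F.
Variables (k0 : int) (I : set int).
Hypothesis I_consecutive : consecutive_integers k0 I.
Variable Lam : int -> set G.
Hypothesis Lam_lattice : forall k, I k -> lattice (Lam k).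
Hypothesis Lam_nested : forall k, I k -> I (k + 1) -> Lam k `<=` Lam (k + 1).
Local Notation ann L := (annihilator L : set D).
Variable V : int -> set D.
Hypothesis V_domain : forall k, I k -> fundamental_domain nu (ann (Lam k)) (V k).
Variable Phi : int -> D -> R[i].
Hypothesis Phi_L2 : forall k, I k -> L2 nu (Phi k).
Hypothesis cond_i : forall S : set D, compact S -> exists2 K1, I K1 &
  forall w w' : D, ann (Lam K1) w -> ann (Lam K1) w' -> w <> w' ->
    nu ((+%R w @` S) `&` (+%R w' @` S)) = 0%E.
Hypothesis cond_ii : forall S : set D, compact S -> forall eps : R, 0 < eps ->
  exists2 K2, I K2 & forall k, I k -> K2 <= k -> forall g, S g ->
    `| fine (nu (V k)) * Normc.normc (Phi k g) ^+ 2 - 1 | <= eps.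
Variable H : int -> D -> R[i].
Hypothesis H_periodic : forall k, I k -> I (k + 1) ->
  periodic_Linfty nu (ann (Lam (k + 1))) (V (k + 1)) (H (k + 1)).
Hypothesis cond_iii : forall k, I k -> I (k + 1) ->
  {ae nu, forall g, Phi k g = H (k + 1) g * Phi (k + 1) g}.
Variables (rho : int -> nat) (Gm : forall k, 'I_(rho k) -> D -> R[i]).
Hypothesis Gm_periodic : forall k, I k -> I (k + 1) -> forall m,
  periodic_Linfty nu (ann (Lam (k + 1))) (V (k + 1)) (@Gm k m).
Variables (d : int -> nat) (reps : forall k, 'I_(d k) -> D).
Hypothesis reps_cosets : forall k, I k -> I (k + 1) ->
  coset_representatives (ann (Lam k)) (ann (Lam (k + 1))) (@reps k).
Hypothesis P_unitary : forall k, I k -> I (k + 1) -> {ae nu, forall g, V k g ->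
  (Pmx (H (k + 1)) (@Gm k) (@reps k) g)^t* *m
    Pmx (H (k + 1)) (@Gm k) (@reps k) g = ((d k)%:R)%:M}.

Lemma Psi_L2 k m : I k -> I (k + 1) -> L2 nu (Psi Phi Gm k m).
Proof.
move=> Ik Ik1; have [mG [M GM] Gp] := Gm_periodic Ik Ik1 m.
apply: (L2_ae_bounded mG _ (Phi_L2 Ik1)).
have sA := annihilator_subgroup (R := R) (Lam (k + 1)).
have cA := annihilator_countable lcaG (Lam_lattice Ik1).
by have := periodic_bounded nu_haar sA cA (V_domain Ik1) GM; apply.
Qed.

Lemma annihilator_nested k k' : I k -> I k' -> k <= k' ->
  ann (Lam k') `<=` ann (Lam k).
Proof.
move=> Ik Ik' kk'; suff : forall k', I k' -> k <= k' -> ann (Lam k') `<=` ann (Lam k) by apply.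
apply: (consecutive_ind I_consecutive) => [|j Ij Ij1 IH].
  move=> kk0; have -> // : k = k0.
  by apply/eqP; rewrite eq_le kk0 (consecutive_ge I_consecutive).
rewrite le_eqVlt => /predU1P[<-//|]; rewrite ltzD1 => kj.
by apply: subset_trans (IH kj) => w Aw l /(Lam_nested Ij Ij1); exact: Aw.
Qed.

(** * Energies against a bounded function of compact support *)

Section Tested.
Variables (S : set D) (M : R) (phi : borel D -> R[i]).
Hypotheses (cS : compact S) (L2phi : L2 nu phi).
Hypothesis phiS : forall g, ~ S g -> phi g = 0.
Hypothesis phiM : forall g, Normc.normc (phi g) <= M.

(** Boundedness of [phi] keeps the product in L^2, and the support [S], common to all generators,
    provides common windows. *)
Let tested (f : D -> R[i]) : borel D -> R[i] := fun g => phi g * (f g)^*.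

Let tested_L2 f : L2 nu f -> L2 nu (tested f).
Proof. by move=> L2f; apply: (@L2M _ _ _ _ M) => //; [case: L2phi|exact: L2C]. Qed.

Let testedS f g : ~ S g -> tested f g = 0.
Proof. by move=> /phiS; rewrite /tested => ->; rewrite mul0r. Qed.

Let E k := coefficient_energy nu (Lam k) (tested (Phi k)).

Lemma energy_step k : I k -> I (k + 1) ->
  (E k + \sum_(m < rho k) coefficient_energy nu (Lam k) (tested (Psi Phi Gm k m)) =
   E (k + 1))%E.
Proof.
move=> Ik Ik1; have L2t := tested_L2 (Phi_L2 Ik1).
(* [Phi k] and all the [Psi] of level [k] form one family, in the order of [filter_rows]: each is
   its filter row times Phi_(k+1). *)
pose f (i : 'I_(1 + rho k)) := if fintype.split i is inr m then Psi Phi Gm k m else Phi k.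
have := @coefficient_energy_splitting R G lcaG mu nu mu_haar nu_haar F F_plancherel
  (Lam k) (Lam (k + 1)) (V k) (V (k + 1)) S _ (d k) (@reps k)
  (filter_rows (H (k + 1)) (@Gm k)) (tested (Phi (k + 1))) (fun i => tested (f i)).
rewrite big_split_ord big_ord1 /= /f.
have splitl i : fintype.split (lshift (rho k) i) = inl i := unsplitK (inl i).
have splitr i : fintype.split (rshift 1 i) = inr i := unsplitK (inr i).
rewrite splitl; under eq_bigr do rewrite splitr.
apply => //; try by move=> *; exact: testedS.
- exact: Lam_lattice.
- exact: Lam_lattice.
- exact: Lam_nested.
- exact: V_domain.
- exact: V_domain.
- exact: reps_cosets.
- move=> i w Bw; rewrite /filter_rows; case: fintype.split => m.
    by have [_ _ h] := H_periodic Ik Ik1; exact: h.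
  by have [_ _ h] := Gm_periodic Ik Ik1 m; exact: h.
- by apply: aeS (P_unitary Ik Ik1) => g P /P; exact: Pmx_isometry.
- move=> i; apply: tested_L2; case: fintype.split => m; first exact: Phi_L2.
  exact: Psi_L2.
- move=> i; rewrite /filter_rows /tested; case: fintype.split => m.
    by apply: aeS (cond_iii Ik Ik1) => g ->; rewrite rmorphM/=; ring.
  by apply: aeW => g; rewrite /Psi rmorphM/=; ring.
Qed.

(** Beyond both thresholds only the diagonal term is left, and the pointwise bound of (ii) on [S] is
    integrated against |phi|^2. Asking for a level [K] in [I], instead of a limit, covers finite [I]
    as well. *)
Lemma energy_limit (eps : R) : 0 < eps -> exists2 K, I K & forall k, I k -> K <= k ->
  exists2 r, E k = r%:E & `|r - nrm2 nu phi| <= eps * nrm2 nu phi.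
Proof.
move=> eps0; have [K1 IK1 dS] := cond_i cS; have [K2 IK2 hE] := cond_ii cS eps0.
have IK : I (Num.max K1 K2) by rewrite /Num.max; case: ifP.
exists (Num.max K1 K2) => // k Ik; rewrite ge_max => /andP[K1k K2k].
have L2t := tested_L2 (Phi_L2 Ik).
exists (fine (nu (V k)) * nrm2 nu (tested (Phi k))).
  apply: (coefficient_energy_disjoint lcaG mu_haar nu_haar F_plancherel _ _ cS) => //.
  - exact: Lam_lattice.
  - exact: V_domain.
  - by move=> w w' Aw Aw'; apply: dS; exact: (annihilator_nested IK1 Ik K1k).
  - exact: testedS.
have i1 := L2_integrable L2t; have i2 := L2_integrable L2phi.
have bound g : `|fine (nu (V k)) * sqc (tested (Phi k) g) - sqc (phi g)| <= eps * sqc (phi g).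
  rewrite /tested; have [Sg|/phiS ->] := pselect (S g); last first.
    by rewrite mul0r Normc.normc0 expr0n mulr0 subr0 normr0 mulr0.
  rewrite Normc.normcM normcC exprMn mulrCA -{2}[sqc (phi g)]mulr1 -mulrBr.
  by rewrite normrM (ger0_norm (sqc_ge0 _)) mulrC ler_wpM2r ?sqc_ge0// hE.
rewrite /nrm2 -RintegralZl// -RintegralZl// -RintegralB//; last first.
  exact: (integrableZl measurableT _ i1).
apply: le_trans (le_normr_Rintegral _ _) _ => //.
  exact: (integrableB measurableT (integrableZl measurableT _ i1) i2).
apply: le_Rintegral => //.
- apply/integrable_norm; exact: (integrableB measurableT (integrableZl measurableT _ i1) i2).
- exact: (integrableZl measurableT _ i2).
Qed.

Let coef (f : D -> R[i]) l : \bar R :=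
  (sqc (cintegral nu (fun g : borel D => tested f g * (g : D) l)))%:E.

Let term (j : gsi_index (G := G) rho) : \bar R :=
  match j with
  | inl l => coef (Phi k0) l
  | inr (existT k (m, l)) => coef (Psi Phi Gm k m) l
  end.

(** The coarse generator is always included, and the [Psi] of level k' only for k' < k: those of
    level [k] already belong to the passage from [k] to k + 1. *)
Let below k : set (gsi_index rho) := gsi_support I k0 Lam `&`
  [set j | if j is inr (existT k' _) then k' < k else True].

Let term_ge0 j : (0 <= term j)%E.
Proof. by case: j => [l|[k [m l]]]; rewrite lee_fin sqc_ge0. Qed.

(** Telescoping: the indices that [below (k + 1)] adds to [below k] are those of the [Psi] of level
    [k], so each step is [energy_step]. *)
Lemma energy_below k : I k -> \esum_(j in below k) term j = E k.
Proof.
move: k; apply: (consecutive_ind I_consecutive) => [|k Ik Ik1 IHk].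
  have -> : below k0 = inl @` Lam k0.
    apply/seteqP; split => [[l|[k [m l]]] [/= h1 h2]|_ [l Ll <-]] //; first by exists l.
    by case: h1 => /(consecutive_ge I_consecutive); rewrite leNgt h2.
  by rewrite esum_image// => x y _ _ [].
rewrite (esumID (below k) _ _ (fun j _ => term_ge0 j)).
have -> : below (k + 1) `&` below k = below k.
  apply: setIidr => j [sj jk]; split => //.
  by case: j sj jk => // -[k' [m l]] _ /= /lt_trans; apply; rewrite ltzD1.
have -> : below (k + 1) `&` ~` below k = (fun p => inr (existT _ k p)) @` [set p | Lam k p.2].
  apply/seteqP; split => [j|_ [[m l] /= Ll <-]].
    case: j => [l|[k' [m l]]] [[h1 h2]] h3; first by case: h3.
    have {h3} : ~~ (k' < k) by apply/negP => k'k; case: h3.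
    rewrite /= -leNgt => kk'; have k'k : k' = k.
      by apply/eqP; rewrite eq_le kk' andbT -ltzD1.
    by subst k'; exists (m, l) => //; case: h1.
  by split; [split; [|rewrite /= ltzD1]|move=> [_ /=]; rewrite ltxx].
rewrite IHk esum_image; last by move=> x y _ _ xy; exact: (Tagged_inj (inr_inj xy)).
rewrite -(energy_step Ik Ik1); congr (_ + _)%E.
rewrite /coefficient_energy -(@esum_ord R _ _ _ (fun m => coef (Psi Phi Gm k m))).
  by apply: eq_esum => -[].
by move=> m l; rewrite lee_fin sqc_ge0.
Qed.

(** Every finite set of indices lies below some level, and that level may be raised to one where the
    energy is within eps of the limit; conversely, the part below such a level already has nearly
    all the energy. *)
Lemma energy_total : \esum_(j in gsi_support I k0 Lam) term j = (nrm2 nu phi)%:E.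
Proof.
have n0 := nrm2_ge0 nu phi.
have fin_below (X : seq (gsi_index rho)) : [set` X] `<=` gsi_support I k0 Lam ->
    exists2 k, I k & [set` X] `<=` below k.
  elim: X => [|j X IHX] XI; first by exists k0 => //; exact: consecutive_first.
  have [|k Ik Xk] := IHX; first by move=> i iX; apply: XI; rewrite /= inE iX orbT.
  have [k' Ik' jk'] : exists2 k', I k' & below k' j.
    have : gsi_support I k0 Lam j by apply: XI; rewrite /= mem_head.
    case: j XI => [l|[k' [m l]]] _ /= sj; first by exists k0 => //; exact: consecutive_first.
    (* An index of level k' is below k' + 1 only; this level belongs to [I] because [gsi_support]
       requires it. *)
    by have [_ Ik' _] := sj; exists (k' + 1) => //; split => //=; rewrite ltzD1.
  have mono i i' : i <= i' -> below i `<=` below i'.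
    move=> ii' [l|[a [m l]]] [h1 h2]; split => //=.
    exact: lt_le_trans h2 ii'.
  exists (Num.max k k'); first by rewrite /Num.max; case: ifP.
  move=> i /=; rewrite inE => /predU1P[->|iX].
    by apply: mono jk'; rewrite le_max lexx orbT.
  by apply: (mono k); [rewrite le_max lexx|exact: Xk].
have sub k X : I k -> [set` X] `<=` below k -> uniq X -> (\sum_(j <- X) term j <= E k)%E.
  move=> Ik Xk uX; rewrite -(energy_below Ik); apply: ereal_sup_ubound.
  by exists [set` X]; [split => //; exact: finite_seq|rewrite -fsbig_seq].
have close (eps : R) : 0 < eps -> exists2 K, I K & forall k, I k -> K <= k ->
    exists2 r, E k = r%:E & `|r - nrm2 nu phi| <= eps.
  move=> eps0; have e1 : 0 < eps / (nrm2 nu phi + 1) by rewrite divr_gt0// ltr_wpDl.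
  have [K IK hK] := energy_limit e1; exists K => // k Ik Kk.
  have [r -> hr] := hK k Ik Kk; exists r => //; apply: (le_trans hr).
  rewrite mulrAC ler_pdivrMr ?ltr_wpDl// ler_pM2l//; lra.
apply/eqP; rewrite eq_le; apply/andP; split.
  apply/lee_addgt0Pr => eps eps0; have [K IK hK] := close _ eps0.
  apply: ge_ereal_sup => _ [X [/finite_seqP[r Xr] XS] <-].
  have {r Xr} [r ur Xr] : exists2 r, uniq r & X = [set` r].
    exists (undup r); first exact: undup_uniq.
    by rewrite Xr; apply/seteqP; split => l /=; rewrite mem_undup.
  rewrite Xr -fsbig_seq//; rewrite Xr in XS; have [k Ik rk] := fin_below _ XS.
  have Im : I (Num.max k K) by rewrite /Num.max; case: ifP.
  have [|x Ex hx] := hK _ Im; first by rewrite le_max lexx orbT.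
  apply: (@le_trans _ _ (E (Num.max k K))).
    apply: sub => // j /rk [sj jk]; split => //.
    case: j sj jk => // -[a [m l]] _ /= /lt_le_trans; apply.
    by rewrite le_max lexx.
  by rewrite Ex -EFinD lee_fin; move: hx; rewrite ler_norml => /andP[]; lra.
apply/lee_addgt0Pr => eps eps0; have [K IK hK] := close _ eps0.
have [x Ex hx] := hK _ IK (lexx _).
apply: (@le_trans _ _ (E K + eps%:E)%E).
  by rewrite Ex -EFinD lee_fin; move: hx; rewrite ler_norml => /andP[]; lra.
rewrite leeD2r// -(energy_below IK) (@esumID _ _ (below K) (gsi_support _ _ _))//.
have -> : gsi_support I k0 Lam `&` below K = below K by apply: setIidr => j [].
by rewrite leeDl// esum_ge0.
Qed.

End Tested.
Local Notation system := (gsi_system (plancherel_inv mu nu F (Phi k0))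
  (fun k m => plancherel_inv mu nu F (Psi Phi Gm k m))).

Lemma gsi_support_countable : countable (gsi_support (rho := rho) I k0 Lam).
Proof.
have [_ _ _ scG] := lcaG.
have cLam k : I k -> countable (Lam k).
  move=> Ik; have latL := Lam_lattice Ik.
  exact: (discrete_countable (lattice_subgroup latL) (lattice_discrete latL)).
pose level (k : int) (m : 'I_(rho k)) : set (gsi_index rho) :=
  [set inr (existT (fun k => ('I_(rho k) * G)%type) k (m, l)) | l in Lam k].
pose X (b : bool) : set (gsi_index rho) := if b then inl @` Lam k0
  else \bigcup_(k in I) \bigcup_(m in [set: 'I_(rho k)]) level k m.
apply: (@sub_countable _ _ _ (\bigcup_(b in setT) X b)).
  apply: subset_card_le => -[l|[k [m l]]] /=; first by exists true => //; exists l.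
  by move=> [Ik _ Ll]; exists false => //; exists k => //; exists m => //; exists l.
have cim (T T' : Type) (g : T -> T') (Y : set T) : countable Y -> countable (g @` Y).
  by apply: sub_countable; exact: card_image_le.
apply: bigcup_countable => [|[] _]; first exact: finite_set_countable.
  by apply: cim; apply: cLam; exact: consecutive_first I_consecutive.
apply: bigcup_countable => // k Ik; apply: bigcup_countable => [|m _].
  exact: finite_set_countable.
by apply: cim; exact: cLam.
Qed.

Lemma gsi_system_L2 j : gsi_support I k0 Lam j -> L2 mu (system j).
Proof.
case: j => [l _|[k [m l]] [Ik Ik1 _]]; apply: L2_translation => //.
  by have [] := plancherel_invP F_plancherel (Phi_L2 (consecutive_first I_consecutive)).
by have [] := plancherel_invP F_plancherel (Psi_L2 m Ik Ik1).
Qed.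

Lemma gsi_system_tight_frame : tight_frame mu (gsi_support I k0 Lam) system 1.
Proof.
split; [exact: gsi_support_countable|exact: gsi_system_L2|move=> f L2f].
rewrite mul1e (sqnormE L2f); apply: parseval_dense L2f => [j|{}f L2f eps eps0].
  exact: gsi_system_L2.
have [hG lcG metG scG] := lcaG.
have L2Ff := plancherel_L2 F_plancherel L2f.
have [K [cK ndK KT]] := compact_exhaustion (dual_sigma_compact (R := R) metG).
(* Cutting [F f] to [W n] makes it bounded and compactly supported at once; the sets exhaust the
   dual because [F f] takes finite values. *)
pose W n : set (borel D) := K n `&` [set g | Normc.normc (F f g) <= n%:R].
have mW n : measurable (W n).
  apply: measurableI; first by apply: compact_borel => //; exact: dual_hausdorff.
  have mn : measurable_fun setT (fun g => Normc.normc (F f g)).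
    by apply: measurable_normc; case: L2Ff.
  have := mn measurableT `]-oo, n%:R]%classic (measurable_itv _).
  by rewrite setTI; congr measurable; apply/seteqP; split => x /=; rewrite in_itv.
have ndW : nondecreasing_seq W.
  move=> n m nm; rewrite subsetEset => g [Kg Fg]; split.
    by have := ndK _ _ nm; rewrite subsetEset; apply.
  by apply: le_trans Fg _; rewrite ler_nat.
have WT : \bigcup_n W n = setT.
  apply/seteqP; split => // g _; have : (\bigcup_n K n) g by rewrite KT.
  move=> [n _ Kg]; pose m := Num.Def.archi_bound (Normc.normc (F f g)).
  exists (maxn n m) => //; split.
    by have := ndK _ _ (leq_maxl n m); rewrite subsetEset; apply.
  have := archi_boundP (normc_ge0 (F f g)) => /ltW /le_trans; apply.
  by rewrite ler_nat leq_maxr.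
have [n hn] := nrm2_exhaustion mW ndW WT L2Ff eps0.
pose phi : borel D -> R[i] := fun g => F f g * cind (W n) g.
have L2phi : L2 nu phi by exact: L2_indM.
(* Surjectivity of the transform gives a function [u] on the group with transform [phi]; since [F]
   is an isometry, [u] is as close to [f] as [phi] is to [F f]. *)
have [_ _ /(_ _ L2phi)[u L2u Fu] _] := F_plancherel.
have L2Fu := plancherel_L2 F_plancherel L2u; exists u; split => //.
  rewrite -(plancherel_dist F_plancherel L2f L2u); apply: le_trans hn.
  rewrite (@nrm2_ae _ _ _ _ _ (fun g => F f g - phi g))//; try exact: L2B.
  by apply: aeS Fu => g ->.
rewrite -(plancherel_nrm2 F_plancherel L2u) (nrm2_ae L2Fu L2phi Fu).
rewrite -(@energy_total (K n) n%:R phi (cK n) L2phi); first last.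
- move=> g; rewrite /phi Normc.normcM cindE; case: asboolP => [[_ Fg]|_].
    by rewrite Normc.normc1 mulr1.
  by rewrite Normc.normc0 mulr0.
- by move=> g nK; rewrite /phi cind_out ?mulr0// => -[].
have coefE y p : L2 nu p -> inner mu u (translate y (plancherel_inv mu nu F p)) =
    cintegral nu (fun g : borel D => phi g * (p g)^* * (g : D) y).
  move=> L2p; rewrite (inner_translate_plancherel_inv mu_haar hG scG F_plancherel)//.
  have mh (h : borel D -> R[i]) : L2 nu h ->
      cmeasurable (fun g : borel D => h g * (p g)^* * (g : D) y).
    move=> L2h; apply: cmeasurableM; last exact: eval_cmeasurable.
    exact: cintegrable_meas (cintegrable_inner L2h L2p).
  by apply: ae_eq_cintegral; [exact: mh|exact: mh|apply: aeS Fu => g ->].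
apply: eq_esum => -[l _|[k [m l]] [Ik Ik1 _]]; congr ((Normc.normc _) ^+ 2)%:E.
  exact: coefE (Phi_L2 (consecutive_first I_consecutive)).
exact: coefE (Psi_L2 m Ik Ik1).
Qed.

End System.

Theorem corollary3p6 (R : realType) (G : topologicalZmodType)
  (lcaG : lca_group R G)
  (mu : {measure set (borel G) -> \bar R})
  (nu : {measure set (borel (dual_group R G)) -> \bar R})
  (mu_haar : haar_measure mu) (nu_haar : haar_measure nu)
  (mu_nu : fourier_inversion mu nu)
  (F : (borel G -> R[i]) -> (borel (dual_group R G) -> R[i]))
  (F_plancherel : plancherel_transform mu nu F)
  (k0 : int) (I : set int) (I_consecutive : consecutive_integers k0 I)
  (Lam : int -> set G)
  (Lam_lattice : forall k, I k -> lattice (Lam k))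
  (Lam_nested : forall k, I k -> I (k + 1) -> Lam k `<=` Lam (k + 1))
  (V : int -> set (dual_group R G))
  (V_domain : forall k, I k ->
    fundamental_domain nu (annihilator (Lam k)) (V k))
  (Phi : int -> dual_group R G -> R[i])
  (Phi_L2 : forall k, I k -> L2 nu (Phi k))
  (cond_i : forall S : set (dual_group R G), compact S ->
    exists2 K1, I K1 & forall omega omega' : dual_group R G,
      annihilator (Lam K1) omega -> annihilator (Lam K1) omega' ->
      omega <> omega' ->
      nu ((+%R omega @` S) `&` (+%R omega' @` S)) = 0%E)
  (cond_ii : forall S : set (dual_group R G), compact S ->
    forall eps : R, 0 < eps ->
    exists2 K2, I K2 & forall k, I k -> K2 <= k ->
      forall gamma, S gamma ->
        `| fine (nu (V k)) * Normc.normc (Phi k gamma) ^+ 2 - 1 | <= eps)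
  (H : int -> dual_group R G -> R[i])
  (H_periodic : forall k, I k -> I (k + 1) ->
    periodic_Linfty nu (annihilator (Lam (k + 1))) (V (k + 1)) (H (k + 1)))
  (cond_iii : forall k, I k -> I (k + 1) ->
    {ae nu, forall gamma,
      Phi k gamma = H (k + 1) gamma * Phi (k + 1) gamma})
  (rho : int -> nat)
  (Gm : forall k, 'I_(rho k) -> dual_group R G -> R[i])
  (Gm_periodic : forall k, I k -> I (k + 1) -> forall m,
    periodic_Linfty nu (annihilator (Lam (k + 1))) (V (k + 1)) (Gm k m))
  (d : int -> nat)
  (d_index : forall k, I k -> I (k + 1) ->
    has_index (annihilator (R := R) (Lam k)) (annihilator (Lam (k + 1))) (d k))
  (reps : forall k, 'I_(d k) -> dual_group R G)
  (reps_cosets : forall k, I k -> I (k + 1) ->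
    coset_representatives (annihilator (Lam k)) (annihilator (Lam (k + 1)))
      (reps k))
  (reps_0 : forall k, I k -> I (k + 1) ->
    forall l : 'I_(d k), l = 0%N :> nat -> reps k l = 0)
  (P_unitary : forall k, I k -> I (k + 1) ->
    {ae nu, forall gamma, V k gamma ->
      (Pmx (H (k + 1)) (Gm k) (reps k) gamma)^t* *m
        Pmx (H (k + 1)) (Gm k) (reps k) gamma = ((d k)%:R)%:M}) :
  tight_frame mu (gsi_support (rho := rho) I k0 Lam)
    (gsi_system (plancherel_inv mu nu F (Phi k0))
       (fun k m => plancherel_inv mu nu F (Psi Phi Gm k m)))
    1.
Proof.
exact: (gsi_system_tight_frame lcaG mu_haar nu_haar F_plancherel I_consecutive Lam_lattice
  Lam_nested V_domain Phi_L2 cond_i cond_ii H_periodic cond_iii Gm_periodic reps_cosets P_unitary).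
Qed.
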